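(* Let $f$ and $g$ be two rational functions with $\operatorname{supp}(f)\subset\mathbb{D}$ and $\operatorname{supp}(g)\subset\mathbb{P}\setminus\overline{\mathbb{D}}$, and put $h=f/g$. Then the multiplicative commutator $$T(g)T(f)^{-1}T(g)^{-1}T(f)$$ is of determinant class, and $$\begin{aligned}\mathcal{R}(f,g)&=\det T\Big(\frac fg\Big)T\Big(\frac gf\Big)=\det\big[T(f)^{-1}T(g)T(f)T(g)^{-1}\big]\\&=\lim_{N\to\infty}\Big(\frac{g(0)}{f(\infty)}\Big)^N\det t_N\Big(\frac fg\Big)=\exp\sum_{k=1}^\infty k(\mathrm{Log}\,h)_k(\mathrm{Log}\,h)_{-k}.\end{aligned}$$
   Context: $\mathbb{D}$ is the open unit disk, $\mathbb{T}=\partial\mathbb{D}$, $\mathbb{P}$ the Riemann sphere. $\operatorname{supp}(f)$ is the support of the divisor of $f$ on $\mathbb{P}$, i.e. the set of its zeros and poles. The meromorphic resultant of rational functions with divisors of disjoint supports is $\mathcal{R}(f,g)=\prod_{a\in\mathbb{P}}g(a)^{\operatorname{ord}_a(f)}$. For a bounded function $\varphi$ on $\mathbb{T}$, $T(\varphi)$ is the Toeplitz operator $\phi\mapsto P_+(\varphi\phi)$ on the Hardy space $H^2(\mathbb{D})$, where $P_+:L^2(\mathbb{T})\to H^2(\mathbb{D})$ is the orthogonal projection. An operator is of determinant class if it differs from the identity by a trace class operator; $\det$ of such an operator is the Fredholm determinant. For $N\ge1$, $t_N(\varphi)=(\varphi_{i-j})_{1\le i,j\le N}$, where $\varphi_k=\frac1{2\pi}\int_0^{2\pi}e^{-ik\theta}\varphi(e^{i\theta})\,d\theta$.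 The function $h=f/g$ is holomorphic and nonvanishing in a neighbourhood of $\mathbb{T}$ with winding number $0$ along $\mathbb{T}$; $\mathrm{Log}\,h$ is any single-valued branch of $\log h$ near $\mathbb{T}$, and $(\mathrm{Log}\,h)_k=\frac{1}{2\pi}\int_0^{2\pi}e^{-ik\theta}\,\mathrm{Log}\,h(e^{i\theta})\,d\theta$. *)

(* Defs.v *)
From HB Require Import structures.
From mathcomp Require Import all_boot all_order all_algebra.
From mathcomp Require Import fraction generic_quotient.
From mathcomp Require Import all_classical all_reals all_analysis.
From mathcomp Require Import complex.

Set Implicit Arguments.
Unset Strict Implicit.
Unset Printing Implicit Defensive.

Import Order.TTheory GRing.Theory Num.Theory.
Import numFieldNormedType.Exports.

Local Open Scope classical_set_scope.
Local Open Scope ring_scope.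
Local Open Scope complex_scope.

(* The library attaches the metric topology of the field R[i] to the alias
   R[i]^o; limits of complex sequences are therefore taken in R[i]^o. *)

Section RationalFunctions.
Context (R : realType).
Local Notation C := R[i].
(* The Riemann sphere: [Some z] is the finite point z, [None] is infinity. *)
Local Notation P := (option C).
Implicit Type f g : {fraction {poly C}}.

(* Numerator and denominator in lowest terms. *)
Definition rnum f : {poly C} :=
  let: (p, q) := frac (repr f) in p %/ gcdp p q.
Definition rden f : {poly C} :=
  let: (p, q) := frac (repr f) in q %/ gcdp p q.

(* [mup z p] is the multiplicity of z as a root of p; at infinity the order is
   deg (rden f) - deg (rnum f).  Meaningful for f != 0. *)
Definition ord (a : P) f : int :=
  if a is Some z then (mup z (rnum f))%:Z - (mup z (rden f))%:Z
  else (size (rden f))%:Z - (size (rnum f))%:Z.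

Definition supp f : set P := [set a | ord a f != 0].

(* The value f(a), for a not a pole of f (an arbitrary number otherwise).  At
   infinity the coefficient of index deg (rden f) of the numerator is its
   leading coefficient when f(oo) != 0, and is 0 when f has a zero at oo. *)
Definition rval f (a : P) : C :=
  if a is Some z then (rnum f).[z] / (rden f).[z]
  else (rnum f)`_(size (rden f)).-1 / lead_coef (rden f).

(* Finitely supported product over the whole sphere. *)
Definition meromorphic_resultant f g : C :=
  \big[*%R/1]_(a \in [set: P]) rval g a ^ ord a f.

Definition unit_disk : set P :=
  [set a | exists2 z : C, a = Some z & `|z| < 1].
Definition closed_unit_disk : set P :=
  [set a | exists2 z : C, a = Some z & `|z| <= 1].

Definition symbol f : C -> C := fun z => rval f (Some z).

End RationalFunctions.

Section HardySpace.
Context (R : realType).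
Local Notation C := R[i].
Local Notation mu := (@lebesgue_measure R).
Local Notation arc := (`[0, 2 * pi]%classic : set R).

(* Functions on the unit circle are represented by functions u : C -> C, of
   which only the values at the points e^(it), 0 <= t <= 2 pi, matter. *)
Definition cis (t : R) : C := cos t +i* sin t.

(* (2 pi)^-1 times the integral of u(e^(it)) over [0, 2 pi]. *)
Definition circle_mean (u : C -> C) : C :=
  ((2 * pi)^-1 * \int[mu]_(t in arc) complex.Re (u (cis t)))
  +i* ((2 * pi)^-1 * \int[mu]_(t in arc) complex.Im (u (cis t))).

(* z ^ (- k) is e^(-ikt) at z = e^(it). *)
Definition fourier (u : C -> C) (k : int) : C :=
  circle_mean (fun z => z ^ (- k) * u z).

Definition L2 (u : C -> C) : Prop :=
  [/\ measurable_fun arc (fun t => complex.Re (u (cis t))),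
      measurable_fun arc (fun t => complex.Im (u (cis t))) &
      (\int[mu]_(t in arc)
        (complex.Re (u (cis t)) ^+ 2 + complex.Im (u (cis t)) ^+ 2)%:E
       < +oo)%E].

(* Equality in L2, i.e. almost everywhere on the circle. *)
Definition eqT (u v : C -> C) : Prop :=
  {ae mu, forall t, arc t -> u (cis t) = v (cis t)}.

Definition dot (u v : C -> C) : C := circle_mean (fun z => u z * (v z)^*).
Definition norm2 (u : C -> C) : R := Num.sqrt (complex.Re (dot u u)).

(* H^2(D), as the closed subspace of L2(T) of boundary values. *)
Definition hardy (u : C -> C) : Prop :=
  L2 u /\ forall k : int, k < 0 -> fourier u k = 0.

(* Orthogonal projection of L2 onto the Hardy space: a representative of the
   (unique up to eqT) w in H^2 such that v - w is orthogonal to H^2. *)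
Definition hardy_proj (v : C -> C) : C -> C :=
  xget (fun=> 0) [set w | hardy w /\
    forall u, hardy u -> dot (fun z => v z - w z) u = 0].

Definition toeplitz (phi : C -> C) (u : C -> C) : C -> C :=
  hardy_proj (fun z => phi z * u z).

(* Operators on H^2 act on representatives.  A bounded linear operator in the
   sense below is automatically compatible with eqT. *)
Definition bounded_op (A : (C -> C) -> (C -> C)) : Prop :=
  [/\ forall u, hardy u -> hardy (A u),
      forall (a : C) u v, hardy u -> hardy v ->
        eqT (A (fun z => a * u z + v z)) (fun z => a * A u z + A v z) &
      exists M : R, forall u, hardy u -> norm2 (A u) <= M * norm2 u].

Definition inverse_ops (A B : (C -> C) -> (C -> C)) : Prop :=
  [/\ bounded_op A, bounded_op B &
      forall u, hardy u -> eqT (A (B u)) u /\ eqT (B (A u)) u].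

Definition invertible_op (A : (C -> C) -> (C -> C)) : Prop :=
  exists B, inverse_ops A B.

Definition op_inv (A : (C -> C) -> (C -> C)) : (C -> C) -> (C -> C) :=
  xget (fun u : C -> C => u) [set B | inverse_ops A B].

(* B is the modulus |A| = (A^* A)^(1/2): B is positive (hence self-adjoint) and
   B^2 = A^* A, the latter written as <B u, B v> = <A u, A v>. *)
Definition modulus_op (A B : (C -> C) -> (C -> C)) : Prop :=
  [/\ bounded_op B,
      forall u, hardy u -> 0 <= dot (B u) u &
      forall u v, hardy u -> hardy v -> dot (B u) (B v) = dot (A u) (A v)].

(* The orthonormal basis of H^2. *)
Definition monom (n : nat) : C -> C := fun z => z ^+ n.

(* |A| has finite trace. *)
Definition trace_class (A : (C -> C) -> (C -> C)) : Prop :=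
  bounded_op A /\
  exists2 B, modulus_op A B &
    cvgn (series (fun n => dot (B (monom n)) (monom n) : C^o)).

Definition sub_id (A : (C -> C) -> (C -> C)) : (C -> C) -> (C -> C) :=
  fun u z => A u z - u z.

Definition determinant_class (A : (C -> C) -> (C -> C)) : Prop :=
  trace_class (sub_id A).

(* The N x N upper-left corner of the matrix of A in the basis z^n. *)
Definition corner (A : (C -> C) -> (C -> C)) (N : nat) : 'M[C]_N :=
  \matrix_(i < N, j < N) dot (A (monom j)) (monom i).

(* The trace of the k-th exterior power of A:
   (k!)^-1 \sum_(i_1, ..., i_k) det (<A z^(i_q), z^(i_p)>)_(p, q). *)
Definition trace_ext (A : (C -> C) -> (C -> C)) (k : nat) : C :=
  limn (fun N => (k`!%:R^-1 *
    \sum_(s : {ffun 'I_k -> 'I_N}) \det (mxsub s s (corner A N))) : C^o).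

(* det (1 + A) = \sum_k tr (Lambda^k A), for A trace class. *)
Definition fredholm_det (B : (C -> C) -> (C -> C)) : C :=
  limn (series (fun k => trace_ext (sub_id B) k : C^o)).

Definition toeplitz_mx (phi : C -> C) (N : nat) : 'M[C]_N :=
  \matrix_(i < N, j < N) fourier phi (i%:Z - j%:Z).

Definition cexp (z : C) : C := (expR (complex.Re z))%:C * cis (complex.Im z).

(* L is a single-valued branch of log h in a neighbourhood of the unit circle;
   a continuous branch of the logarithm of a holomorphic function is
   holomorphic. *)
Definition log_branch (h L : C -> C) : Prop :=
  exists U : set C^o,
    [/\ open U, (forall z : C, `|z| = 1 -> U z),
        {in U, continuous (L : C^o -> C^o)} &
        forall z, U z -> cexp (L z) = h z].

End HardySpace.

(* Main.v *)
Require Import Defs.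
From HB Require Import structures.
From mathcomp Require Import all_boot all_order all_algebra.
From mathcomp Require Import fraction generic_quotient.
From mathcomp Require Import all_classical all_reals all_analysis.
From mathcomp Require Import complex.
From mathcomp Require Import perm measurable_realfun.
From mathcomp Require Import ring lra.

Set Implicit Arguments.
Unset Strict Implicit.
Unset Printing Implicit Defensive.

Import Order.TTheory GRing.Theory Num.Theory.
Import numFieldNormedType.Exports.

Local Open Scope classical_set_scope.
Local Open Scope ring_scope.

(** The function [g] and its inverse are holomorphic near the closed disk, so
    that [T(g)] is multiplication by [g] and [T(g)^-1] multiplication by [1/g].
    The function [f] is [c P / Q] with [c = f(oo)] and [P], [Q] monic of the same
    degree, all of whose roots lie in the disk; [T(f)] maps [u] to
    [c (P u - r) / Q], with [r] the remainder of [P u] modulo [Q]. Indeed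
    [(P u - r) / Q] belongs to the Hardy space ([hardy_quotient]) and [r / Q] is
    orthogonal to it ([hardy_perp_frac]). The remainder of a Hardy function is
    defined by Cauchy's formula ([hrem]). In particular [T(1/f) = T(f)^-1].

    The operators of the theorem have the form [T(a) T(1/f) T(b) T(f) T(a b)^-1], up
    to the exchange of [f] and [1/f], with [a] and [b] among [1], [g] and [1/g]. The
    multiplications by [b] and [1/b] on both sides of [T(f)] would cancel but for the
    remainders, which are polynomials of degree less than that of [Q]; thus such an
    operator is the identity plus an operator of finite rank factoring through
    [C[z]/Q] ([toeplitz_sandwich]). For it, everything reduces to matrices: it is of
    trace class because its modulus can be found by solving a matrix equation
    ([psdmx_modulus], [finite_rank_trace_class]), and its Fredholm determinant is an
    ordinary determinant of size [deg Q], which is also the limit of the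
    determinants of its corners ([finite_rank_fredholm_det]). By Sylvester's
    identity ([det1D_mulmxC]) this determinant is that of multiplication by [b]
    modulo [P] followed by multiplication by [1/b] modulo [Q]
    ([toeplitz_commutator_det]). The eigenvalues of multiplication by [b] modulo a
    polynomial are the values of [b] at its roots ([det_mult_mx_frac]), whence the
    product of the values of [b] over the zeros of [f], divided by that over the
    poles: for [b = g] this is the resultant.

    The truncated Toeplitz determinants come from the operator
    [T(g) T(f) T(1/g) T(1/f)]. In the basis of monomials [T(g)] is lower triangular,
    with diagonal [g(0)], and [T(1/f)] is upper triangular, with diagonal
    [1/f(oo)], as it maps [z^j] to the polynomial part of [z^j / f]; between them
    stands the matrix of [T(f/g)]. Hence the corner of size [N] has determinant
    [(g(0)/f(oo))^N det t_N(f/g)] ([toeplitz_corner]), and this tends to the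
    Fredholm determinant, which is the resultant.

    Finally [Log h] is differentiated along the circle. Its derivative is a
    combination of the [z / (z - a)] over the zeros and poles of [h], whose Fourier
    coefficients are powers of [a] or [1/a]; after an integration by parts
    ([fourier_log]) the products [k (Log h)_k (Log h)_(-k)] become combinations of
    the [(a/b)^k / k], with [a] a zero or pole inside the disk and [b] one outside.
    They sum up to logarithms of the [1 - a/b] ([log_sum_limit]), and the exponential
    of the total is the resultant ([szego_sum_limit]). *)

(** * Determinants: principal minors and companion matrices *)

(** Both determinants are that of the block matrix [1, -A; B, 1], which factors
    as block lower times block upper triangular in two ways. *)
Lemma det1D_mulmxC (F : comUnitRingType) m n (A : 'M[F]_(m, n)) (B : 'M[F]_(n, m)) :
  \det (1%:M + A *m B) = \det (1%:M + B *m A).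
Proof.
pose X : 'M[F]_(m + n) := block_mx 1%:M (- A) B 1%:M.
have e1 : X *m block_mx 1%:M 0 (- B) 1%:M = block_mx (1%:M + A *m B) (- A) 0 1%:M.
  rewrite mulmx_block !mul1mx !mulmx1 !mulmx0 !add0r mulNmx mulmxN opprK.
  by rewrite subrr.
have e2 : block_mx 1%:M 0 (- B) 1%:M *m X = block_mx 1%:M (- A) 0 (1%:M + B *m A).
  rewrite mulmx_block !mul1mx !mulmx1 !mul0mx !addr0 mulNmx mulmxN opprK.
  by rewrite addNr addrC.
have := congr1 determinant e1; have := congr1 determinant e2.
rewrite !det_mulmx !det_lblock !det_ublock !det1 !mul1r !mulr1 => <- <-.
by [].
Qed.

(** [k! * tr (Lambda^k X)], summed over all k-tuples of indices. *)
Definition minor_sum (F : comPzRingType) k N (X : 'M[F]_N) : F :=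
  \sum_(s : {ffun 'I_k -> 'I_N}) \det (mxsub s s X).

(** Expand every determinant and every matrix product; the two sides then
    exchange the two families of indices, after the substitution [s o sigma]. *)
Lemma minor_sum_mulC (F : comPzRingType) k N n (U : 'M[F]_(N, n)) (V : 'M[F]_(n, N)) :
  minor_sum k (U *m V) = minor_sum k (V *m U).
Proof.
have expand a b (A : 'M[F]_(a, b)) (B : 'M[F]_(b, a)) : minor_sum k (A *m B) =
    \sum_(sg : 'S_k) \sum_(s : {ffun 'I_k -> 'I_a}) \sum_(t : {ffun 'I_k -> 'I_b})
       (-1) ^+ sg * \prod_i (A (s i) (t i) * B (t i) (s (sg i))).
  rewrite /minor_sum /determinant exchange_big /=; apply: eq_bigr => sg _.
  apply: eq_bigr => s _.
  rewrite -mulr_sumr; congr (_ * _).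
  rewrite -(bigA_distr_bigA (fun i j => A (s i) j * B j (s (sg i)))).
  by apply: eq_bigr => i _; rewrite !mxE.
rewrite !expand; apply: eq_bigr => sg _.
rewrite exchange_big /=; apply: eq_bigr => t _.
pose act (h : {perm 'I_k}) (s : {ffun 'I_k -> 'I_N}) := [ffun i => s (h i)].
have actK h : cancel (act h) (act h^-1%g).
  by move=> s; apply/ffunP=> i; rewrite !ffunE permKV.
rewrite (reindex (act sg^-1%g)) /=; last first.
  apply: onW_bij; exists (act sg); last exact: actK.
  by move=> s; rewrite -{1}(invgK sg) actK.
apply: eq_bigr => s _; congr (_ * _); rewrite !big_split /= mulrC; congr (_ * _).
  by apply: eq_bigr => i _; rewrite ffunE permK.
rewrite (reindex_inj (@perm_inj _ sg)) /=.
by apply: eq_bigr => i _; rewrite ffunE permK.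
Qed.

Lemma det_mxsub_noninj (F : comPzRingType) k N (X : 'M[F]_N) (s : {ffun 'I_k -> 'I_N}) :
  ~~ injectiveb s -> \det (mxsub s s X) = 0.
Proof.
case/injectivePn=> i [j nij sij].
apply: (determinant_alternate nij) => l; by rewrite !mxE sij.
Qed.

(** A tuple longer than the dimension repeats an index, hence a row. *)
Lemma minor_sum_gt (F : comPzRingType) k N (X : 'M[F]_N) :
  (N < k)%N -> minor_sum k X = 0.
Proof.
move=> Nk; apply: big1 => s _; apply: det_mxsub_noninj.
by apply/negP=> /injectiveP /leq_card; rewrite !card_ord leqNgt Nk.
Qed.

(** The rows outside the image of [s] being those of the identity, the matrix is
    [1 + J (J^T (X - 1))] with [J] the 0-1 matrix of [s], and [J^T J = 1]. *)
Lemma det_mxsub_inj (F : comUnitRingType) k N (X : 'M[F]_N) (s : {ffun 'I_k -> 'I_N}) :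
  injective s ->
  \det (\matrix_(i, j) (if i \in codom s then X i j else (i == j)%:R)) =
  \det (mxsub s s X).
Proof.
move=> s_inj; pose J : 'M[F]_(N, k) := \matrix_(i, l) (i == s l)%:R.
have -> : \matrix_(i, j) (if i \in codom s then X i j else (i == j)%:R) =
    1%:M + J *m (J^T *m (X - 1%:M)).
  apply/matrixP=> i j; rewrite !mxE.
  have JX l : (J^T *m (X - 1%:M)) l j = X (s l) j - (s l == j)%:R.
    rewrite mxE (bigD1 (s l)) //= !mxE eqxx mul1r big1 ?addr0 // => m ml.
    by rewrite !mxE (negbTE ml) mul0r.
  case: ifPn => [/codomP[l ->]|il].
    rewrite (bigD1 l) //= JX !mxE eqxx mul1r big1 ?addr0; first by ring.
    by move=> m ml; rewrite !mxE inj_eq // eq_sym (negbTE ml) mul0r.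
  rewrite big1 ?addr0 // => l _; rewrite !mxE; case: eqP => [e|]; last by rewrite mul0r.
  by rewrite e codom_f in il.
rewrite det1D_mulmxC -mulmxA; congr (\det _); apply/matrixP=> a b.
have XJ i : ((X - 1%:M) *m J) i b = X i (s b) - (i == s b)%:R.
  rewrite mxE (bigD1 (s b)) //= !mxE eqxx mulr1 big1 ?addr0 // => m mb.
  by rewrite !mxE (negbTE mb) mulr0.
rewrite !mxE (bigD1 (s a)) //= XJ !mxE eqxx mul1r big1 ?addr0.
  by rewrite inj_eq //; ring.
by move=> m ma; rewrite !mxE (negbTE ma) mul0r.
Qed.

(** Expand [det (1 + X)] along subsets of rows; a subset of cardinal [k] is the
    image of [k!] injective tuples. *)
Lemma det1D_minor_sum (F : numFieldType) N (X : 'M[F]_N) :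
  \det (1%:M + X) = \sum_(k < N.+1) k`!%:R^-1 * minor_sum k X.
Proof.
pose G (S : {set 'I_N}) := \det (\matrix_(i, j) (if i \in S then X i j else (i == j)%:R)).
have -> : \det (1%:M + X) = \sum_(S : {set 'I_N}) G S.
  rewrite /G /determinant exchange_big /=; apply: eq_bigr => sg _.
  rewrite -mulr_sumr; congr (_ * _).
  rewrite (eq_bigr (fun i => X i (sg i) + (i == sg i)%:R)) => [|i _]; last first.
    by rewrite !mxE addrC.
  rewrite bigA_distr; apply: eq_bigr => S _; apply: eq_bigr => i _.
  by rewrite mxE.
rewrite (partition_big (fun S : {set 'I_N} => inord #|S| : 'I_N.+1) xpredT) //=.
apply: eq_bigr => k _.
rewrite (eq_bigl (fun S : {set 'I_N} => #|S| == k)) => [|S]; last first.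
  rewrite -val_eqE /= inordK // ltnS.
  by rewrite -[X in (_ <= X)%N](card_ord N) max_card.
have kfact0 : k`!%:R != 0 :> F by rewrite pnatr_eq0 -lt0n fact_gt0.
apply: (mulfI kfact0); rewrite mulrA divff // mul1r.
have -> : minor_sum k X = \sum_(s : {ffun 'I_k -> 'I_N} | injectiveb s) G [set i in codom s].
  rewrite /minor_sum [RHS]big_mkcond; apply: eq_bigr => s _.
  case: ifPn => [/injectiveP s_inj|]; last exact: det_mxsub_noninj.
  rewrite -det_mxsub_inj //; congr (\det _); apply/matrixP=> i j.
  by rewrite !mxE inE.
rewrite (partition_big (fun s : {ffun 'I_k -> 'I_N} => [set i in codom s])
           (fun S : {set 'I_N} => #|S| == k)) /=; last first.
  move=> s /injectiveP s_inj; rewrite cardsE card_codom // card_ord; exact/eqP.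
rewrite mulr_sumr; apply: eq_bigr => S /eqP cS.
rewrite (eq_bigr (fun _ => G S)) => [|s /andP[_ /eqP->]] //.
rewrite sumr_const mulr_natl; congr (_ *+ _).
have := card_inj_ffuns_on 'I_k (mem S); rewrite card_ord cS ffactnn => <-.
apply: eq_card => s; rewrite inE [RHS]unfold_in andbC.
case: (boolP (injectiveb s)) => //= /injectiveP s_inj.
have cs : #|[set i in codom s]| = k by rewrite cardsE card_codom // card_ord.
apply/ffun_onP/eqP => [sS|<- i]; last by rewrite !inE codom_f.
apply/eqP; rewrite eqEcard cs cS leqnn andbT; apply/fintype.subsetP=> j.
by rewrite inE => /codomP[l ->]; exact: sS.
Qed.

(** ** Square roots of positive semidefinite matrices *)

Section PositiveMatrices.
Context (C : numClosedFieldType).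
Local Open Scope sesquilinear_scope.

Definition psdmx n (M : 'M[C]_n) : Prop :=
  M ^t* = M /\ forall x : 'rV_n, 0 <= (x *m M *m x ^t*) 0 0.

Lemma trmxC_mul m n p (A : 'M[C]_(m, n)) (B : 'M[C]_(n, p)) :
  (A *m B) ^t* = B ^t* *m A ^t*.
Proof. by rewrite trmx_mul map_mxM. Qed.

Lemma psdmx_congr n m (M : 'M[C]_n) (Y : 'M[C]_(m, n)) :
  psdmx M -> psdmx (Y *m M *m Y ^t*).
Proof.
case=> hM pM; split; first by rewrite !trmxC_mul trmxCK hM mulmxA.
by move=> x; have := pM (x *m Y); rewrite trmxC_mul !mulmxA.
Qed.

(** The spectral theorem; the last clause makes the signs of the eigenvalues
    available. *)
Lemma psdmx_diag n (M : 'M[C]_n) : psdmx M ->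
  exists P (d : 'rV_n), [/\ P *m P ^t* = 1%:M, P ^t* *m P = 1%:M,
    M = P ^t* *m diag_mx d *m P & forall i, d 0 i = (row i P *m M *m (row i P) ^t*) 0 0].
Proof.
move=> [hM pM]; have nM : M \is normalmx.
  by apply: hermitian_normalmx; apply/is_hermitianmxP; rewrite expr0 scale1r hM.
have uP := spectral_unitarymx M; have /orthomx_spectralP := nM.
set P := spectralmx M in uP *; set d := spectral_diag M => eM.
have PP : P *m P ^t* = 1%:M by apply/unitarymxP.
have PP' : P ^t* *m P = 1%:M by exact: mulmx1C.
rewrite invmx_unitary // in eM.
exists P, d; split => // i.
rewrite rowE trmxC_mul [in RHS]eM !mulmxA -(mulmxA _ P) PP mulmx1.
rewrite -(mulmxA _ P) PP mulmx1 -rowE row_diag_mx.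
by rewrite trmx_delta map_delta_mx -scalemxAl mul_delta_mx !mxE eqxx mulr1.
Qed.

Lemma psdmx_sqrt n (M : 'M[C]_n) : psdmx M -> exists2 E, psdmx E & E *m E = M.
Proof.
move=> pM; have [P [d [PP PP' eM dE]]] := psdmx_diag pM.
have d0 i : 0 <= d 0 i by rewrite dE; case: pM.
pose e : 'rV_n := map_mx sqrtC d.
exists (P ^t* *m diag_mx e *m P).
  rewrite -{2}[P]trmxCK; apply: psdmx_congr; split.
    rewrite tr_diag_mx map_diag_mx; congr diag_mx; apply/rowP=> i; rewrite !mxE.
    by rewrite /= conj_Creal // ger0_real // sqrtC_ge0.
  move=> x; rewrite mul_mx_diag !mxE; apply: sumr_ge0 => i _.
  by rewrite !mxE mulrAC mulr_ge0 ?mul_conjC_ge0 // sqrtC_ge0.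
rewrite !mulmxA -[_ *m P *m P ^t*]mulmxA PP mulmx1 -[_ *m diag_mx e *m diag_mx e]mulmxA.
rewrite mulmx_diag [RHS]eM; congr (_ *m diag_mx _ *m _); apply/rowP=> i.
by rewrite !mxE -expr2 sqrtCK.
Qed.

(** [Y] diagonalises [P] with eigenvalues normalised to 1, so that the equation
    becomes [E E = Y^-1 Q Y^-*] for [X = Y E Y^*]. *)
Lemma psdmx_modulus n (P Q : 'M[C]_n) :
  psdmx P -> (forall x : 'rV_n, (x *m P *m x ^t*) 0 0 = 0 -> x = 0) -> psdmx Q ->
  exists2 X, psdmx X & X *m P *m X = Q.
Proof.
move=> pP defP pQ; have [W [d [WW WW' eP dE]]] := psdmx_diag pP.
have d0 i : 0 < d 0 i.
  rewrite lt0r dE; apply/andP; split; last by case: pP.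
  apply/eqP=> /defP /(congr1 (mulmx^~ (W ^t*))).
  rewrite mul0mx -row_mul WW row1 => /rowP/(_ i); rewrite !mxE !eqxx => /eqP.
  by rewrite oner_eq0.
pose e : 'rV_n := map_mx (fun z => (sqrtC z)^-1) d.
pose e' : 'rV_n := map_mx sqrtC d.
have ee' : diag_mx e *m diag_mx e' = 1%:M.
  rewrite mulmx_diag -diag_const_mx; congr diag_mx; apply/rowP=> i.
  by rewrite !mxE mulVf // sqrtC_eq0 gt_eqF.
have eC (f : C -> C) : (forall x, 0 <= x -> 0 <= f x) ->
    (diag_mx (map_mx f d)) ^t* = diag_mx (map_mx f d).
  move=> f0; rewrite tr_diag_mx map_diag_mx; congr diag_mx; apply/rowP=> i.
  by rewrite !mxE /= conj_Creal // ger0_real // f0 // ltW.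
have eC1 : (diag_mx e) ^t* = diag_mx e.
  by apply: eC => x x0; rewrite invr_ge0 sqrtC_ge0.
have eC2 : (diag_mx e') ^t* = diag_mx e'.
  by apply: eC => x x0; rewrite sqrtC_ge0.
pose Y := W ^t* *m diag_mx e; pose Z := diag_mx e' *m W.
have YZ : Y *m Z = 1%:M.
  by rewrite /Y /Z mulmxA -(mulmxA _ (diag_mx e)) ee' mulmx1.
have ZY : Z *m Y = 1%:M by exact: mulmx1C.
have ZZ : Z ^t* *m Z = P.
  rewrite /Z trmxC_mul eC2 mulmxA -(mulmxA _ (diag_mx e') (diag_mx e')) mulmx_diag eP.
  congr (_ *m diag_mx _ *m _); apply/rowP=> i.
  by rewrite !mxE -expr2 sqrtCK.
have [E pE EE] := psdmx_sqrt (psdmx_congr Z pQ).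
exists (Y *m E *m Y ^t*); first exact: psdmx_congr.
have YCZ : Y ^t* *m Z ^t* = 1%:M by rewrite -trmxC_mul ZY trmx1 map_mx1.
have ZCY : Z ^t* *m Y ^t* = 1%:M by rewrite -trmxC_mul YZ trmx1 map_mx1.
clearbody Y Z.
rewrite -ZZ !mulmxA -(mulmxA _ (Y ^t*)) YCZ mulmx1 -(mulmxA _ Z) ZY mulmx1.
rewrite -(mulmxA _ E E) EE !mulmxA YZ mul1mx.
by rewrite -mulmxA ZCY mulmx1.
Qed.

End PositiveMatrices.

(** ** Companion matrices *)

(** The matrix of multiplication by ['X] modulo [q] in the basis [1, 'X, ..], on
    row vectors, for [q] monic of degree [n.+1]; it is [companionmx q] with its
    dimension in successor form. *)
Definition comp_mx (F : nzRingType) n (q : {poly F}) : 'M[F]_n.+1 :=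
  \matrix_(i, j) (if i == n :> nat then - q`_j else (i.+1 == j :> nat)%:R).

Lemma char_poly_comp_mx (F : comNzRingType) n (q : {poly F}) :
  q \is monic -> size q = n.+2 -> char_poly (comp_mx n q) = q.
Proof.
move=> qm sq; rewrite -[RHS]companionmxK //.
rewrite /companionmx /comp_mx; have : (size q).-1 = n.+1 by rewrite sq.
by move: (size q).-1 => m ->.
Qed.

Lemma comp_mx_root (F : comNzRingType) n (q : {poly F}) :
  q \is monic -> size q = n.+2 -> horner_mx (comp_mx n q) q = 0.
Proof. by move=> qm sq; rewrite -{2}(char_poly_comp_mx qm sq) Cayley_Hamilton. Qed.

Lemma prodr_const_size (F : pzSemiRingType) (T : Type) (s : seq T) (c : F) :
  \prod_(i <- s) c = c ^+ size s.
Proof. by rewrite big_const_seq count_predT -Monoid.iteropE. Qed.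

(** Both sides are multiplicative in [r]; for [r = 'X - z] they are the value at
    [z] of the characteristic polynomial, up to sign. *)
Lemma det_horner_mx (F : closedFieldType) n (A : 'M[F]_n.+1) (r : {poly F}) (rs : seq F) :
  char_poly A = \prod_(a <- rs) ('X - a%:P) ->
  \det (horner_mx A r) = \prod_(a <- rs) r.[a].
Proof.
move=> cA; have srs : size rs = n.+1.
  by apply: succn_inj; rewrite -(size_prod_XsubC rs id) -cA size_char_poly.
have [zs ->] := closed_field_poly_normal r.
move: (lead_coef r) => c; rewrite linearZ /= -mul_scalar_mx det_mulmx det_scalar.
rewrite rmorph_prod /= (eq_bigr (fun a => c * \prod_(z <- zs) (a - z))) => [|a _]; last first.
  rewrite hornerZ horner_prod; congr (_ * _).
  by apply: eq_bigr => z _; rewrite hornerXsubC.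
rewrite big_split /= prodr_const_size srs; congr (_ * _).
rewrite exchange_big /= (big_morph _ (@det_mulmx _ _) (det1 _ _)).
apply: eq_bigr => z _; rewrite rmorphB /= horner_mx_X horner_mx_C.
have -> : \prod_(a <- rs) (a - z) = (-1) ^+ n.+1 * (char_poly A).[z].
  rewrite cA horner_prod -srs -prodr_const_size -big_split /=; apply: eq_bigr => a _.
  by rewrite hornerXsubC mulN1r opprB.
rewrite /char_poly /char_poly_mx -horner_evalE -det_map_mx -detZ; congr (\det _).
apply/matrixP=> i j; rewrite !mxE /= /horner_eval hornerD hornerN hornerC hornerMn hornerX.
by rewrite mulN1r opprB.
Qed.

Arguments circle_mean : simpl never.
Arguments fourier : simpl never.
Arguments dot : simpl never.
Arguments norm2 : simpl never.

(** * Means over the unit circle *)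

Section CircleMean.
Context (R : realType).
Local Notation C := R[i].
Local Notation mu := (@lebesgue_measure R).
Local Notation arc := (`[0, 2 * pi]%classic : set R).
Local Notation Re := complex.Re.
Local Notation Im := complex.Im.
Local Notation "x %:C" := (real_complex_def (Phant R) x) : ring_scope.
Local Notation "x +i* y" := (Complex x y) : ring_scope.
Implicit Types (u v w : C -> C) (t : R) (a b z : C).

Lemma cJD a b : (a + b)^* = a^* + b^*. Proof. exact: rmorphD. Qed.
Lemma cJB a b : (a - b)^* = a^* - b^*. Proof. exact: rmorphB. Qed.
Lemma cJM a b : (a * b)^* = a^* * b^*. Proof. exact: rmorphM. Qed.
Lemma cJK a : a^*^* = a. Proof. exact: conjCK. Qed.
Lemma cJ_sum (I : Type) (s : seq I) (F : I -> C) :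
  (\sum_(i <- s) F i)^* = \sum_(i <- s) (F i)^*.
Proof. exact: rmorph_sum. Qed.

Lemma cReD a b : Re (a + b) = Re a + Re b. Proof. by case: a b => [? ?] []. Qed.
Lemma cImD a b : Im (a + b) = Im a + Im b. Proof. by case: a b => [? ?] []. Qed.
Lemma cReN a : Re (- a) = - Re a. Proof. by case: a. Qed.
Lemma cImN a : Im (- a) = - Im a. Proof. by case: a. Qed.
Lemma cReM a b : Re (a * b) = Re a * Re b - Im a * Im b.
Proof. by case: a b => [? ?] []. Qed.
Lemma cImM a b : Im (a * b) = Re a * Im b + Im a * Re b.
Proof. by case: a b => [? ?] []. Qed.
Lemma cReJ a : Re a^* = Re a. Proof. by case: a. Qed.
Lemma cImJ a : Im a^* = - Im a. Proof. by case: a. Qed.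
Lemma complex_ext a b : Re a = Re b -> Im a = Im b -> a = b.
Proof. by case: a b => [? ?] [? ?] /= -> ->. Qed.

(** The squared modulus as a real number: [`|z|] is itself of type [C]. *)
Definition abs2 z : R := Re z ^+ 2 + Im z ^+ 2.

Lemma abs2_ge0 z : 0 <= abs2 z. Proof. by rewrite addr_ge0 ?sqr_ge0. Qed.

Lemma mulcJ z : z * z^* = (abs2 z)%:C.
Proof. by apply: complex_ext; rewrite ?cReM ?cImM cReJ cImJ /abs2 /=; ring. Qed.

Lemma abs2M a b : abs2 (a * b) = abs2 a * abs2 b.
Proof. by rewrite /abs2 cReM cImM; ring. Qed.

Lemma abs2_1 : abs2 1 = 1. Proof. by rewrite /abs2 /= expr1n expr0n addr0. Qed.

Lemma abs2X a n : abs2 (a ^+ n) = abs2 a ^+ n.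
Proof. by elim: n => [|n IH]; rewrite ?abs2_1 // !exprS abs2M IH. Qed.

Lemma abs2D a b : abs2 (a + b) <= 2 * abs2 a + 2 * abs2 b.
Proof.
rewrite /abs2 cReD cImD -subr_ge0.
have -> : 2 * (Re a ^+ 2 + Im a ^+ 2) + 2 * (Re b ^+ 2 + Im b ^+ 2) -
   ((Re a + Re b) ^+ 2 + (Im a + Im b) ^+ 2) =
   (Re a - Re b) ^+ 2 + (Im a - Im b) ^+ 2 by ring.
by rewrite addr_ge0 ?sqr_ge0.
Qed.

Lemma abs2_eq0 z : abs2 z = 0 -> z = 0.
Proof.
move=> /eqP; rewrite paddr_eq0 ?sqr_ge0 // !sqrf_eq0 => /andP[/eqP ra /eqP ia].
exact: complex_ext.
Qed.

Lemma cis_abs2 t : abs2 (cis t) = 1. Proof. by rewrite /abs2 /= cos2Dsin2. Qed.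

Lemma cis_neq0 t : cis t != 0.
Proof.
apply/eqP=> e; have := cis_abs2 t; rewrite e /abs2 /= expr0n addr0 => /eqP.
by rewrite eq_sym oner_eq0.
Qed.

Lemma cisD t t' : cis (t + t') = cis t * cis t'.
Proof.
by apply: complex_ext; rewrite ?cReM ?cImM /= ?cosD ?sinD //; ring.
Qed.

Lemma cisN t : cis (- t) = (cis t)^-1.
Proof.
apply: (mulIf (cis_neq0 t)); rewrite mulVf ?cis_neq0 // -cisD addNr.
by rewrite /cis cos0 sin0.
Qed.

Lemma cis_conj t : (cis t)^* = (cis t)^-1.
Proof. by apply: complex_ext; rewrite ?cReJ ?cImJ -cisN /= ?cosN ?sinN. Qed.

Lemma cisX t (k : int) : cis t ^ k = cis (k%:~R * t).
Proof.
have cisXn n : cis t ^+ n = cis (n%:R * t).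
  elim: n => [|n IH]; first by rewrite expr0 mul0r /cis cos0 sin0.
  by rewrite exprS IH -cisD -[n.+1]add1n natrD mulrDl mul1r.
case: k => n; first by rewrite -exprnP cisXn.
by rewrite NegzE -exprnN cisXn -cisN mulrNz mulNr.
Qed.

Lemma measurable_arc : measurable (arc : set (measurableTypeR R)).
Proof. exact: measurable_itv. Qed.

Local Notation ReT u := (fun t : R => Re (u (cis t))).
Local Notation ImT u := (fun t : R => Im (u (cis t))).

Let ReTD u v : ReT (fun z => u z + v z) = ReT u \+ ReT v.
Proof. by apply/funext=> t; rewrite cReD. Qed.
Let ImTD u v : ImT (fun z => u z + v z) = ImT u \+ ImT v.
Proof. by apply/funext=> t; rewrite cImD. Qed.
Let ReTM u v : ReT (fun z => u z * v z) = (ReT u \* ReT v) \- (ImT u \* ImT v).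
Proof. by apply/funext=> t; rewrite cReM. Qed.
Let ImTM u v : ImT (fun z => u z * v z) = (ReT u \* ImT v) \+ (ImT u \* ReT v).
Proof. by apply/funext=> t; rewrite cImM. Qed.
Let ReTJ u : ReT (fun z => (u z)^*) = ReT u.
Proof. by apply/funext=> t; rewrite cReJ. Qed.
Let ImTJ u : ImT (fun z => (u z)^*) = \- ImT u.
Proof. by apply/funext=> t; rewrite cImJ. Qed.

Definition measurable_circle u :=
  measurable_fun arc (fun t => Re (u (cis t))) /\
  measurable_fun arc (fun t => Im (u (cis t))).

Definition integrable_circle u :=
  mu.-integrable arc (EFin \o fun t => Re (u (cis t))) /\
  mu.-integrable arc (EFin \o fun t => Im (u (cis t))).

(** Only the values on the circle matter, whence the parameter; the parts are taken
    separately so that the results on real functions apply. *)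
Definition continuous_circle u :=
  continuous (fun t => Re (u (cis t))) /\ continuous (fun t => Im (u (cis t))).

Lemma measurable_circleD u v : measurable_circle u -> measurable_circle v ->
  measurable_circle (fun z => u z + v z).
Proof.
move=> [u1 u2] [v1 v2]; split.
  by rewrite ReTD; exact: measurable_funD.
by rewrite ImTD; exact: measurable_funD.
Qed.

Lemma measurable_circleM u v : measurable_circle u -> measurable_circle v ->
  measurable_circle (fun z => u z * v z).
Proof.
move=> [u1 u2] [v1 v2]; split.
  by rewrite ReTM; apply: measurable_funB; exact: measurable_funM.
by rewrite ImTM; apply: measurable_funD; exact: measurable_funM.
Qed.

Lemma measurable_circleJ u : measurable_circle u -> measurable_circle (fun z => (u z)^*).
Proof.
move=> [u1 u2]; split; first by rewrite ReTJ.
by rewrite ImTJ; exact: measurableT_comp.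
Qed.

Lemma measurable_abs2 u : measurable_circle u ->
  measurable_fun arc (fun t => abs2 (u (cis t))).
Proof. by move=> [u1 u2]; apply: measurable_funD; exact: measurable_funX. Qed.

Lemma continuous_circle_measurable u : continuous_circle u -> measurable_circle u.
Proof.
by move=> [u1 u2]; split; apply: measurable_funTS; exact: continuous_measurable_fun.
Qed.

Lemma continuous_circleD u v : continuous_circle u -> continuous_circle v ->
  continuous_circle (fun z => u z + v z).
Proof.
move=> [u1 u2] [v1 v2]; split.
  by rewrite ReTD; move=> t; exact (cvgD (u1 t) (v1 t)).
by rewrite ImTD; move=> t; exact (cvgD (u2 t) (v2 t)).
Qed.

Lemma continuous_circleM u v : continuous_circle u -> continuous_circle v ->
  continuous_circle (fun z => u z * v z).
Proof.
move=> [u1 u2] [v1 v2]; split.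
  by rewrite ReTM; move=> t; exact (cvgB (cvgM (u1 t) (v1 t)) (cvgM (u2 t) (v2 t))).
by rewrite ImTM; move=> t; exact (cvgD (cvgM (u1 t) (v2 t)) (cvgM (u2 t) (v1 t))).
Qed.

Lemma continuous_circle_cst a : continuous_circle (fun=> a).
Proof. by split=> t; exact: cvg_cst. Qed.

Lemma continuous_circle_id : continuous_circle id.
Proof. by split; [exact: continuous_cos|exact: continuous_sin]. Qed.

Lemma continuous_circleV u : (forall t, u (cis t) != 0) -> continuous_circle u ->
  continuous_circle (fun z => (u z)^-1).
Proof.
move=> u0 [u1 u2]; have a0 t : abs2 (u (cis t)) != 0.
  by apply/eqP=> /abs2_eq0/eqP; rewrite (negbTE (u0 t)).
have ca : continuous (fun t => (abs2 (u (cis t)))^-1).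
  move=> t; exact (cvgV (a0 t) (cvgD (cvgM (u1 t) (u1 t)) (cvgM (u2 t) (u2 t)))).
have Vabs z : z^-1 = (Re z / abs2 z) +i* (- Im z / abs2 z).
  by case: z => x y; rewrite /abs2 mulNr.
have -> : (fun z => (u z)^-1) = (fun z => (Re (u z) / abs2 (u z)) +i* (- Im (u z) / abs2 (u z))).
  by apply/funext=> z; rewrite Vabs.
split=> t /=; first exact (cvgM (u1 t) (ca t)).
exact (cvgM (cvgN (u2 t)) (ca t)).
Qed.

Lemma eq_continuous_circle u v : (forall t, u (cis t) = v (cis t)) ->
  continuous_circle u -> continuous_circle v.
Proof.
move=> uv; rewrite /continuous_circle; have -> : ReT v = ReT u by apply/funext=> t; rewrite uv.
by have -> : ImT v = ImT u by apply/funext=> t; rewrite uv.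
Qed.

Lemma continuous_circleX u n : continuous_circle u -> continuous_circle (fun z => u z ^+ n).
Proof.
move=> cu; elim: n => [|n IH].
  exact: eq_continuous_circle (continuous_circle_cst 1).
by apply: eq_continuous_circle (continuous_circleM cu IH) => t; rewrite exprS.
Qed.

Lemma continuous_circleXz (k : int) : continuous_circle (fun z => z ^ k).
Proof.
case: k => n; first exact: continuous_circleX continuous_circle_id.
apply: eq_continuous_circle (continuous_circleV _ (continuous_circleX n.+1 continuous_circle_id)).
  by move=> t; rewrite NegzE -exprnN.
by move=> t; rewrite expf_neq0 // cis_neq0.
Qed.

Lemma continuous_circle_horner (p : {poly C}) : continuous_circle (fun z => p.[z]).
Proof.
elim/poly_ind: p => [|p c IH].
  by apply: eq_continuous_circle (continuous_circle_cst 0) => t; rewrite horner0.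
apply: eq_continuous_circle (continuous_circleD
   (continuous_circleM IH continuous_circle_id) (continuous_circle_cst c)) => t.
by rewrite hornerMXaddC.
Qed.

Lemma continuous_circle_bounded u : continuous_circle u ->
  exists2 M : R, 0 <= M & forall t, arc t -> abs2 (u (cis t)) <= M.
Proof.
move=> [u1 u2]; have c : {within arc, continuous (fun t => abs2 (u (cis t)))}.
  apply: continuous_subspaceT => t.
  exact (cvgD (cvgM (u1 t) (u1 t)) (cvgM (u2 t) (u2 t))).
have pi0 : 0 <= 2 * pi :> R by rewrite mulr_ge0 // pi_ge0.
have [c0 c0arc cmax] := EVT_max pi0 c.
exists (abs2 (u (cis c0))); first exact: abs2_ge0.
by move=> t tarc; apply: cmax; rewrite inE in tarc *.
Qed.

End CircleMean.

(** * Square-integrable functions on the circle *)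

Section SquareIntegrable.
Context (R : realType).
Local Notation C := R[i].
Local Notation mu := (@lebesgue_measure R).
Local Notation arc := (`[0, 2 * pi]%classic : set R).
Local Notation Re := complex.Re.
Local Notation Im := complex.Im.
Local Notation "x %:C" := (real_complex_def (Phant R) x) : ring_scope.
Local Notation "x +i* y" := (Complex x y) : ring_scope.
Implicit Types (u v w : C -> C) (t : R) (a b z : C) (f g : R -> R).

Let mD := @measurable_arc R.
Let igr f := mu.-integrable arc (EFin \o f).

Let igrD f g : igr f -> igr g -> igr (fun t => f t + g t).
Proof. by move=> hf hg; exact: (integrableD mD hf hg). Qed.

Let igrZ (k : R) f : igr f -> igr (fun t => k * f t).
Proof. by move=> hf; exact: (integrableZl mD k hf). Qed.

Let igrB f g : igr f -> igr g -> igr (fun t => f t - g t).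
Proof. by move=> hf hg; exact: (integrableB mD hf hg). Qed.

Let igr_le f g : measurable_fun arc f -> (forall t, arc t -> `|f t| <= g t) ->
  igr g -> igr f.
Proof.
move=> mf fg ig; apply: (le_integrable mD _ _ ig); first exact/measurable_EFinP.
move=> t At; rewrite /= lee_fin; apply: le_trans (fg t At) _.
exact: ler_norm.
Qed.

Let igr_cst (k : R) : igr (fun=> k).
Proof.
apply: continuous_compact_integrable; first exact: segment_compact.
by apply: continuous_subspaceT => t; exact: cvg_cst.
Qed.

Lemma eq_circle_mean u v : (forall t, u (cis t) = v (cis t)) ->
  circle_mean u = circle_mean v.
Proof.
move=> uv; rewrite /circle_mean; congr (_ * _ +i* (_ * _));
by apply: eq_Rintegral => t _; rewrite uv.
Qed.

Lemma circle_meanD u v : integrable_circle u -> integrable_circle v ->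
  circle_mean (fun z => u z + v z) = circle_mean u + circle_mean v.
Proof.
move=> [u1 u2] [v1 v2]; rewrite /circle_mean; apply: complex_ext; rewrite ?cReD ?cImD /= -mulrDr.
  by rewrite -RintegralD //; congr (_ * _); apply: eq_Rintegral => t _; rewrite cReD.
by rewrite -RintegralD //; congr (_ * _); apply: eq_Rintegral => t _; rewrite cImD.
Qed.

Lemma integrable_circleZ a u : integrable_circle u ->
  integrable_circle (fun z => a * u z).
Proof.
move=> [u1 u2]; split.
  have := igrB (igrZ (Re a) u1) (igrZ (Im a) u2); congr (integrable _ _ _).
  by apply/funext => t /=; rewrite cReM.
have := igrD (igrZ (Re a) u2) (igrZ (Im a) u1); congr (integrable _ _ _).
by apply/funext => t /=; rewrite cImM.
Qed.

Lemma circle_meanZ a u : integrable_circle u ->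
  circle_mean (fun z => a * u z) = a * circle_mean u.
Proof.
move=> [u1 u2]; rewrite /circle_mean; apply: complex_ext; rewrite ?cReM ?cImM /=.
  rewrite (eq_Rintegral mu (g := fun t => Re a * Re (u (cis t)) - Im a * Im (u (cis t)))) => [|t _].
    by rewrite RintegralB ?RintegralZl //; [ring|exact: igrZ..].
  by rewrite cReM.
rewrite (eq_Rintegral mu (g := fun t => Re a * Im (u (cis t)) + Im a * Re (u (cis t)))) => [|t _].
  by rewrite RintegralD ?RintegralZl //; [ring|exact: igrZ..].
by rewrite cImM.
Qed.

Lemma circle_meanJ u : integrable_circle u ->
  circle_mean (fun z => (u z)^*) = (circle_mean u)^*.
Proof.
move=> [u1 u2]; rewrite /circle_mean; apply: complex_ext; rewrite ?cReJ ?cImJ /=.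
  by congr (_ * _); apply: eq_Rintegral => t _; rewrite cReJ.
rewrite (eq_Rintegral mu (g := fun t => - 1 * Im (u (cis t)))) => [|t _].
  by rewrite RintegralZl // mulN1r mulrN.
by rewrite cImJ mulN1r.
Qed.

Lemma integrable_circleD u v : integrable_circle u -> integrable_circle v ->
  integrable_circle (fun z => u z + v z).
Proof.
move=> [u1 u2] [v1 v2]; split.
  have := igrD u1 v1; congr (integrable _ _ _).
  by apply/funext => t /=; rewrite cReD.
have := igrD u2 v2; congr (integrable _ _ _).
by apply/funext => t /=; rewrite cImD.
Qed.

Lemma L2P u : L2 u <-> measurable_circle u /\ igr (fun t => abs2 (u (cis t))).
Proof.
have e : (\int[mu]_(t in arc) `|(EFin \o fun t => abs2 (u (cis t))) t| =
    \int[mu]_(t in arc) (Re (u (cis t)) ^+ 2 + Im (u (cis t)) ^+ 2)%:E)%E.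
  by apply: eq_integral => t _; rewrite /= ger0_norm // abs2_ge0.
split=> [[u1 u2 ui]|[[u1 u2] /integrableP[_ ui]]]; last by split=> //; rewrite -e.
split=> //; apply/integrableP; split; last by rewrite e.
by apply/measurable_EFinP; exact (measurable_abs2 (conj u1 u2)).
Qed.

Lemma eq_L2 u v : (forall t, u (cis t) = v (cis t)) -> L2 u -> L2 v.
Proof.
move=> uv /L2P[[u1 u2] ui]; apply/L2P.
have e (F : C -> R) : (fun t => F (u (cis t))) = (fun t => F (v (cis t))).
  by apply/funext=> t; rewrite uv.
by split; [split; rewrite -e|rewrite -e].
Qed.

Lemma L2D u v : L2 u -> L2 v -> L2 (fun z => u z + v z).
Proof.
move=> /L2P[mu' iu] /L2P[mv iv]; apply/L2P.
have muv := measurable_circleD mu' mv; split=> //.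
apply: igr_le (igrD (igrZ 2 iu) (igrZ 2 iv)); first exact (measurable_abs2 muv).
by move=> t _; rewrite ger0_norm ?abs2_ge0 ?abs2D.
Qed.

Lemma L2_mulr u v : continuous_circle u -> L2 v -> L2 (fun z => u z * v z).
Proof.
move=> cu /L2P[mv iv]; have [M M0 uM] := continuous_circle_bounded cu.
apply/L2P; have muv := measurable_circleM (continuous_circle_measurable cu) mv.
split=> //; apply: igr_le (igrZ M iv); first exact (measurable_abs2 muv).
by move=> t At; rewrite ger0_norm ?abs2_ge0 // abs2M ler_wpM2r ?abs2_ge0 ?uM.
Qed.

Lemma L2_continuous u : continuous_circle u -> L2 u.
Proof.
move=> cu; have [M M0 uM] := continuous_circle_bounded cu.
apply/L2P; have mu' := continuous_circle_measurable cu; split=> //.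
apply: igr_le (igr_cst M); first exact (measurable_abs2 mu').
by move=> t At; rewrite ger0_norm ?abs2_ge0 ?uM.
Qed.

Lemma L2Z a u : L2 u -> L2 (fun z => a * u z).
Proof. by apply: L2_mulr; exact: continuous_circle_cst. Qed.

Lemma L2_cst a : L2 (fun=> a).
Proof. by apply: L2_continuous; exact: continuous_circle_cst. Qed.

Lemma L2B u v : L2 u -> L2 v -> L2 (fun z => u z - v z).
Proof.
move=> Lu Lv; apply: eq_L2 (L2D Lu (L2Z (-1) Lv)) => t; by rewrite mulN1r.
Qed.

Lemma L2_sum (I : finType) (F : I -> C -> C) : (forall i, L2 (F i)) ->
  L2 (fun z => \sum_i F i z).
Proof.
move=> LF; have : L2 (fun z => \sum_(i <- index_enum I) F i z) by
  elim: (index_enum I) => [|i s IH]; [apply: eq_L2 (L2_cst 0) => t; rewrite big_nil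
  |apply: eq_L2 (L2D (LF i) IH) => t; rewrite big_cons].
by [].
Qed.

Lemma abs_mulJ_le a b : `|Re (a * b^*)| <= abs2 a + abs2 b /\
  `|Im (a * b^*)| <= abs2 a + abs2 b.
Proof.
case: a b => x y [z w]; rewrite /abs2 /= !ler_norml.
have := sqr_ge0 (x + z); have := sqr_ge0 (x - z); have := sqr_ge0 (y + w).
have := sqr_ge0 (y - w); have := sqr_ge0 (x + w); have := sqr_ge0 (x - w).
have := sqr_ge0 (y + z); have := sqr_ge0 (y - z).
rewrite !sqrrD !sqrrN !expr2 => *; split; apply/andP; split; lra.
Qed.

Lemma integrable_dot u v : L2 u -> L2 v -> integrable_circle (fun z => u z * (v z)^*).
Proof.
move=> /L2P[mu' iu] /L2P[mv iv]; have iuv := igrD iu iv.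
have [m1 m2] := measurable_circleM mu' (measurable_circleJ mv).
by split; apply: igr_le iuv => // t _; have [] := abs_mulJ_le (u (cis t)) (v (cis t)).
Qed.

Lemma integrable_L2 u : L2 u -> integrable_circle u.
Proof.
move=> Lu; have := integrable_dot Lu (L2_cst 1).
by rewrite (_ : (fun z => _) = u) //; apply/funext=> z /=; rewrite rmorph1 mulr1.
Qed.

Lemma circle_mean0 : circle_mean (fun=> 0 : C) = 0.
Proof.
transitivity (circle_mean (fun z : C => 0 * (fun=> 0) z)).
  by apply: eq_circle_mean => t; rewrite mul0r.
by rewrite circle_meanZ ?mul0r //; apply: integrable_L2; exact: L2_cst.
Qed.

Lemma dotDl u v w : L2 u -> L2 v -> L2 w ->
  dot (fun z => u z + v z) w = dot u w + dot v w.
Proof.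
move=> Lu Lv Lw; rewrite /dot -circle_meanD; [|exact: integrable_dot..].
by apply: eq_circle_mean => t; rewrite mulrDl.
Qed.

Lemma dotZl a u w : L2 u -> L2 w -> dot (fun z => a * u z) w = a * dot u w.
Proof.
move=> Lu Lw; rewrite /dot -circle_meanZ; last exact: integrable_dot.
by apply: eq_circle_mean => t; rewrite mulrA.
Qed.

Lemma dotC u v : L2 u -> L2 v -> dot v u = (dot u v)^*.
Proof.
move=> Lu Lv; rewrite /dot -circle_meanJ; last exact: integrable_dot.
by apply: eq_circle_mean => t /=; rewrite cJM cJK mulrC.
Qed.

Lemma eq_dot u v u' v' : (forall t, u (cis t) = u' (cis t)) ->
  (forall t, v (cis t) = v' (cis t)) -> dot u v = dot u' v'.
Proof. by move=> eu ev; apply: eq_circle_mean => t; rewrite eu ev. Qed.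

Lemma dotBl u v w : L2 u -> L2 v -> L2 w ->
  dot (fun z => u z - v z) w = dot u w - dot v w.
Proof.
move=> Lu Lv Lw; rewrite -mulN1r -dotZl // -dotDl //; last exact: L2Z.
by apply: eq_dot => // t; rewrite mulN1r.
Qed.

Lemma dotZr a u w : L2 u -> L2 w -> dot u (fun z => a * w z) = a^* * dot u w.
Proof.
by move=> Lu Lw; rewrite (dotC (L2Z a Lw) Lu) dotZl // cJM -dotC.
Qed.

Lemma dotDr u v w : L2 u -> L2 v -> L2 w ->
  dot u (fun z => v z + w z) = dot u v + dot u w.
Proof.
by move=> Lu Lv Lw; rewrite (dotC (L2D Lv Lw) Lu) dotDl // cJD -!dotC.
Qed.

Lemma dotBr u v w : L2 u -> L2 v -> L2 w ->
  dot u (fun z => v z - w z) = dot u v - dot u w.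
Proof.
by move=> Lu Lv Lw; rewrite (dotC (L2B Lv Lw) Lu) dotBl // cJB -!dotC.
Qed.

Lemma dot_suml (I : finType) (c : I -> C) (F : I -> C -> C) v :
  (forall i, L2 (F i)) -> L2 v ->
  dot (fun z => \sum_i c i * F i z) v = \sum_i c i * dot (F i) v.
Proof.
move=> LF Lv; have : L2 (fun z => \sum_(i <- index_enum I) c i * F i z) /\
    dot (fun z => \sum_(i <- index_enum I) c i * F i z) v =
    \sum_(i <- index_enum I) c i * dot (F i) v; last by case.
elim: (index_enum I) => [|i s [IH1 IH2]].
  split; first by apply: eq_L2 (L2_cst 0) => t; rewrite big_nil.
  rewrite big_nil -[LHS]/(dot _ v) -[RHS](mul0r (dot v v)) -dotZl //.
  by apply: eq_dot => // t; rewrite big_nil mul0r.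
split; first by apply: eq_L2 (L2D (L2Z (c i) (LF i)) IH1) => t; rewrite big_cons.
rewrite big_cons -IH2 -dotZl // -dotDl //; last exact: L2Z.
by apply: eq_dot => // t; rewrite big_cons.
Qed.

Lemma dot_sumr (I : finType) (c : I -> C) (F : I -> C -> C) v :
  (forall i, L2 (F i)) -> L2 v ->
  dot v (fun z => \sum_i c i * F i z) = \sum_i (c i)^* * dot v (F i).
Proof.
move=> LF Lv; have LS : L2 (fun z => \sum_i c i * F i z).
  by apply: L2_sum => i; exact: L2Z.
rewrite dotC // dot_suml // cJ_sum; apply: eq_bigr => i _.
by rewrite cJM -dotC.
Qed.

Definition sqnorm u : R := (2 * pi)^-1 * \int[mu]_(t in arc) abs2 (u (cis t)).

Let twopi_gt0 : 0 < 2 * pi :> R. Proof. by rewrite mulr_gt0 // pi_gt0. Qed.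

Lemma dotuu u : dot u u = (sqnorm u)%:C.
Proof.
rewrite /dot /circle_mean; apply: complex_ext => /=.
  by congr (_ * _); apply: eq_Rintegral => t _; rewrite mulcJ.
rewrite (eq_Rintegral mu (g := fun=> 0)) ?Rintegral_cst ?mul0r ?mulr0 // => t _.
by rewrite mulcJ.
Qed.

Lemma norm2E u : norm2 u = Num.sqrt (sqnorm u).
Proof. by rewrite /norm2 dotuu. Qed.

Lemma sqnorm_ge0 u : 0 <= sqnorm u.
Proof.
apply: mulr_ge0; first by rewrite invr_ge0 ltW.
by apply: Rintegral_ge0 => t _; exact: abs2_ge0.
Qed.

Lemma sqnorm_mulr_le u (M : R) v : continuous_circle u -> L2 v ->
  (forall t, arc t -> abs2 (u (cis t)) <= M) ->
  sqnorm (fun z => u z * v z) <= M * sqnorm v.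
Proof.
move=> cu Lv uM; rewrite /sqnorm mulrCA ler_wpM2l ?invr_ge0 ?(ltW twopi_gt0) //.
have /L2P[_ iv] := Lv; have /L2P[_ iuv] := L2_mulr cu Lv.
rewrite -RintegralZl //; apply: le_Rintegral => //; first exact: igrZ.
by move=> t At; rewrite abs2M ler_wpM2r ?abs2_ge0 ?uM.
Qed.

Lemma sqnormD u v : L2 u -> L2 v -> dot u v = 0 ->
  sqnorm (fun z => u z + v z) = sqnorm u + sqnorm v.
Proof.
move=> Lu Lv uv0; apply: complexI; rewrite rmorphD /= -!dotuu.
rewrite dotDl ?dotDr //; [|exact: L2D..].
by rewrite (dotC Lu Lv) uv0 rmorph0 addr0 add0r.
Qed.

#[global] Instance ae_lebesgue_filter : Filter (nbhs (almost_everywhere mu)).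
Proof. exact: ae_filter_ringOfSetsType. Qed.

Lemma eqT_of_eq u v : (forall t, u (cis t) = v (cis t)) -> eqT u v.
Proof. by move=> uv; apply: aeW => t _; exact: uv. Qed.

Lemma eqT_refl u : eqT u u. Proof. exact: eqT_of_eq. Qed.

Lemma eqT_sym u v : eqT u v -> eqT v u.
Proof. by apply: filterS => t uv At; rewrite uv. Qed.

Lemma eqT_trans v u w : eqT u v -> eqT v w -> eqT u w.
Proof. by apply: filterS2 => t uv vw At; rewrite uv // vw. Qed.

Lemma eqT_op2 (F : C -> C -> C -> C) u v u' v' : eqT u u' -> eqT v v' ->
  eqT (fun z => F z (u z) (v z)) (fun z => F z (u' z) (v' z)).
Proof. by apply: filterS2 => t eu ev At; rewrite eu // ev. Qed.

Lemma eqT_op1 (F : C -> C -> C) u u' : eqT u u' ->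
  eqT (fun z => F z (u z)) (fun z => F z (u' z)).
Proof. by apply: filterS => t eu At; rewrite eu. Qed.

Lemma circle_mean_eqT u v : measurable_circle u -> measurable_circle v -> eqT u v ->
  circle_mean u = circle_mean v.
Proof.
move=> [u1 u2] [v1 v2] uv; rewrite /circle_mean /Rintegral; congr (_ * fine _ +i* (_ * fine _)).
  apply: ae_eq_integral => //; [exact/measurable_EFinP..|].
  by apply: filterS uv => t uv /uv ->.
apply: ae_eq_integral => //; [exact/measurable_EFinP..|].
by apply: filterS uv => t uv /uv ->.
Qed.

Lemma L2_measurable u : L2 u -> measurable_circle u. Proof. by case/L2P. Qed.

Lemma dot_eqT u v u' v' : L2 u -> L2 v -> L2 u' -> L2 v' -> eqT u u' -> eqT v v' ->
  dot u v = dot u' v'.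
Proof.
move=> Lu Lv Lu' Lv' eu ev; apply: circle_mean_eqT.
- by apply: measurable_circleM; [|apply: measurable_circleJ]; exact: L2_measurable.
- by apply: measurable_circleM; [|apply: measurable_circleJ]; exact: L2_measurable.
exact: (eqT_op2 (fun _ a b => a * b^*)).
Qed.

Lemma sqnorm_eqT u v : L2 u -> L2 v -> eqT u v -> sqnorm u = sqnorm v.
Proof.
by move=> Lu Lv uv; apply: complexI; rewrite -!dotuu; exact: dot_eqT.
Qed.

Lemma sqnorm_eq0 u : L2 u -> sqnorm u = 0 -> eqT u (fun=> 0).
Proof.
move=> /L2P[mu' iu] /eqP; rewrite mulf_eq0 invr_eq0 gt_eqF //= => /eqP I0.
have mf : measurable_fun arc (EFin \o (fun t => abs2 (u (cis t)))).
  by apply/measurable_EFinP; exact (measurable_abs2 mu').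
have /(ae_eq_integral_abs mu mD mf) : (\int[mu]_(t in arc) `|(abs2 (u (cis t)))%:E| = 0)%E.
  transitivity (\int[mu]_(t in arc) (abs2 (u (cis t)))%:E)%E.
    by apply: eq_integral => t _; rewrite /= ger0_norm ?abs2_ge0.
  by rewrite -[LHS]fineK ?[fine _]I0 //; exact: integrable_fin_num.
by apply: filterS => t e At; apply: abs2_eq0; have [] := e At.
Qed.

End SquareIntegrable.

(** * Fourier coefficients and the Hardy space *)

Section Hardy.
Context (R : realType).
Local Notation C := R[i].
Local Notation mu := (@lebesgue_measure R).
Local Notation arc := (`[0, 2 * pi]%classic : set R).
Local Notation Re := complex.Re.
Local Notation Im := complex.Im.
Local Notation "x %:C" := (real_complex_def (Phant R) x) : ring_scope.
Local Notation "x +i* y" := (Complex x y) : ring_scope.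
Implicit Types (u v w : C -> C) (t : R) (a b z : C) (f g : R -> R).

Lemma Rintegral_arc_FTC (F f : R -> R) : (forall t, is_derive t 1 F (f t)) ->
  continuous f -> \int[mu]_(t in arc) f t = F (2 * pi) - F 0.
Proof.
move=> dF cf; have pi2 : 0 < 2 * pi :> R by rewrite mulr_gt0 // pi_gt0.
have dFt t : derivable F t 1 by have [] := dF t.
have cF : continuous F.
  by move=> t; apply: differentiable_continuous; apply/derivable1_diffP.
rewrite /Rintegral (@continuous_FTC2 _ f F _ _ pi2) //; first exact: continuous_subspaceT.
- by split=> //; [apply: cvg_at_right_filter; exact: cF
    |apply: cvg_at_left_filter; exact: cF].
- by move=> t _; rewrite derive1E; have [] := dF t.
Qed.

Lemma cis_2pi : cis (2 * pi) = 1 :> C.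
Proof.
rewrite mulr_natl mulr2n cisD /cis cospi sinpi.
by apply: complex_ext; rewrite ?cReM ?cImM /=; ring.
Qed.

Lemma is_derive_scale (k t : R) : is_derive t 1 ( *%R k) k.
Proof.
rewrite -[X in is_derive _ _ _ X]mulr1; exact: (@is_deriveZ R R R id k).
Qed.

Lemma is_derive_cos_scale (k t : R) : is_derive t 1 (fun x => cos (k * x)) (- sin (k * t) * k).
Proof. exact: is_derive1_comp (is_derive_cos _) (is_derive_scale k t). Qed.

Lemma is_derive_sin_scale (k t : R) : is_derive t 1 (fun x => sin (k * x)) (cos (k * t) * k).
Proof. exact: is_derive1_comp (is_derive_sin _) (is_derive_scale k t). Qed.

(** For [k != 0] the integrand has the periodic primitive [z^k / (i k)]. *)
Lemma circle_mean_Xz (k : int) : circle_mean (fun z : C => z ^ k) = (k == 0)%:R.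
Proof.
have pi0 : 2 * pi != 0 :> R by rewrite gt_eqF // mulr_gt0 // pi_gt0.
have [->|k0] := eqVneq k 0.
  apply: complex_ext; rewrite /circle_mean /=.
    rewrite (eq_Rintegral mu (g := fun=> 1)) => [|t _]; last by [].
    rewrite Rintegral_cst; last exact: measurable_arc.
    have e : mu arc = (2 * pi)%:E.
      by rewrite lebesgue_measure_itv /= lte_fin mulr_gt0 ?pi_gt0 // sube0.
    by rewrite mul1r [X in fine X]e mulVf.
  rewrite (eq_Rintegral mu (g := fun=> 0)) => [|t _]; last by [].
  by rewrite Rintegral_cst ?mul0r ?mulr0 //; exact: measurable_arc.
pose c : R := k%:~R; have c0 : c != 0 by rewrite intr_eq0.
have cos_c : cos (c * (2 * pi)) = 1 /\ sin (c * (2 * pi)) = 0.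
  have := cisX (2 * pi : R) k; rewrite cis_2pi exp1rz -/c => /(congr1 (fun z : C => (Re z, Im z))).
  by rewrite /= => -[<- <-].
have cc : continuous (fun t => cos (c * t)).
  by move=> t; apply: differentiable_continuous; apply/derivable1_diffP; case: (is_derive_cos_scale c t).
have cs : continuous (fun t => sin (c * t)).
  by move=> t; apply: differentiable_continuous; apply/derivable1_diffP; case: (is_derive_sin_scale c t).
apply: complex_ext; rewrite /circle_mean /=.
  rewrite (eq_Rintegral mu (g := fun t => cos (c * t))) => [|t _]; last by rewrite cisX.
  have dF t : is_derive t 1 (fun t => c^-1 * sin (c * t)) (cos (c * t)).
    apply: is_derive_eq (@is_deriveZ R R R _ c^-1 _ _ _ (is_derive_sin_scale c t)) _.
    by rewrite /GRing.scale /=; field.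
  by rewrite (Rintegral_arc_FTC dF cc) cos_c.2 !mulr0 sin0 mulr0 subrr mulr0.
rewrite (eq_Rintegral mu (g := fun t => sin (c * t))) => [|t _]; last by rewrite cisX.
have dF t : is_derive t 1 (fun t => - c^-1 * cos (c * t)) (sin (c * t)).
  apply: is_derive_eq (@is_deriveZ R R R _ (- c^-1) _ _ _ (is_derive_cos_scale c t)) _.
  by rewrite /GRing.scale /=; field.
by rewrite (Rintegral_arc_FTC dF cs) cos_c.1 !mulr0 cos0 subrr mulr0.
Qed.

Lemma L2_Xz (k : int) : L2 (fun z : C => z ^ k).
Proof. by apply: L2_continuous; exact: continuous_circleXz. Qed.

Lemma fourier_dot u (k : int) : fourier u k = dot u (fun z => z ^ k).
Proof.
apply: eq_circle_mean => t; rewrite mulrC; congr (_ * _).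
by rewrite rmorphXz ?unitfE ?cis_neq0 //= cis_conj exprz_inv.
Qed.

Lemma L2_Xz_mul (k : int) u : L2 u -> L2 (fun z => z ^ k * u z).
Proof. by apply: L2_mulr; exact: continuous_circleXz. Qed.

Lemma eq_fourier u v (k : int) : (forall t, u (cis t) = v (cis t)) ->
  fourier u k = fourier v k.
Proof. by move=> uv; apply: eq_circle_mean => t; rewrite uv. Qed.

Lemma fourier_eqT u v (k : int) : L2 u -> L2 v -> eqT u v -> fourier u k = fourier v k.
Proof.
move=> Lu Lv uv; rewrite !fourier_dot; apply: dot_eqT => //; first exact: L2_Xz.
  exact: L2_Xz.
exact: eqT_refl.
Qed.

Lemma fourierD u v (k : int) : L2 u -> L2 v ->
  fourier (fun z => u z + v z) k = fourier u k + fourier v k.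
Proof. by move=> Lu Lv; rewrite !fourier_dot dotDl //; exact: L2_Xz. Qed.

Lemma fourierB u v (k : int) : L2 u -> L2 v ->
  fourier (fun z => u z - v z) k = fourier u k - fourier v k.
Proof. by move=> Lu Lv; rewrite !fourier_dot dotBl //; exact: L2_Xz. Qed.

Lemma fourierZ a u (k : int) : L2 u -> fourier (fun z => a * u z) k = a * fourier u k.
Proof. by move=> Lu; rewrite !fourier_dot dotZl //; exact: L2_Xz. Qed.

Lemma fourier_suml (I : finType) (c : I -> C) (F : I -> C -> C) (k : int) :
  (forall i, L2 (F i)) ->
  fourier (fun z => \sum_i c i * F i z) k = \sum_i c i * fourier (F i) k.
Proof.
move=> LF; rewrite fourier_dot dot_suml //; last exact: L2_Xz.
by apply: eq_bigr => i _; rewrite fourier_dot.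
Qed.

Lemma fourierXz (m : int) u (k : int) : fourier (fun z => z ^ m * u z) k = fourier u (k - m).
Proof.
apply: eq_circle_mean => t; rewrite mulrA -expfzDr ?cis_neq0 //; congr (_ ^ _ * _); ring.
Qed.

Lemma fourierX u (k : int) : fourier (fun z => z * u z) k = fourier u (k - 1).
Proof. by rewrite -fourierXz. Qed.

Lemma fourier_Xz (m k : int) : fourier (fun z => z ^ m) k = (m == k)%:R.
Proof.
rewrite -subr_eq0 -circle_mean_Xz; apply: eq_circle_mean => t.
by rewrite -expfzDr ?cis_neq0 // addrC.
Qed.

Lemma fourier_cst a (k : int) : fourier (fun=> a) k = a * (k == 0)%:R.
Proof.
rewrite eq_sym -fourier_Xz -fourierZ; last exact: L2_Xz.
by apply: eq_fourier => t; rewrite expr0z mulr1.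
Qed.

(** Bessel's inequality, as the Pythagorean identity for the remainder. *)
Lemma sqnorm_bessel (I : finType) (e : I -> C -> C) u : (forall i, L2 (e i)) ->
  (forall i j, dot (e i) (e j) = (i == j)%:R) -> L2 u ->
  sqnorm u = \sum_i abs2 (dot u (e i)) +
             sqnorm (fun z => u z - \sum_i dot u (e i) * e i z).
Proof.
move=> Le ee Lu; pose s := fun z => \sum_i dot u (e i) * e i z.
have Ls : L2 s by apply: L2_sum => i; exact: L2Z.
have Lr : L2 (fun z => u z - s z) by exact: L2B.
have se i : dot s (e i) = dot u (e i).
  rewrite dot_suml // (bigD1 i) //= ee eqxx mulr1 big1 ?addr0 // => j ji.
  by rewrite ee (negbTE ji) mulr0.
have sr : dot s (fun z => u z - s z) = 0.
  rewrite (dotC Lr Ls) dot_sumr // big1 ?conjC0 // => i _.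
  by rewrite dotBl // se subrr mulr0.
have -> : sqnorm u = sqnorm (fun z => s z + (u z - s z)).
  by congr sqnorm; apply/funext=> z; ring.
rewrite (sqnormD Ls Lr sr); congr (_ + _); apply: complexI; rewrite -dotuu.
rewrite {2}/s dot_sumr // rmorph_sum /=; apply: eq_bigr => i _.
by rewrite se mulrC mulcJ.
Qed.

Lemma dot_Xz (m k : int) : dot (fun z => z ^ m) (fun z : C => z ^ k) = (m == k)%:R.
Proof. by rewrite -fourier_dot fourier_Xz. Qed.

Lemma sum_abs2_fourier_le u N : L2 u -> \sum_(n < N) abs2 (fourier u n%:Z) <= sqnorm u.
Proof.
move=> Lu; rewrite (@sqnorm_bessel 'I_N (fun n z => z ^ n%:Z)) //.
- by under eq_bigr do rewrite fourier_dot; rewrite lerDl sqnorm_ge0.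
- by move=> i; exact: L2_Xz.
by move=> i j; rewrite dot_Xz.
Qed.

Lemma abs2_fourier_le u (k : int) : L2 u -> abs2 (fourier u k) <= sqnorm u.
Proof.
move=> Lu; have -> : sqnorm u = sqnorm (fun z => z ^ (- k) * u z).
  congr (_ * _); apply: eq_Rintegral => t _; rewrite abs2M.
  by rewrite cisX cis_abs2 mul1r.
have -> : fourier u k = fourier (fun z => z ^ (- k) * u z) 0.
  by rewrite fourierXz opprK add0r.
have := sum_abs2_fourier_le 1 (L2_Xz_mul (- k) Lu).
by rewrite big_ord1.
Qed.

Lemma hardy_L2 u : hardy u -> L2 u. Proof. by case. Qed.

Lemma eq_hardy u v : (forall t, u (cis t) = v (cis t)) -> hardy u -> hardy v.
Proof.
move=> uv [Lu u0]; split; first exact: eq_L2 Lu.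
by move=> k k0; rewrite -(u0 k k0); apply: eq_fourier => t.
Qed.

Lemma hardyD u v : hardy u -> hardy v -> hardy (fun z => u z + v z).
Proof.
move=> [Lu u0] [Lv v0]; split; first exact: L2D.
by move=> k k0; rewrite fourierD // u0 // v0 // addr0.
Qed.

Lemma hardyB u v : hardy u -> hardy v -> hardy (fun z => u z - v z).
Proof.
move=> [Lu u0] [Lv v0]; split; first exact: L2B.
by move=> k k0; rewrite fourierB // u0 // v0 // subrr.
Qed.

Lemma hardyZ a u : hardy u -> hardy (fun z => a * u z).
Proof.
move=> [Lu u0]; split; first exact: L2Z.
by move=> k k0; rewrite fourierZ // u0 // mulr0.
Qed.

Lemma hardy_suml (I : finType) (c : I -> C) (F : I -> C -> C) :
  (forall i, hardy (F i)) -> hardy (fun z => \sum_i c i * F i z).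
Proof.
move=> hF; split; first by apply: L2_sum => i; apply: L2Z; exact: hardy_L2.
move=> k k0; rewrite fourier_suml; last by move=> i; exact: hardy_L2.
by rewrite big1 // => i _; case: (hF i) => _ ->; rewrite ?mulr0.
Qed.

Lemma hardyXn n u : hardy u -> hardy (fun z => z ^+ n * u z).
Proof.
move=> [Lu u0]; have Lnu := L2_Xz_mul n Lu; split=> // k k0.
rewrite -[LHS]/(fourier (fun z => z ^ n%:Z * u z) k) fourierXz u0 //.
by rewrite subr_lt0 (lt_le_trans k0).
Qed.

Lemma hardy_cst a : hardy (fun=> a).
Proof.
split; first exact: L2_cst.
by move=> k k0; rewrite fourier_cst lt_eqF ?mulr0.
Qed.

Lemma hardy_Xn n : hardy (fun z : C => z ^+ n).
Proof. by apply: eq_hardy (hardyXn n (hardy_cst 1)) => t; rewrite mulr1. Qed.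

Lemma hardy_horner (p : {poly C}) : hardy (fun z => p.[z]).
Proof.
apply: eq_hardy (hardy_suml (fun i : 'I_(size p) => p`_i) (fun i => hardy_Xn i)) => t.
by rewrite horner_coef.
Qed.

(** The Fourier coefficients [w_k] of [w = u / (1 - b z)] satisfy
    [w_k = b w_(k-1)] for [k < 0]; being bounded, they vanish. *)
Lemma hardy_geometric b u : abs2 b < 1 -> hardy u -> hardy (fun z => (1 - b * z)^-1 * u z).
Proof.
move=> b1 [Lu u0]; have nz t : 1 - b * cis t != 0.
  apply/eqP=> /eqP; rewrite subr_eq0 => /eqP e; move: b1.
  by have := abs2M b (cis t); rewrite -e cis_abs2 abs2_1 mulr1 => <-; rewrite ltxx.
have cV : continuous_circle (fun z => (1 - b * z)^-1).
  apply: continuous_circleV => //; apply: eq_continuous_circle (continuous_circleD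
    (continuous_circle_cst 1) (continuous_circleM (continuous_circle_cst (- b)) (@continuous_circle_id R))) => t.
  by rewrite mulNr.
set w := fun z => _; have Lw : L2 w by exact: L2_mulr.
split=> //; have step k : k < 0 -> fourier w k = b * fourier w (k - 1).
  move=> k0; apply/eqP; rewrite -subr_eq0 -fourierX -fourierZ; last exact: (L2_Xz_mul 1).
  rewrite -fourierB //; last by apply: L2Z; exact: (L2_Xz_mul 1).
  rewrite (eq_fourier (v := u)) ?u0 // => t; rewrite /w.
  by field; exact: nz.
have geom n k : k < 0 -> fourier w k = b ^+ n * fourier w (k - n%:Z).
  elim: n k => [|n IH] k k0; first by rewrite mul1r subr0.
  rewrite step // (IH (k - 1)) ?subr_lt0 ?(lt_trans k0) // exprS mulrA.
  by congr (_ * fourier _ _); rewrite -addrA -opprD -add1n PoszD.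
move=> k k0; apply: abs2_eq0; apply/eqP; rewrite eq_le abs2_ge0 andbT.
have bound n : abs2 (fourier w k) <= abs2 b ^+ n * sqnorm w.
  by rewrite (geom n) // abs2M abs2X ler_wpM2l ?exprn_ge0 ?abs2_ge0 ?abs2_fourier_le.
have cv : (fun n => abs2 b ^+ n * sqnorm w) @ \oo --> 0 * sqnorm w.
  apply: cvgMl; apply: cvg_expr; by rewrite ger0_norm ?abs2_ge0.
rewrite mul0r in cv; apply: (ler_cvg_to (cvg_cst _) cv).
by apply: nearW => n; exact: bound.
Qed.

End Hardy.

(** * Multipliers, projections and bounded operators on the Hardy space *)

Section Operators.
Context (R : realType).
Local Notation C := R[i].
Local Notation Re := complex.Re.
Local Notation Im := complex.Im.
Local Notation "x %:C" := (real_complex_def (Phant R) x) : ring_scope.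
Local Notation "x +i* y" := (Complex x y) : ring_scope.
Implicit Types (u v w : C -> C) (t : R) (a b z : C) (A B : (C -> C) -> (C -> C)).

(** The bounded holomorphic functions of the disk that are continuous up to the
    circle, seen through their action. *)
Definition multiplier (m : C -> C) : Prop :=
  continuous_circle m /\ forall u, hardy u -> hardy (fun z => m z * u z).

Lemma eq_multiplier (m1 m2 : C -> C) : (forall t, m1 (cis t) = m2 (cis t)) ->
  multiplier m1 -> multiplier m2.
Proof.
move=> e [c1 h1]; split; first exact: eq_continuous_circle c1.
by move=> u hu; apply: eq_hardy (h1 u hu) => t; rewrite e.
Qed.

Lemma multiplier_cst a : multiplier (fun=> a).
Proof. by split; [exact: continuous_circle_cst|move=> u; exact: hardyZ]. Qed.

Lemma multiplierM (m1 m2 : C -> C) : multiplier m1 -> multiplier m2 ->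
  multiplier (fun z => m1 z * m2 z).
Proof.
move=> [c1 h1] [c2 h2]; split; first exact: continuous_circleM.
by move=> u /h2/h1; apply: eq_hardy => t; rewrite mulrA.
Qed.

Lemma multiplier_horner (p : {poly C}) : multiplier (fun z => p.[z]).
Proof.
split; first exact: continuous_circle_horner.
move=> u hu; apply: eq_hardy (hardy_suml (fun i : 'I_(size p) => p`_i)
  (fun i => hardyXn i hu)) => t.
by rewrite horner_coef mulr_suml; apply: eq_bigr => i _; rewrite mulrA.
Qed.

Definition outer_poly (s : {poly C}) := s != 0 /\ forall z, root s z -> 1 < abs2 z.

Definition inner_poly (q : {poly C}) := q != 0 /\ forall z, root q z -> abs2 z < 1.

Lemma outer_poly_neq0 s t : outer_poly s -> s.[cis t] != 0.
Proof. by move=> [_ os]; apply/negP=> /os; rewrite cis_abs2 ltxx. Qed.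

Lemma inner_poly_neq0 s t : inner_poly s -> s.[cis t] != 0.
Proof. by move=> [_ os]; apply/negP=> /os; rewrite cis_abs2 ltxx. Qed.

Lemma abs2V z : abs2 z^-1 = (abs2 z)^-1.
Proof.
have [->|z0] := eqVneq z 0; first by rewrite invr0 /abs2 /= !expr0n addr0 invr0.
apply: (@mulfI _ (abs2 z)); first by apply: contraNneq z0 => /abs2_eq0 ->.
rewrite -abs2M divff // abs2_1 divff //.
by apply: contraNneq z0 => /abs2_eq0 ->.
Qed.

(** Each factor [1 / (z - a)] with [a] outside the disk is a geometric series. *)
Lemma multiplier_horner_inv s : outer_poly s -> multiplier (fun z => (s.[z])^-1).
Proof.
move=> [s0 os]; have [zs es] := closed_field_poly_normal s.
have ozs z : z \in zs -> 1 < abs2 z.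
  move=> zzs; apply: os; rewrite es rootZ ?lead_coef_eq0 //.
  by rewrite root_prod_XsubC.
suff mzs : multiplier (fun z => (\prod_(a <- zs) (z - a))^-1).
  apply: eq_multiplier (multiplierM (multiplier_cst (lead_coef s)^-1) mzs) => t.
  rewrite [in RHS]es hornerZ horner_prod invfM; congr (_ * _^-1).
  by apply: eq_bigr => a _; rewrite hornerXsubC.
elim: zs ozs {es} => [|a zs IH] ozs.
  by apply: eq_multiplier (multiplier_cst 1) => t; rewrite big_nil invr1.
have oa : 1 < abs2 a by apply: ozs; rewrite mem_head.
have a0 : a != 0.
  by apply: contraTneq oa => ->; rewrite /abs2 /= !expr0n addr0 ltr10.
have mzs : multiplier (fun z => (\prod_(a <- zs) (z - a))^-1).
  by apply: IH => z zzs; apply: ozs; rewrite inE zzs orbT.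
have mg : multiplier (fun z => (1 - a^-1 * z)^-1).
  have b1 : abs2 a^-1 < 1 by rewrite abs2V invf_lt1 // (lt_trans _ oa).
  split; last by move=> u; exact: hardy_geometric.
  apply: continuous_circleV.
    move=> t; rewrite subr_eq0; apply/eqP => /(congr1 (@abs2 R)).
    by rewrite abs2M cis_abs2 abs2_1 mulr1 => e; rewrite -e ltxx in b1.
  apply: eq_continuous_circle (continuous_circleD (continuous_circle_cst 1)
    (continuous_circleM (continuous_circle_cst (- a^-1)) (@continuous_circle_id R))) => t.
  by rewrite mulNr.
apply: eq_multiplier (multiplierM (multiplierM (multiplier_cst (- a^-1)) mg) mzs) => t.
rewrite big_cons invfM; congr (_ * _); rewrite -[- a^-1]invrK invrN invrK -invfM.
by congr (_^-1); rewrite mulrBr mulr1 mulrA mulNr mulfV // mulN1r opprK addrC.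
Qed.

(** ** Orthogonal projection *)

Definition hardy_perp (n : C -> C) : Prop :=
  L2 n /\ forall u, hardy u -> dot n u = 0.

(** Two candidates for the projection differ by an element of the Hardy space
    orthogonal to itself. *)
Lemma hardy_proj_eq v w : L2 v -> hardy w -> hardy_perp (fun z => v z - w z) ->
  [/\ hardy (hardy_proj v), hardy_perp (fun z => v z - hardy_proj v z) &
      eqT (hardy_proj v) w].
Proof.
move=> Lv hw pw; have : [set w | hardy w /\
    forall u, hardy u -> dot (fun z => v z - w z) u = 0] (hardy_proj v).
  by apply: xgetPex; exists w; split=> //; case: pw.
set w' := hardy_proj v => -[hw' pw']; have Lw' := hardy_L2 hw'; have Lw := hardy_L2 hw.
split=> //; first by split=> //; exact: L2B.
have hd : hardy (fun z => w' z - w z) by exact: hardyB.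
have Ld := hardy_L2 hd.
have d0 : dot (fun z => w' z - w z) (fun z => w' z - w z) = 0.
  rewrite -[RHS](subrr 0) -[in X in _ = X - _](pw.2 _ hd) -[in X in _ = _ - X](pw' _ hd).
  rewrite -dotBl //; [|exact: L2B..].
  by apply: eq_dot => t //; ring.
have : sqnorm (fun z => w' z - w z) = 0.
  by apply: complexI; rewrite -dotuu d0.
move=> /(sqnorm_eq0 Ld); apply: filterS => t e At.
by apply/eqP; rewrite -subr_eq0; apply/eqP; exact: e.
Qed.

(** ** Bounded operators *)

Lemma sqnormE u : sqnorm u = Re (dot u u). Proof. by rewrite dotuu. Qed.

Lemma sqnormD_le u v : L2 u -> L2 v ->
  sqnorm (fun z => u z + v z) <= 2 * sqnorm u + 2 * sqnorm v.
Proof.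
move=> Lu Lv; have : sqnorm (fun z => u z + v z) + sqnorm (fun z => u z - v z) =
   2 * sqnorm u + 2 * sqnorm v; last by move=> <-; rewrite lerDl sqnorm_ge0.
have LD := L2D Lu Lv; have LB := L2B Lu Lv.
rewrite !sqnormE (dotBl Lu Lv LB) (dotBr Lu Lu Lv) (dotBr Lv Lu Lv).
rewrite (dotDl Lu Lv LD) (dotDr Lu Lu Lv) (dotDr Lv Lu Lv).
by rewrite !cReD !cReN !cReD !cReN; ring.
Qed.

Lemma norm2_le (M : R) u v : 0 <= M -> sqnorm u <= M * sqnorm v ->
  norm2 u <= Num.sqrt M * norm2 v.
Proof. by move=> M0 uv; rewrite !norm2E -sqrtrM // ler_sqrt // mulr_ge0 // sqnorm_ge0. Qed.

Lemma norm2_ge0 u : 0 <= norm2 u. Proof. by rewrite norm2E sqrtr_ge0. Qed.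

Lemma norm2_sqr u : norm2 u ^+ 2 = sqnorm u.
Proof. by rewrite norm2E sqr_sqrtr // sqnorm_ge0. Qed.

Lemma bounded_op_sqnorm A : bounded_op A ->
  exists2 M : R, 0 <= M & forall u, hardy u -> sqnorm (A u) <= M * sqnorm u.
Proof.
move=> [_ _ [M hM]]; exists (M ^+ 2); first exact: sqr_ge0.
move=> u hu; rewrite -!norm2_sqr -(real_normK (num_real M)) -exprMn.
rewrite lerXn2r ?nnegrE ?mulr_ge0 ?norm2_ge0 //.
by apply: le_trans (hM u hu) _; rewrite ler_wpM2r ?norm2_ge0 // ler_norm.
Qed.

Lemma bounded_op_of_sqnorm A (M : R) : 0 <= M ->
  (forall u, hardy u -> hardy (A u)) ->
  (forall a u v, hardy u -> hardy v ->
     eqT (A (fun z => a * u z + v z)) (fun z => a * A u z + A v z)) ->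
  (forall u, hardy u -> sqnorm (A u) <= M * sqnorm u) -> bounded_op A.
Proof.
move=> M0 hA lA bA; split=> //; exists (Num.sqrt M) => u hu.
exact: norm2_le (bA u hu).
Qed.

Lemma bounded_op_hardy A u : bounded_op A -> hardy u -> hardy (A u).
Proof. by case=> hA _ _; exact: hA. Qed.

Lemma sqnorm0 : sqnorm (fun=> 0 : C) = 0.
Proof.
rewrite sqnormE; have := dotZl 0 (L2_cst (0 : C)) (L2_cst (0 : C)).
by rewrite !mul0r => ->.
Qed.

Lemma bounded_op_eqT A u v : bounded_op A -> hardy u -> hardy v -> eqT u v ->
  eqT (A u) (A v).
Proof.
move=> bA hu hv uv; have [M M0 hM] := bounded_op_sqnorm bA; have [hA lA _] := bA.
have hd := hardyB hu hv; have hAd := hA _ hd.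
have d0 : sqnorm (fun z => u z - v z) = 0.
  rewrite -sqnorm0; apply: sqnorm_eqT.
  - exact: hardy_L2.
  - exact: L2_cst.
  by apply: filterS uv => t e At; rewrite e // subrr.
have /(sqnorm_eq0 (hardy_L2 hAd)) z : sqnorm (A (fun z => u z - v z)) = 0.
  by apply/eqP; rewrite eq_le sqnorm_ge0 andbT (le_trans (hM _ hd)) // d0 mulr0.
have := lA 1 _ _ hd hv; rewrite (_ : (fun z => _) = u); last first.
  by apply/funext=> x; ring.
by apply: filterS2 z => t e1 e2 At; rewrite e2 // e1 // mulr0 add0r.
Qed.

Lemma bounded_op_comp A B : bounded_op A -> bounded_op B -> bounded_op (A \o B).
Proof.
move=> bA bB; have [M M0 hM] := bounded_op_sqnorm bA; have [N N0 hN] := bounded_op_sqnorm bB.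
have [hA lA _] := bA; have [hB lB _] := bB.
apply: (@bounded_op_of_sqnorm _ (M * N)); first exact: mulr_ge0.
- by move=> u hu; apply/hA/hB.
- move=> a u v hu hv; apply: eqT_trans _ (lA a _ _ (hB _ hu) (hB _ hv)).
  apply: (bounded_op_eqT bA); last exact: lB.
    by apply: hB; apply: hardyD => //; exact: hardyZ.
  by apply: hardyD; [apply: hardyZ|]; exact: hB.
move=> u hu; apply: le_trans (hM _ (hB _ hu)) _.
by rewrite -mulrA ler_wpM2l // hN.
Qed.

Lemma bounded_op_sub_id A : bounded_op A -> bounded_op (sub_id A).
Proof.
move=> bA; have [M M0 hM] := bounded_op_sqnorm bA; have [hA lA _] := bA.
apply: (@bounded_op_of_sqnorm _ (2 * M + 2)); first by rewrite addr_ge0 ?mulr_ge0.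
- by move=> u hu; apply: hardyB => //; exact: hA.
- move=> a u v hu hv; have := lA a u v hu hv; apply: filterS => t e At.
  by rewrite /sub_id e //; ring.
move=> u hu; have Lu := hardy_L2 hu; have LA := hardy_L2 (hA _ hu).
have := sqnormD_le LA (L2Z (-1) Lu).
have -> : sqnorm (fun z => -1 * u z) = sqnorm u.
  by apply: complexI; rewrite -!dotuu dotZl ?dotZr //; [rewrite rmorphN1; ring|exact: L2Z].
have -> : (fun z => A u z + -1 * u z) = sub_id A u.
  by apply/funext=> z; rewrite mulN1r.
move/le_trans; apply.
by have := hM u hu; have := sqnorm_ge0 u; set x := sqnorm u; set y := sqnorm (A u); nra.
Qed.

(** The chosen inverse is any given one up to null sets, by the usual uniqueness
    argument. *)
Lemma op_inv_spec A B : inverse_ops A B ->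
  bounded_op (op_inv A) /\ forall u, hardy u -> eqT (op_inv A u) (B u).
Proof.
move=> AB; have : inverse_ops A (op_inv A) by apply: xgetPex; exists B.
move=> [bA bA' AA']; split=> // u hu; have [_ bB BA] := AB.
have hA'u := bounded_op_hardy bA' hu.
have [_ /eqT_sym e] := BA _ hA'u; apply: eqT_trans e _.
apply: bounded_op_eqT => //; first exact: bounded_op_hardy.
by have [] := AA' u hu.
Qed.

(** ** Toeplitz operators *)

(** The existence of orthogonal decompositions is taken as a hypothesis, to be met
    by explicit formulas instead of the completeness of the Hardy space. *)
Lemma toeplitz_bounded (phi : C -> C) : continuous_circle phi ->
  (forall u, hardy u -> exists2 w, hardy w & hardy_perp (fun z => phi z * u z - w z)) ->
  bounded_op (toeplitz phi).
Proof.
move=> cphi dec; have [M M0 phiM] := continuous_circle_bounded cphi.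
have L u : hardy u -> L2 (fun z => phi z * u z).
  by move=> hu; apply: L2_mulr => //; exact: hardy_L2.
have T u : hardy u -> hardy (toeplitz phi u) /\
    hardy_perp (fun z => phi z * u z - toeplitz phi u z).
  by move=> hu; have [w hw pw] := dec u hu; have [] := hardy_proj_eq (L u hu) hw pw.
apply: (bounded_op_of_sqnorm M0).
- by move=> u /T[].
- move=> a u v hu hv; have [hTu [Lu pu]] := T u hu; have [hTv [Lv pv]] := T v hv.
  have hd : hardy (fun z => a * u z + v z) by apply: hardyD => //; exact: hardyZ.
  have [] // := hardy_proj_eq (L _ hd) (hardyD (hardyZ a hTu) hTv).
  have e t : a * (phi (cis t) * u (cis t) - toeplitz phi u (cis t)) +
     (phi (cis t) * v (cis t) - toeplitz phi v (cis t)) =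
     phi (cis t) * (a * u (cis t) + v (cis t)) - (a * toeplitz phi u (cis t) + toeplitz phi v (cis t)).
    by ring.
  split; first by apply: eq_L2 (L2D (L2Z a Lu) Lv) => t; rewrite e.
  move=> w hw; have Lw := hardy_L2 hw; transitivity (dot (fun z =>
    a * (phi z * u z - toeplitz phi u z) + (phi z * v z - toeplitz phi v z)) w).
    by apply: eq_dot => // t; rewrite e.
  by rewrite dotDl ?dotZl // ?pu ?pv ?mulr0 ?addr0 //; exact: L2Z.
move=> u hu; have [hTu [Lu pu]] := T u hu; have LT := hardy_L2 hTu.
apply: le_trans (sqnorm_mulr_le cphi (hardy_L2 hu) phiM).
have -> : (fun z => phi z * u z) =
    (fun z => (phi z * u z - toeplitz phi u z) + toeplitz phi u z).
  by apply/funext=> z; rewrite subrK.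
by rewrite sqnormD ?pu // lerDr sqnorm_ge0.
Qed.

Lemma toeplitz_eq (phi : C -> C) u w : continuous_circle phi -> hardy u -> hardy w ->
  hardy_perp (fun z => phi z * u z - w z) -> eqT (toeplitz phi u) w.
Proof.
move=> cphi hu hw pw.
by have [] := hardy_proj_eq (L2_mulr cphi (hardy_L2 hu)) hw pw.
Qed.

End Operators.

(** * Division by a polynomial with roots in the disk *)

Section Remainder.
Context (R : realType).
Local Notation C := R[i].
Local Notation Re := complex.Re.
Local Notation Im := complex.Im.
Local Notation "x %:C" := (real_complex_def (Phant R) x) : ring_scope.
Local Notation "x +i* y" := (Complex x y) : ring_scope.
Implicit Types (u v w : C -> C) (t : R) (a b z : C) (p q r s : {poly C}).

Lemma abs2J z : abs2 z^* = abs2 z.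
Proof. by rewrite /abs2 cReJ cImJ sqrrN. Qed.

(** On the circle the conjugate of [z / (z - b)] is [1 / (1 - b^* z)]. *)
Lemma multiplier_inner_conj q : inner_poly q ->
  multiplier (fun z => (z ^+ (size q).-1 / q.[z])^*).
Proof.
move=> [q0 iq]; have [zs eq] := closed_field_poly_normal q.
have szq : (size q).-1 = size zs.
  by rewrite eq size_scale ?lead_coef_eq0 // size_prod_XsubC.
have izs z : z \in zs -> abs2 z < 1.
  by move=> zzs; apply: iq; rewrite eq rootZ ?lead_coef_eq0 // root_prod_XsubC.
suff mzs : multiplier (fun z => (z ^+ size zs / \prod_(a <- zs) (z - a))^*).
  apply: eq_multiplier (multiplierM (multiplier_cst ((lead_coef q)^-1)^*) mzs) => t.
  rewrite szq [in RHS]eq hornerZ horner_prod -rmorphM; congr (_ ^*).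
  rewrite invfM mulrCA; congr (_ * (_ * _^-1)).
  by apply: eq_bigr => a _; rewrite hornerXsubC.
elim: zs izs {eq szq} => [|a zs IH] izs.
  by apply: eq_multiplier (multiplier_cst 1) => t; rewrite big_nil /= expr0 divr1 conjC1.
have mzs : multiplier (fun z => (z ^+ size zs / \prod_(a <- zs) (z - a))^*).
  by apply: IH => z zzs; apply: izs; rewrite inE zzs orbT.
have ia : abs2 a^* < 1 by rewrite abs2J izs // mem_head.
have cnz t : 1 - a^* * cis t != 0.
  rewrite subr_eq0; apply/eqP => /(congr1 (@abs2 R)).
  by rewrite abs2M cis_abs2 abs2_1 mulr1 => e; rewrite -e ltxx in ia.
have mg : multiplier (fun z => (1 - a^* * z)^-1).
  split; last by move=> u; exact: hardy_geometric.
  apply: continuous_circleV => //.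
  apply: eq_continuous_circle (continuous_circleD (continuous_circle_cst 1)
    (continuous_circleM (continuous_circle_cst (- a^*)) (@continuous_circle_id R))) => t.
  by rewrite mulNr.
apply: eq_multiplier (multiplierM mg mzs) => t.
rewrite big_cons invfM /= exprS mulrACA [in RHS]rmorphM; congr (_ * _).
rewrite rmorphM fmorphV rmorphB /= !cis_conj -invfM.
by congr (_^-1); rewrite mulrBr mulfV ?cis_neq0 // mulrC.
Qed.

Lemma multiplier_reverse d p : (size p <= d.+1)%N ->
  multiplier (fun z => (p.[z] / z ^+ d)^*).
Proof.
move=> sp; apply: eq_multiplier (multiplier_horner (\poly_(i < d.+1) (p`_(d - i))^* )) => t.
rewrite horner_poly (horner_coef_wide _ sp) mulr_suml rmorph_sum /=.
rewrite (reindex_inj rev_ord_inj) /=; apply: eq_bigr => i _.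
have id : (i <= d)%N by rewrite -ltnS.
rewrite subSS subKn // !rmorphM fmorphV !rmorphXn /= cis_conj -mulrA; congr (_ * _).
have e : cis t ^+ d = cis t ^+ i * cis t ^+ (d - i) by rewrite -exprD subnKC.
by rewrite !exprVn invrK e mulKf // expf_neq0 // cis_neq0.
Qed.

(** On the circle the conjugate of [p / q] is the quotient of the reversed
    conjugate polynomials, and the roots of the reversed [q] lie outside. *)
Lemma multiplier_frac_conj p q : inner_poly q -> (size p <= size q)%N ->
  multiplier (fun z => (p.[z] / q.[z])^*).
Proof.
move=> iq pq; have [q0 _] := iq.
have sq : (size q).-1.+1 = size q by rewrite prednK // size_poly_gt0.
have mp := @multiplier_reverse (size q).-1 p; rewrite sq in mp.
apply: eq_multiplier (multiplierM (multiplier_inner_conj iq) (mp pq)) => t.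
rewrite -rmorphM; congr (_ ^*); rewrite mulrC mulrA; congr (_ / _).
by rewrite divfK // expf_neq0 // cis_neq0.
Qed.

Lemma continuous_frac p q : inner_poly q -> continuous_circle (fun z => p.[z] / q.[z]).
Proof.
move=> iq; apply: continuous_circleM; first exact: continuous_circle_horner.
apply: continuous_circleV; last exact: continuous_circle_horner.
by move=> t; exact: inner_poly_neq0.
Qed.

(** Its conjugate is [z] times a multiplier, so that its products with Hardy
    functions have mean 0. *)
Lemma hardy_perp_frac r q : inner_poly q -> (size r < size q)%N ->
  hardy_perp (fun z => r.[z] / q.[z]).
Proof.
move=> iq rq; have Lrq : L2 (fun z => r.[z] / q.[z]).
  by apply: L2_continuous; exact: continuous_frac.
split=> // u hu; rewrite (dotC (hardy_L2 hu) Lrq).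
have sXr : (size (r * 'X)%R <= size q)%N.
  have [->|r0] := eqVneq r 0; first by rewrite mul0r size_poly0.
  by rewrite size_mulX.
have [_ /(_ u hu)[_ h0]] := multiplier_frac_conj iq sXr.
rewrite -[RHS]conjC0 -(h0 (- 1)) //; congr (_ ^*); apply: eq_circle_mean => t.
rewrite opprK expr1z hornerM hornerX mulrAC; set x := _ / _.
by rewrite [in RHS]rmorphM /= cis_conj; field; exact: cis_neq0.
Qed.

Context (n : nat) (q : {poly C}).
Hypotheses (q_monic : q \is monic) (size_q : size q = n.+2) (iq : inner_poly q).

(** The coordinates of the remainder modulo [q] of a function [u] of the Hardy
    space are the means of [u z * hrem_kernel l z]; this is Cauchy's formula
    for the remainder, whose kernel is [(q(z) - q(x)) / (q(z) (z - x))] expanded in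
    powers of [x]. *)
Definition hrem_kernel l : C -> C := fun z => z * (drop_poly l.+1 q).[z] / q.[z].

Definition hrem u : 'rV[C]_n.+1 := \row_l circle_mean (fun z => u z * hrem_kernel l z).

Definition hrem_dual (l : nat) : C -> C := fun z => (hrem_kernel l z)^*.

Local Notation X_q := (comp_mx n q).

Lemma hrem_kernelE l t : hrem_kernel l (cis t) = (drop_poly l.+1 q * 'X)%R.[cis t] / q.[cis t].
Proof. by rewrite /hrem_kernel hornerM hornerX [_ * cis t]mulrC. Qed.

Lemma size_drop_mulX l : (size (drop_poly l.+1 q * 'X)%R <= size q)%N.
Proof.
have [->|d0] := eqVneq (drop_poly l.+1 q) 0; first by rewrite mul0r size_poly0.
by rewrite size_mulX // size_drop_poly size_q subSS ltnS leq_subr.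
Qed.

Lemma continuous_hrem_kernel l : continuous_circle (hrem_kernel l).
Proof.
apply: eq_continuous_circle (continuous_frac (drop_poly l.+1 q * 'X) iq) => t.
by rewrite hrem_kernelE.
Qed.

Lemma hardy_hrem_dual l : hardy (hrem_dual l).
Proof.
have [_ /(_ _ (hardy_cst 1))] := multiplier_frac_conj iq (size_drop_mulX l).
by apply: eq_hardy => t; rewrite mulr1 /hrem_dual hrem_kernelE.
Qed.

Lemma L2_hrem_dual l : L2 (hrem_dual l). Proof. exact: hardy_L2 (hardy_hrem_dual l). Qed.

Lemma hremE u l : hrem u 0 l = dot u (hrem_dual l).
Proof. by rewrite mxE; apply: eq_circle_mean => t; rewrite /hrem_dual conjCK. Qed.

Lemma eq_hrem u v : (forall t, u (cis t) = v (cis t)) -> hrem u = hrem v.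
Proof. by move=> uv; apply/rowP => l; rewrite !hremE; apply: eq_dot. Qed.

Lemma hremD u v : L2 u -> L2 v -> hrem (fun z => u z + v z) = hrem u + hrem v.
Proof.
by move=> Lu Lv; apply/rowP => l; rewrite [in RHS]mxE !hremE dotDl //; exact: L2_hrem_dual.
Qed.

Lemma hremB u v : L2 u -> L2 v -> hrem (fun z => u z - v z) = hrem u - hrem v.
Proof.
move=> Lu Lv; apply/rowP => l; rewrite [in RHS]mxE [X in _ + X]mxE !hremE dotBl //.
exact: L2_hrem_dual.
Qed.

Lemma hremZ a u : L2 u -> hrem (fun z => a * u z) = a *: hrem u.
Proof.
by move=> Lu; apply/rowP => l; rewrite [in RHS]mxE !hremE dotZl //; exact: L2_hrem_dual.
Qed.

Lemma drop_polyS l : drop_poly l q = drop_poly l.+1 q * 'X + (q`_l)%:P.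
Proof.
apply/polyP=> i; rewrite coefD coefMX coefC !coef_drop_poly.
by case: i => [|i] /=; rewrite ?add0r ?addr0 // addSnnS.
Qed.

Lemma horner_drop_polyS l z :
  (drop_poly l q).[z] = (drop_poly l.+1 q).[z] * z + q`_l.
Proof. by rewrite drop_polyS hornerD hornerM hornerX hornerC. Qed.

Lemma drop_poly_top : drop_poly n.+1 q = 1.
Proof.
have l1 : q`_n.+1 = 1 by have /monicP := q_monic; rewrite /lead_coef size_q.
by rewrite drop_polyS l1 drop_poly_eq0 ?size_q // mul0r add0r.
Qed.

(** Multiplication of the kernels by [z] is the action of the companion matrix;
    the last term comes from the polynomial part of [z q(z) / q(z)]. *)
Lemma hrem_kernel_mulX (j : 'I_n.+1) t : cis t * hrem_kernel j (cis t) =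
  \sum_(i < n.+1) hrem_kernel i (cis t) * X_q i j + (j == 0 :> nat)%:R * cis t.
Proof.
have q0 : q.[cis t] != 0 by exact: inner_poly_neq0.
have last : hrem_kernel n (cis t) = cis t / q.[cis t].
  by rewrite /hrem_kernel drop_poly_top hornerC mulr1.
rewrite (bigD1 ord_max) //= mxE /= eqxx last.
have -> : \sum_(i < n.+1 | i != ord_max) hrem_kernel i (cis t) * X_q i j =
    if j == 0 :> nat then 0 else hrem_kernel j.-1 (cis t).
  have [j0|j0] := eqVneq (j : nat) 0%N.
    rewrite big1 // => i im; rewrite mxE; case: ifP => [e|_].
      by rewrite -val_eqE /= e in im.
    by rewrite j0 mulr0.
  have jn : (j.-1 < n.+1)%N by rewrite (leq_ltn_trans (leq_pred _)).
  rewrite (bigD1 (Ordinal jn)) /=; last first.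
    by rewrite -val_eqE /= neq_ltn -ltnS prednK ?lt0n // ltn_ord.
  rewrite mxE /= prednK ?lt0n // eqxx ifN ?mulr1; last first.
    by rewrite neq_ltn -ltnS prednK ?lt0n // ltn_ord.
  rewrite big1 ?addr0 // => i /andP[im ij]; rewrite mxE ifN; last by rewrite -val_eqE in im.
  case: eqP => [e|_]; last by rewrite mulr0.
  by rewrite -val_eqE /= -e eqxx in ij.
have step : q`_j = (drop_poly j q).[cis t] - (drop_poly j.+1 q).[cis t] * cis t.
  by rewrite horner_drop_polyS addrC addKr.
rewrite /hrem_kernel step; case: eqVneq => [->|j0].
  by rewrite drop_poly0l mulr1n; field.
by rewrite prednK ?lt0n // mulr0n; field.
Qed.

Lemma hrem_mulX u : hardy u -> hrem (fun z => z * u z) = hrem u *m X_q.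
Proof.
move=> hu; have Lu := hardy_L2 hu; apply/rowP => j; rewrite [RHS]mxE [LHS]mxE.
have Lk i : integrable_circle (fun z => u z * hrem_kernel i z).
  have := integrable_dot Lu (L2_hrem_dual i); rewrite (_ : (fun z => _) = (fun z => u z * hrem_kernel i z)) //.
  by apply/funext => z; rewrite /hrem_dual conjCK.
have Lz : integrable_circle (fun z => z ^ 1 * u z).
  by apply: integrable_L2; exact: L2_Xz_mul.
have -> : circle_mean (fun z => z * u z * hrem_kernel j z) =
    circle_mean (fun z => \sum_(i < n.+1) X_q i j * (u z * hrem_kernel i z) +
                          (j == 0 :> nat)%:R * (z ^ 1 * u z)).
  apply: eq_circle_mean => t; rewrite mulrAC hrem_kernel_mulX mulrDl mulr_suml expr1z mulrA.
  by congr (_ + _); apply: eq_bigr => i _; ring.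
have Ls : forall s : seq 'I_n.+1,
    integrable_circle (fun z => \sum_(i <- s) X_q i j * (u z * hrem_kernel i z)) /\
    circle_mean (fun z => \sum_(i <- s) X_q i j * (u z * hrem_kernel i z)) =
    \sum_(i <- s) hrem u 0 i * X_q i j.
  elim=> [|i s [IH1 IH2]].
    have z0 : (fun z : C => \sum_(i <- [::]) X_q i j * (u z * hrem_kernel i z)) = fun=> 0.
      by apply/funext => z; rewrite big_nil.
    rewrite z0 big_nil circle_mean0; split=> //; apply: integrable_L2; exact: L2_cst.
  have -> : (fun z => \sum_(k <- i :: s) X_q k j * (u z * hrem_kernel k z)) =
      (fun z => X_q i j * (u z * hrem_kernel i z) + \sum_(k <- s) X_q k j * (u z * hrem_kernel k z)).
    by apply/funext => z; rewrite big_cons.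
  rewrite big_cons -IH2; split.
    by apply: integrable_circleD => //; exact: integrable_circleZ.
  rewrite circle_meanD //; last exact: integrable_circleZ.
  by rewrite circle_meanZ // [in RHS]mxE [in RHS]mulrC.
have [Ls1 Ls2] := Ls (index_enum _).
rewrite circle_meanD //; last exact: integrable_circleZ.
rewrite Ls2 circle_meanZ //; have [_ /(_ (- 1))] := hu.
by rewrite /fourier opprK => -> //; rewrite mulr0 addr0.
Qed.

Lemma hrem_horner s u : hardy u ->
  hrem (fun z => s.[z] * u z) = hrem u *m horner_mx X_q s.
Proof.
move=> hu; have Lu := hardy_L2 hu; elim/poly_ind: s => [|s c IH].
  rewrite rmorph0 mulmx0 -(scale0r (hrem u)) -hremZ //; apply: eq_hrem => t.
  by rewrite horner0.
have [_ /(_ u hu) hsu] := @multiplier_horner R s.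
rewrite rmorphD rmorphM /= horner_mx_X horner_mx_C mulmxDr mul_mx_scalar -hremZ //.
rewrite [horner_mx _ s * _]/(_ *m _) mulmxA -IH -hrem_mulX // -hremD; last exact: L2Z.
  by apply: eq_hrem => t; rewrite hornerMXaddC; ring.
exact: (L2_Xz_mul 1 (hardy_L2 hsu)).
Qed.

Lemma hrem_1 : hrem (fun=> 1) = delta_mx 0 0.
Proof.
(* Dividing the recursion of the kernels by z, all means on the right vanish. *)
apply/rowP => j; rewrite mxE [RHS]mxE eqxx /=.
have mean_div l : circle_mean (fun z => z^-1 * hrem_kernel l z) = 0.
  have [L h0] := hardy_hrem_dual l; have L1 := L2_Xz_mul 1 L.
  rewrite -[RHS]conjC0 -(h0 (- 1)) // /fourier opprK -circle_meanJ; last exact: integrable_L2.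
  by apply: eq_circle_mean => t; rewrite /hrem_dual expr1z rmorphM /= conjCK cis_conj.
have mean_sum (s : seq 'I_n.+1) : integrable_circle (fun z => \sum_(i <- s) X_q i j * (z^-1 * hrem_kernel i z)) /\
    circle_mean (fun z => \sum_(i <- s) X_q i j * (z^-1 * hrem_kernel i z)) = 0.
  elim: s => [|i s [IH1 IH2]].
    have -> : (fun z : C => \sum_(i <- [::]) X_q i j * (z^-1 * hrem_kernel i z)) = fun=> 0.
      by apply/funext => z; rewrite big_nil.
    by rewrite circle_mean0; split=> //; apply: integrable_L2; exact: L2_cst.
  have -> : (fun z => \sum_(k <- i :: s) X_q k j * (z^-1 * hrem_kernel k z)) =
      (fun z => X_q i j * (z^-1 * hrem_kernel i z) + \sum_(k <- s) X_q k j * (z^-1 * hrem_kernel k z)).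
    by apply/funext => z; rewrite big_cons.
  have Lk : integrable_circle (fun z => z^-1 * hrem_kernel i z).
    apply: integrable_L2; apply: L2_continuous; apply: continuous_circleM.
      by apply: continuous_circleV; [exact: cis_neq0|exact: continuous_circle_id].
    exact: continuous_hrem_kernel.
  have Lk' := integrable_circleZ (X_q i j) Lk.
  split; first exact: integrable_circleD.
  by rewrite circle_meanD // circle_meanZ // mean_div mulr0 IH2 addr0.
have [Ls1 Ls2] := mean_sum (index_enum _).
have Lc : integrable_circle (fun=> (j == 0 :> nat)%:R : C) by apply: integrable_L2; exact: L2_cst.
transitivity (circle_mean (fun z => \sum_(i < n.+1) X_q i j * (z^-1 * hrem_kernel i z) +
                          (j == 0 :> nat)%:R)).
  apply: eq_circle_mean => t; rewrite mul1r; apply: (mulfI (cis_neq0 t)).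
  rewrite hrem_kernel_mulX mulrDr mulr_sumr [cis t * _%:R]mulrC; congr (_ + _).
  by apply: eq_bigr => i _; field; exact: cis_neq0.
rewrite circle_meanD // Ls2 add0r -[RHS]mulr1.
have := fourier_cst ((j == 0 :> nat)%:R : C) 0; rewrite eqxx => <-.
by apply: eq_circle_mean => t; rewrite oppr0 expr0z mul1r.
Qed.

Lemma delta_mx_comp (i : 'I_n.+1) : delta_mx (0 : 'I_1) 0 *m horner_mx X_q 'X^i = delta_mx 0 i.
Proof.
case: i => i; elim: i => [|i IH] ilt.
  by rewrite expr0 rmorph1 mulmx1; congr delta_mx; apply/val_inj.
have ilt' := ltnW ilt; rewrite exprSr rmorphM /= horner_mx_X.
rewrite [horner_mx _ _ * _]/(_ *m _) mulmxA [_ *m horner_mx _ _](IH ilt') -rowE.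
apply/rowP => j; rewrite !mxE /= ifN; last by rewrite neq_ltn -ltnS ilt.
by rewrite -val_eqE /= eq_sym.
Qed.

(** Powers of the companion matrix map the coordinates of 1 to those of ['X^i]. *)
Lemma hrem_poly r : (size r <= n.+1)%N -> hrem (fun z => r.[z]) = poly_rV r.
Proof.
move=> sr; have -> : hrem (fun z => r.[z]) = hrem (fun=> 1) *m horner_mx X_q r.
  by rewrite -hrem_horner; [apply: eq_hrem => t; rewrite mulr1|exact: hardy_cst].
rewrite hrem_1 -{1}(poly_rV_K sr) /rVpoly.
rewrite poly_def rmorph_sum /= mulmx_sumr; apply/rowP => j.
rewrite summxE (bigD1 j) //= big1 ?addr0 => [|i ij].
  by rewrite valK linearZ /= -scalemxAr delta_mx_comp !mxE !eqxx /= mulr1.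
by rewrite valK linearZ /= -scalemxAr delta_mx_comp !mxE [j == _]eq_sym (negbTE ij) /= mulr0.
Qed.

Lemma hrem_root u : hardy u -> hrem (fun z => q.[z] * u z) = 0.
Proof. by move=> hu; rewrite hrem_horner // comp_mx_root // mulmx0. Qed.

Lemma hrem_rem u : hrem (fun z => (rVpoly (hrem u)).[z]) = hrem u.
Proof. by rewrite hrem_poly ?size_poly // rVpolyK. Qed.

(** The negative Fourier coefficients of [(u - r) / q] are last coordinates of
    remainders of [z^m (u - r)], because the last kernel is [z / q]. *)
Lemma hardy_quotient u : hardy u ->
  hardy (fun z => (u z - (rVpoly (hrem u)).[z]) / q.[z]).
Proof.
move=> hu; set r := rVpoly _; set v := fun z => u z - r.[z].
have hv : hardy v by apply: hardyB => //; exact: hardy_horner.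
have cq : continuous_circle (fun z => (q.[z])^-1).
  apply: continuous_circleV; last exact: continuous_circle_horner.
  by move=> t; exact: inner_poly_neq0.
split.
  apply: eq_L2 (L2_mulr cq (hardy_L2 hv)) => t; by rewrite mulrC.
case=> // m _; have rv : hrem v = 0.
  rewrite hremB; [|exact: hardy_L2|exact: hardy_L2 (hardy_horner _)].
  by rewrite /r hrem_rem subrr.
have : hrem (fun z => ('X^m).[z] * v z) 0 ord_max = 0.
  by rewrite hrem_horner // rv mul0mx mxE.
rewrite mxE => <-; apply: eq_circle_mean => t.
rewrite NegzE opprK /hrem_kernel /= drop_poly_top hornerC hornerXn mulr1 -exprnP exprSr /v.
by rewrite -!mulrA; congr (_ * _); rewrite mulrCA.
Qed.

End Remainder.

(** * Convergence of complex sequences *)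

Section ComplexSequences.
Context (R : realType).
Local Notation C := R[i].
Local Notation Re := complex.Re.
Local Notation Im := complex.Im.
Local Notation "x %:C" := (real_complex_def (Phant R) x) : ring_scope.
Local Notation "x +i* y" := (Complex x y) : ring_scope.
Implicit Types (u v w : nat -> C) (t : R) (a b z : C).

(** Fixes the alias that carries the topology. *)
Definition cvgC u a : Prop := (u : nat -> R[i]^o) @ \oo --> (a : R[i]^o).

Lemma normC_abs2 z : `|z| ^+ 2 = (abs2 z)%:C.
Proof. by rewrite normCK mulcJ. Qed.

Lemma normC_ltE z (e : R) : 0 < e -> (`|z| < e%:C) = (abs2 z < e ^+ 2).
Proof.
move=> e0; rewrite -[RHS]ltcR -normC_abs2 rmorphXn /=.
by rewrite ltr_pXn2r // nnegrE ?normr_ge0 // ler0c ltW.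
Qed.

Lemma cvgCP u a : cvgC u a <-> (fun n => abs2 (u n - a)) @ \oo --> (0 : R).
Proof.
split=> [ua|ua]; last first.
  apply/(@cvgrPdist_lt _ R[i]^o) => e e0.
  have [e' e'0 ->] : exists2 e' : R, 0 < e' & e = e'%:C.
    exists (Re e); first by move: e0; rewrite ltcE => /andP[].
    by apply: complex_ext => //=; apply/eqP; move: e0; rewrite ltcE eq_sym => /andP[].
  have /cvgrPdist_lt /(_ (e' ^+ 2)) := ua; rewrite exprn_gt0 // => /(_ isT).
  apply: filterS => n; rewrite sub0r normrN ger0_norm ?abs2_ge0 // => h.
  by rewrite distrC normC_ltE.
apply/cvgrPdist_lt => e e0; have se0 : 0 < Num.sqrt e by rewrite sqrtr_gt0.
have /(@cvgrPdist_lt _ R[i]^o) /(_ (Num.sqrt e)%:C) := ua; rewrite ltcR => /(_ se0).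
apply: filterS => n; rewrite distrC normC_ltE // sqr_sqrtr ?ltW // => h.
by rewrite sub0r normrN ger0_norm ?abs2_ge0.
Qed.

Lemma cvgC0P u : cvgC u 0 <-> (fun n => abs2 (u n)) @ \oo --> (0 : R).
Proof.
have e : (fun n => abs2 (u n - 0)) = (fun n => abs2 (u n)).
  by apply/funext => n; rewrite subr0.
by have := cvgCP u 0; rewrite e.
Qed.

Lemma eq_cvgC u v a : (forall n, u n = v n) -> cvgC u a -> cvgC v a.
Proof. by move=> /funext ->. Qed.

Lemma cvgC_cst a : cvgC (fun=> a) a. Proof. exact: cvg_cst. Qed.

Lemma cvgC_lim u a : cvgC u a -> limn (u : nat -> R[i]^o) = a.
Proof. by move=> /cvg_lim; apply. Qed.

Lemma cvgCD u v a b : cvgC u a -> cvgC v b -> cvgC (fun n => u n + v n) (a + b).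
Proof. by move=> ua vb; exact: (@cvgD R[i] R[i]^o _ _ _ _ _ _ _ ua vb). Qed.

Lemma cvgCM u v a b : cvgC u a -> cvgC v b -> cvgC (fun n => u n * v n) (a * b).
Proof. by move=> ua vb; exact: (@cvgM R[i] _ _ _ _ _ _ _ ua vb). Qed.

Lemma cvgC_sum (I : Type) (s : seq I) (F : I -> nat -> C) (l : I -> C) :
  (forall i, cvgC (F i) (l i)) -> cvgC (fun n => \sum_(i <- s) F i n) (\sum_(i <- s) l i).
Proof.
move=> Fl; elim: s => [|i s IH].
  by rewrite big_nil; apply: (@eq_cvgC (fun=> 0)) => [n|]; [rewrite big_nil|exact: cvgC_cst].
by rewrite big_cons; apply: (eq_cvgC _ (cvgCD (Fl i) IH)) => n; rewrite big_cons.
Qed.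

Lemma cvgC_prod (I : Type) (s : seq I) (F : I -> nat -> C) (l : I -> C) :
  (forall i, cvgC (F i) (l i)) -> cvgC (fun n => \prod_(i <- s) F i n) (\prod_(i <- s) l i).
Proof.
move=> Fl; elim: s => [|i s IH].
  by rewrite big_nil; apply: (@eq_cvgC (fun=> 1)) => [n|]; [rewrite big_nil|exact: cvgC_cst].
by rewrite big_cons; apply: (eq_cvgC _ (cvgCM (Fl i) IH)) => n; rewrite big_cons.
Qed.

Lemma cvgC_det m (X : nat -> 'M[C]_m) (L : 'M[C]_m) :
  (forall i j, cvgC (fun n => X n i j) (L i j)) -> cvgC (fun n => \det (X n)) (\det L).
Proof.
move=> XL; apply: cvgC_sum => s; apply: cvgCM; first exact: cvgC_cst.
by apply: cvgC_prod => i; exact: XL.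
Qed.

Lemma cvgC_bounded_null (u v : nat -> C) (K : R) :
  (forall n, abs2 (u n) <= K) -> cvgC v 0 -> cvgC (fun n => u n * v n) 0.
Proof.
move=> uK /cvgC0P v0; apply/cvgC0P.
have cv : (fun n => K * abs2 (v n)) @ \oo --> (0 : R).
  by rewrite -(mulr0 K); apply: cvgMr.
apply: (squeeze_cvgr _ (cvg_cst 0) cv); apply: nearW => n.
by rewrite abs2_ge0 abs2M ler_wpM2r ?abs2_ge0.
Qed.

Lemma cvgC_shift u a k : cvgC u a -> cvgC (fun n => u (n + k)%N) a.
Proof. by move=> ua; exact: (@cvg_comp _ _ _ (fun n => (n + k)%N) u _ _ _ (cvg_addnr k) ua). Qed.

Lemma cvgC_eventually u a N : (forall n, (N <= n)%N -> u n = a) -> cvgC u a.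
Proof.
by move=> ua; apply: cvg_near_cst; exists N => // n /= /ua ->.
Qed.

Lemma cvgC_real (u : nat -> R) (a : R) : u @ \oo --> a -> cvgC (fun n => (u n)%:C) a%:C.
Proof.
move=> ua; apply/cvgCP.
have -> : (fun n => abs2 ((u n)%:C - a%:C)) = (fun n => (u n - a) * (u n - a)).
  by apply/funext => n; rewrite /abs2 /= subrr expr0n addr0 expr2.
rewrite -[X in _ --> X](mulr0 0); have d : (fun n => u n - a) @ \oo --> (0 : R).
  by rewrite -(subrr a); apply: cvgB => //; exact: cvg_cst.
exact (cvgM d d).
Qed.

Lemma cvgC_of_ReIm u a : (fun n => Re (u n)) @ \oo --> Re a ->
  (fun n => Im (u n)) @ \oo --> Im a -> cvgC u a.
Proof.
move=> ru iu; have := cvgCD (cvgC_real ru) (cvgCM (@cvgC_cst (0 +i* 1)) (cvgC_real iu)).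
have e z : (Re z)%:C + (0 +i* 1) * (Im z)%:C = z.
  by apply: complex_ext; rewrite ?cReD ?cImD ?cReM ?cImM /=; ring.
by rewrite e; apply: eq_cvgC => n; rewrite e.
Qed.

End ComplexSequences.

(** * Finite rank operators: trace class and Fredholm determinant *)

Section FiniteRank.
Context (R : realType).
Local Notation C := R[i].
Local Notation Re := complex.Re.
Local Notation Im := complex.Im.
Local Notation "x %:C" := (real_complex_def (Phant R) x) : ring_scope.
Local Notation "x +i* y" := (Complex x y) : ring_scope.
Implicit Types (u v w : C -> C) (t : R) (a b z : C).

Lemma fourier_cvg0 u : L2 u -> cvgC (fun N => fourier u N%:Z) 0.
Proof.
move=> Lu; apply/cvgC0P; apply: cvg_series_cvg_0.
apply: nondecreasing_is_cvgn.
  by apply/nondecreasing_seqP => N; rewrite /series /= big_nat_recr //= lerDl abs2_ge0.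
exists (sqnorm u) => _ [N _ <-]; rewrite /series /= big_mkord.
exact: sum_abs2_fourier_le.
Qed.

Lemma dot_CauchySchwarz u v : L2 u -> L2 v -> abs2 (dot u v) <= sqnorm u * sqnorm v.
Proof.
move=> Lu Lv; have [v0|v0] := eqVneq (sqnorm v) 0.
  have -> : dot u v = 0.
    rewrite (@dot_eqT _ _ _ u (fun=> 0)) //; first last.
    - exact: sqnorm_eq0.
    - exact: eqT_refl.
    - exact: L2_cst.
    rewrite -[RHS]circle_mean0; apply: eq_circle_mean => t.
    by rewrite /= conjC0 mulr0.
  by rewrite v0 mulr0 /abs2 /= expr0n addr0.
have vp : 0 < sqnorm v by rewrite lt0r v0 sqnorm_ge0.
pose c : C := ((Num.sqrt (sqnorm v))^-1)%:C.
have cJ : c^* = c by apply: complex_ext; rewrite ?cReJ ?cImJ //= oppr0.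
have cc : c * c = ((sqnorm v)^-1)%:C.
  apply: complex_ext; rewrite ?cReM ?cImM /= ?mulr0 ?mul0r ?subr0 ?addr0 //.
  by rewrite -invfM -expr2 sqr_sqrtr // ltW.
have Le : L2 (fun z => c * v z) by exact: L2Z.
have := @sqnorm_bessel R unit (fun _ z => c * v z) u (fun=> Le).
rewrite dotZl // dotZr // cJ mulrA cc dotuu => /(_ _ Lu) ->.
  rewrite (bigD1 tt) //= big1 => [|[]] //; rewrite addr0 mulrDl dotZr // cJ abs2M.
  have -> : abs2 c = (sqnorm v)^-1.
    by rewrite /abs2 /= expr0n addr0 exprVn sqr_sqrtr // ltW.
  rewrite mulrAC mulVf // mul1r lerDl mulr_ge0 ?sqnorm_ge0 //.
move=> [] []; rewrite eqxx; apply: complex_ext; rewrite ?cReM ?cImM /= ?mulr0 ?mul0r ?subr0 ?addr0 //.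
by rewrite mulVf.
Qed.

Definition partial_sum u N : C -> C := fun z => \sum_(j < N) fourier u j%:Z * z ^+ j.

(** Removing the coefficients below [N] leaves room for a shift by [-N]. *)
Lemma hardy_tail u N : hardy u -> hardy (fun z => z ^ (- N%:Z) * (u z - partial_sum u N z)).
Proof.
move=> hu; have hS : hardy (partial_sum u N) by apply: hardy_suml => j; exact: hardy_Xn.
have Sk (k : int) : fourier (partial_sum u N) k =
    if (0 <= k) && (k < N%:Z) then fourier u k else 0.
  rewrite fourier_suml; last by move=> j; exact: hardy_L2 (hardy_Xn _ _).
  have FX (j : nat) : fourier (fun z : C => z ^+ j) k = (j%:Z == k)%:R by rewrite -fourier_Xz.
  case: k FX => k FX /=; last first.
    by rewrite big1 // => j _; rewrite FX mulr0.
  rewrite ltz_nat; case: ltnP => kN.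
    rewrite (bigD1 (Ordinal kN)) //= FX eqxx mulr1 big1 ?addr0 // => j jk.
    by move: jk; rewrite FX eqz_nat -val_eqE /= => /negbTE ->; rewrite mulr0.
  rewrite big1 // => j _; rewrite FX eqz_nat ltn_eqF ?mulr0 //.
  exact: leq_trans (ltn_ord j) kN.
have Ld : L2 (fun z => u z - partial_sum u N z) by apply: L2B; exact: hardy_L2.
split; first exact: L2_Xz_mul.
move=> k k0; rewrite fourierXz opprK fourierB; [|exact: hardy_L2..].
rewrite Sk; have [Nk|Nk] := leP 0 (k + N%:Z).
  by rewrite gtrDr k0 subrr.
by have [_ ->] := hu; rewrite // subrr.
Qed.

Context (n : nat) (q : {poly C}).
Hypotheses (q_monic : q \is monic) (size_q : size q = n.+2) (iq : inner_poly q).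

Local Notation hrem := (hrem n q).
Local Notation hrem_dual := (hrem_dual q).
Local Notation X_q := (comp_mx n q).

Let hdual l : hardy (hrem_dual l). Proof. exact: hardy_hrem_dual size_q iq l. Qed.
Let Ldual l : L2 (hrem_dual l). Proof. exact: hardy_L2. Qed.

Lemma hrem_Xn N l : hrem (fun z => z ^+ N) 0 l = (fourier (hrem_dual l) N%:Z)^*.
Proof.
rewrite hremE fourier_dot -[RHS]dotC //; exact: (L2_Xz R N).
Qed.

Lemma hrem_Xn_small (k : 'I_n.+1) : hrem (fun z => z ^+ k) = delta_mx 0 k.
Proof.
have := @hrem_poly _ _ _ q_monic size_q iq 'X^k; rewrite size_polyXn => /(_ (ltn_ord k)).
have -> : (fun z : C => ('X^k).[z]) = (fun z => z ^+ k).
  by apply/funext => z; rewrite hornerXn.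
move=> ->; apply/rowP => j; rewrite !mxE coefXn eqxx /= -val_eqE eq_sym.
by [].
Qed.

(** The powers of the companion matrix tend to 0: their rows are the remainders
    of [z^N], which are Fourier coefficients of square-integrable functions. *)
Lemma comp_mx_power_cvg0 i l : cvgC (fun N => horner_mx X_q 'X^N i l) 0.
Proof.
have e N : horner_mx X_q 'X^N i l = (fourier (hrem_dual l) (N + i)%N%:Z)^*.
  rewrite -hrem_Xn; have -> : horner_mx X_q 'X^N i l = (delta_mx (0 : 'I_1) i *m horner_mx X_q 'X^N) 0 l.
    by rewrite -rowE mxE.
  rewrite -hrem_Xn_small -hrem_horner //; last exact: hardy_Xn.
  by congr (fun_of_matrix _ _ _); apply: eq_hrem => t; rewrite hornerXn exprD.
have /cvgC0P h := cvgC_shift i (fourier_cvg0 (Ldual l)).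
by apply/cvgC0P; under eq_fun do rewrite e abs2J.
Qed.

(** Write [w = S_N + z^N w_N] with [S_N] the partial Fourier sum; the remainder
    of [z^N w_N] tends to 0 as [w_N] is bounded in norm by [w]. *)
Lemma hrem_partial_sums w l : hardy w ->
  cvgC (fun N => \sum_(j < N) fourier w j%:Z * hrem (fun z => z ^+ j) 0 l) (hrem w 0 l).
Proof.
move=> hw; have Lw := hardy_L2 hw.
pose S N : C -> C := partial_sum w N.
have hS N : hardy (S N) by apply: hardy_suml => j; exact: hardy_Xn.
pose v N : C -> C := fun z => z ^ (- N%:Z) * (w z - S N z).
have Ld N : L2 (fun z => w z - S N z) by apply: L2B => //; exact: hardy_L2.
have hv N : hardy (v N) by exact: hardy_tail.
have ew N t : w (cis t) = S N (cis t) + (cis t) ^+ N * v N (cis t).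
  by rewrite /v mulrA exprnP -expfzDr ?cis_neq0 // subrr expr0z mul1r addrC subrK.
have nv N : sqnorm (v N) <= sqnorm w.
  have := @sqnorm_bessel R 'I_N (fun j z => z ^ j%:Z) w (fun j => L2_Xz R j).
  move=> /(_ (fun i j => dot_Xz R i j) Lw) ->.
  have -> : sqnorm (v N) = sqnorm (fun z => w z - \sum_(j < N) dot w (fun z => z ^ j%:Z) * z ^ j%:Z).
    congr (_ * _); apply: eq_Rintegral => t _; rewrite abs2M cisX cis_abs2 mul1r.
    by congr (abs2 (_ - _)); apply: eq_bigr => j _; rewrite fourier_dot.
  by rewrite lerDr sumr_ge0 // => j _; exact: abs2_ge0.
have hremS N : \sum_(j < N) fourier w j%:Z * hrem (fun z => z ^+ j) 0 l = hrem (S N) 0 l.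
  rewrite hremE dot_suml //; last by move=> j; exact: hardy_L2 (hardy_Xn _ _).
  by apply: eq_bigr => j _; rewrite hremE.
have diff N : hrem (S N) 0 l = hrem w 0 l - \sum_(i < n.+1) hrem (v N) 0 i * horner_mx X_q 'X^N i l.
  have -> : hrem w = hrem (S N) + hrem (v N) *m horner_mx X_q 'X^N.
    rewrite -hrem_horner // -hremD //.
    - by apply: eq_hrem => t; rewrite (ew N) hornerXn.
    - exact: hardy_L2.
    - by have [_ /(_ _ (hv N))[]] := @multiplier_horner R 'X^N.
  by rewrite [X in _ = X - _]mxE [X in _ = _ + X - _]mxE addrK.
apply: (@eq_cvgC _ (fun N => hrem w 0 l + (-1) * \sum_(i < n.+1) hrem (v N) 0 i * horner_mx X_q 'X^N i l)).
  by move=> N; rewrite hremS diff mulN1r.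
rewrite -[X in cvgC _ X]addr0; apply: cvgCD; first exact: cvgC_cst.
rewrite -[X in cvgC _ X](mulr0 (-1)); apply: cvgCM; first exact: cvgC_cst.
rewrite [X in cvgC _ X](_ : 0 = \sum_(i < n.+1) 0); last by rewrite big1.
apply: (@cvgC_sum _ _ _ _ (fun=> 0)) => i; apply: (@cvgC_bounded_null _ _ _ (sqnorm w * sqnorm (hrem_dual i))).
  move=> N; rewrite hremE; apply: le_trans (dot_CauchySchwarz (hardy_L2 (hv N)) (Ldual i)) _.
  by rewrite ler_wpM2r ?sqnorm_ge0.
exact: comp_mx_power_cvg0.
Qed.

Section Operator.
Context (W : 'I_n.+1 -> C -> C) (A : (C -> C) -> (C -> C)).
Hypotheses (hW : forall l, hardy (W l)) (bA : bounded_op A)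
  (eA : forall u, hardy u -> eqT (A u) (fun z => \sum_l hrem u 0 l * W l z)).

Let LW l : L2 (W l). Proof. exact: hardy_L2. Qed.

Let FR u : C -> C := fun z => \sum_l hrem u 0 l * W l z.

Let hFR u : hardy (FR u). Proof. exact: hardy_suml. Qed.

Local Open Scope sesquilinear_scope.

Let gram (F : 'I_n.+1 -> C -> C) : 'M[C]_n.+1 := \matrix_(l, m) dot (F l) (F m).

Let dot_gram (F : 'I_n.+1 -> C -> C) (x y : 'rV[C]_n.+1) : (forall l, L2 (F l)) ->
  dot (fun z => \sum_l x 0 l * F l z) (fun z => \sum_l y 0 l * F l z) =
  (x *m gram F *m y ^t*) 0 0.
Proof.
move=> LF; have LS : L2 (fun z => \sum_l y 0 l * F l z) by apply: L2_sum => l; exact: L2Z.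
rewrite dot_suml // -mulmxA mxE; apply: eq_bigr => l _; congr (_ * _).
rewrite dot_sumr // mxE; apply: eq_bigr => m _.
by rewrite !mxE mulrC.
Qed.

Let psd_gram F : (forall l, L2 (F l)) -> psdmx (gram F).
Proof.
move=> LF; split.
  by apply/matrixP => l m; rewrite !mxE /= -dotC.
by move=> x; rewrite -dot_gram // dotuu ler0c sqnorm_ge0.
Qed.

(** The Gram matrix of the dual functions is definite: they are biorthogonal to
    the monomials [1, .., z^n]. *)
Let gram_dual_definite (x : 'rV[C]_n.+1) :
  (x *m gram (fun l => hrem_dual l) *m x ^t*) 0 0 = 0 -> x = 0.
Proof.
rewrite -dot_gram; last by move=> l; exact: Ldual.
rewrite dotuu => /complexI; set v := fun z => _ => v0.
have Lv : L2 v by apply: L2_sum => l; exact: L2Z (Ldual l).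
have /(sqnorm_eq0 Lv) ev := v0; apply/rowP => k; rewrite mxE.
have LX : L2 (fun z : C => z ^+ k) by exact: (L2_Xz R k).
have : dot (fun z => z ^+ k) v = 0.
  rewrite (@dot_eqT _ _ _ (fun z => z ^+ k) (fun=> 0)) //; last first.
  - exact: eqT_refl.
  - exact: L2_cst.
  rewrite -[RHS]circle_mean0; apply: eq_circle_mean => t.
  by rewrite /= conjC0 mulr0.
rewrite (dot_sumr _ (fun l : 'I_n.+1 => Ldual l) LX).
rewrite (bigD1 k) //= -hremE hrem_Xn_small mxE !eqxx mulr1 big1 ?addr0 => [|l lk].
  by move/eqP; rewrite conjC_eq0 => /eqP.
by rewrite -hremE hrem_Xn_small mxE (negbTE lk) andbF mulr0.
Qed.

(** The modulus is sought in the form [B u = sum_lm u_l X_lm p_m], where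
    [u_l = <u, p_l>] are the coordinates of the remainder of [u]; then
    [<B u, B v> = <A u, A v>] reads [X P X = Q] for the Gram matrices [P], [Q]. *)
Lemma finite_rank_trace_class : trace_class A.
Proof.
split=> //; pose P := gram (fun l => hrem_dual l); pose Q := gram W.
have [X pX XPX] := psdmx_modulus (psd_gram (fun l => Ldual l)) gram_dual_definite (psd_gram LW).
have [XC X0] := pX.
pose B u : C -> C := fun z => \sum_m (hrem u *m X) 0 m * hrem_dual m z.
have hB u : hardy (B u) by apply: hardy_suml => m; exact: hdual.
have BB u v : hardy u -> hardy v -> dot (B u) (B v) = dot (A u) (A v).
  move=> hu hv; rewrite dot_gram; last by move=> l; exact: Ldual.
  have -> : dot (A u) (A v) = dot (FR u) (FR v).
    have [hA _ _] := bA; apply: dot_eqT; try exact: hardy_L2 (hFR _).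
    - by apply: hardy_L2; exact: hA.
    - by apply: hardy_L2; exact: hA.
    - exact: eA.
    - exact: eA.
  rewrite dot_gram // trmxC_mul XC -[X in _ = (_ *m X *m _) 0 0]XPX.
  by rewrite !mulmxA.
have dotB u : hardy u -> dot (B u) u = (hrem u *m X *m (hrem u) ^t*) 0 0.
  move=> hu; have Lu := hardy_L2 hu; rewrite (dot_suml _ (fun m : 'I_n.+1 => Ldual m) Lu).
  rewrite mxE; apply: eq_bigr => m _; congr (_ * _).
  by rewrite (dotC Lu (Ldual m)) [in RHS]mxE [in RHS]mxE hremE.
exists B.
  split=> //; last by move=> u hu; rewrite dotB.
  have [M M0 hM] := bounded_op_sqnorm bA; apply: (bounded_op_of_sqnorm M0) => //.
    move=> a u v hu hv; apply: eqT_of_eq => t; rewrite /B.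
    have -> : hrem (fun z => a * u z + v z) = a *: hrem u + hrem v.
      have Lu := hardy_L2 hu; have Lv := hardy_L2 hv.
      by rewrite hremD //; [rewrite hremZ|exact: L2Z].
    rewrite mulr_sumr -big_split /=; apply: eq_bigr => m _.
    by rewrite mulmxDl -scalemxAl !mxE; ring.
  by move=> u hu; rewrite sqnormE BB // -sqnormE; exact: hM.
pose r k := Re (dot (B (@monom R k)) (@monom R k)).
have hmon k : hardy (@monom R k) by exact: hardy_Xn.
have rE k : dot (B (@monom R k)) (@monom R k) = (r k)%:C.
  have := X0 (hrem (@monom R k)); rewrite -dotB // => d0.
  by apply: complex_ext => //; move: d0; rewrite lecE => /andP[/eqP].
have r0 k : 0 <= r k by rewrite -ler0c -rE dotB.
have rle k : r k <= \sum_m \sum_l (abs2 (X l m) * abs2 (fourier (hrem_dual l) k%:Z) +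
    abs2 (fourier (hrem_dual m) k%:Z)).
  rewrite /r dotB // mxE (big_morph _ (@cReD R) (erefl : Re 0 = 0)).
  apply: ler_sum => m _; rewrite mxE mulr_suml (big_morph _ (@cReD R) (erefl : Re 0 = 0)).
  apply: ler_sum => l _; apply: le_trans (ler_norm _) _.
  rewrite [(_ ^t*) _ _]mxE [_^T _ _]mxE.
  have [h _] := abs_mulJ_le (hrem (@monom R k) 0 l * X l m) (hrem (@monom R k) 0 m).
  apply: le_trans h _; rewrite abs2M mulrC.
  by rewrite ![hrem (@monom R k) 0 _](hrem_Xn k) !abs2J.
have cr : cvgn (series r).
  apply: nondecreasing_is_cvgn.
    by apply/nondecreasing_seqP => N; rewrite /series /= big_nat_recr //= lerDl.
  exists (\sum_m \sum_l (abs2 (X l m) * sqnorm (hrem_dual l) + sqnorm (hrem_dual m))).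
  move=> _ [N _ <-]; rewrite /series /= big_mkord.
  apply: le_trans (ler_sum _ (fun (k : 'I_N) _ => rle k)) _.
  rewrite exchange_big /=; apply: ler_sum => m _; rewrite exchange_big /=.
  apply: ler_sum => l _; rewrite big_split /= -mulr_sumr lerD //; last first.
    exact: sum_abs2_fourier_le.
  by rewrite ler_wpM2l ?abs2_ge0 // sum_abs2_fourier_le.
have := cvgC_real cr; set l := (limn (series r))%:C => h.
apply/cvg_ex; exists l; apply: (@eq_cvgC _ (fun N => (series r N)%:C)) => // N.
rewrite /series /= rmorph_sum /=; apply: eq_bigr => k _; by rewrite -rE.
Qed.

Definition finite_rank_mx : 'M[C]_n.+1 := \matrix_(l, m) hrem (W m) 0 l.

Let U_ N : 'M[C]_(N, n.+1) := \matrix_(i, l) fourier (W l) i%:Z.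
Let V_ N : 'M[C]_(n.+1, N) := \matrix_(l, j) hrem (@monom R j) 0 l.

Lemma finite_rank_corner N : corner A N = U_ N *m V_ N.
Proof.
apply/matrixP => i j; rewrite !mxE.
have hj : hardy (@monom R j) by exact: hardy_Xn.
have [hA _ _] := bA.
rewrite (@dot_eqT _ _ _ (FR (@monom R j)) (@monom R i)); first last.
- exact: eqT_refl.
- exact: eA.
- exact: hardy_L2 (hardy_Xn _ _).
- exact: hardy_L2.
- exact: hardy_L2 (hardy_Xn _ _).
- exact: hardy_L2 (hA _ hj).
rewrite dot_suml //; last exact: hardy_L2 (hardy_Xn _ _).
by apply: eq_bigr => l _; rewrite !mxE mulrC fourier_dot.
Qed.

Lemma finite_rank_mx_cvg l m : cvgC (fun N => (V_ N *m U_ N) l m) (finite_rank_mx l m).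
Proof.
rewrite [finite_rank_mx l m]mxE.
apply: (@eq_cvgC _ (fun N => \sum_(j < N) fourier (W m) j%:Z * hrem (fun z => z ^+ j) 0 l)) => [N|].
  by rewrite mxE; apply: eq_bigr => j _; rewrite !mxE mulrC.
exact: hrem_partial_sums (hW m).
Qed.

(** The sums of principal minors of [U V] and of [V U] agree, and [V U] has a fixed
    size. *)
Lemma finite_rank_trace_ext k :
  trace_ext A k = k`!%:R^-1 * minor_sum k finite_rank_mx.
Proof.
apply: cvgC_lim.
apply: (@eq_cvgC _ (fun N => k`!%:R^-1 * minor_sum k (V_ N *m U_ N))).
  by move=> N; rewrite -minor_sum_mulC -finite_rank_corner.
apply: cvgCM; first exact: cvgC_cst.
apply: cvgC_sum => s; apply: cvgC_det => i j.
rewrite [mxsub _ _ _ i j]mxE; apply: (@eq_cvgC _ (fun N => (V_ N *m U_ N) (s i) (s j))) => [N|].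
  by rewrite [RHS]mxE.
exact: finite_rank_mx_cvg.
Qed.

Lemma finite_rank_det_corner_cvg :
  cvgC (fun N => \det (1%:M + corner A N)) (\det (1%:M + finite_rank_mx)).
Proof.
apply: (@eq_cvgC _ (fun N => \det (1%:M + V_ N *m U_ N))).
  by move=> N; rewrite finite_rank_corner det1D_mulmxC.
apply: cvgC_det => i j; rewrite [(1%:M + finite_rank_mx) i j]mxE.
apply: (@eq_cvgC _ (fun N => (1%:M : 'M[C]_n.+1) i j + (V_ N *m U_ N) i j)) => [N|].
  by rewrite [RHS]mxE.
by apply: cvgCD; [exact: cvgC_cst|exact: finite_rank_mx_cvg].
Qed.

End Operator.

(** The exterior powers beyond the rank have trace 0, so that the series of the
    Fredholm determinant is the finite expansion of [det (1 + X)]. *)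
Lemma finite_rank_fredholm_det W O : (forall l, hardy (W l)) -> bounded_op O ->
  (forall u, hardy u -> eqT (sub_id O u) (fun z => \sum_l hrem u 0 l * W l z)) ->
  [/\ determinant_class O, fredholm_det O = \det (1%:M + finite_rank_mx W) &
      cvgC (fun N => \det (corner O N)) (\det (1%:M + finite_rank_mx W))].
Proof.
move=> hW bO eO; have bA := bounded_op_sub_id bO; split.
- exact: finite_rank_trace_class bA eO.
- apply: cvgC_lim; apply: (@cvgC_eventually _ _ _ n.+2) => N nN.
  rewrite /series /= big_mkord det1D_minor_sum.
  rewrite (eq_bigr _ (fun (k : 'I_N) _ => finite_rank_trace_ext hW bA eO k)).
  rewrite (big_ord_widen N (fun k => k`!%:R^-1 * minor_sum k (finite_rank_mx W)) nN).
  rewrite [RHS]big_mkcond; apply: eq_bigr => k _.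
  by case: ltnP => // kn; rewrite minor_sum_gt // mulr0.
apply: (@eq_cvgC _ (fun N => \det (1%:M + corner (sub_id O) N))) => [N|]; last exact: finite_rank_det_corner_cvg hW bA eO.
congr (\det _); apply/matrixP => i j; rewrite !mxE.
have hj : hardy (@monom R j) by exact: hardy_Xn.
have LX k : L2 (@monom R k) by exact: hardy_L2 (hardy_Xn _ _).
rewrite dotBl //; last by case: bO => hO _ _; exact: hardy_L2 (hO _ hj).
have -> : dot (@monom R j) (@monom R i) = (i == j)%:R.
  by rewrite [LHS](dot_Xz R j i) eqz_nat eq_sym.
by rewrite addrC subrK.
Qed.

End FiniteRank.

(** * Commutators of Toeplitz operators *)

Section MultiplierMatrix.
Context (R : realType) (n : nat) (q : {poly R[i]}).
Local Notation C := R[i].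
Hypotheses (q_monic : q \is monic) (size_q : size q = n.+2) (iq : inner_poly q).
Implicit Types (u v w m : C -> C) (t : R) (a b z : C).
Local Notation hrem := (hrem n q).

Lemma horner_rVpolyE (x : 'rV[C]_n.+1) z : (rVpoly x).[z] = \sum_l x 0 l * z ^+ l.
Proof. by rewrite horner_poly; apply: eq_bigr => l _; rewrite valK. Qed.

Lemma hrem_suml (I : finType) (c : I -> C) (F : I -> C -> C) :
  (forall i, L2 (F i)) -> hrem (fun z => \sum_i c i * F i z) = \sum_i c i *: hrem (F i).
Proof.
move=> LF; apply/rowP => j; rewrite summxE hremE dot_suml //; last exact: L2_hrem_dual size_q iq _.
by apply: eq_bigr => i _; rewrite mxE hremE.
Qed.

(** The matrix of multiplication by [m] modulo [q], acting on rows of coordinates. *)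
Definition mult_mx m : 'M[C]_n.+1 := \matrix_(l, j) hrem (fun z => m z * z ^+ l) 0 j.

Lemma row_mult_mx m l : row l (mult_mx m) = hrem (fun z => m z * z ^+ l).
Proof. by apply/rowP => j; rewrite !mxE. Qed.

Lemma hrem_rVpoly (x : 'rV[C]_n.+1) : hrem (fun z => (rVpoly x).[z]) = x.
Proof. by rewrite (hrem_poly q_monic size_q iq) ?size_poly // rVpolyK. Qed.

Lemma hrem_mult_rVpoly m (x : 'rV[C]_n.+1) : multiplier m ->
  hrem (fun z => m z * (rVpoly x).[z]) = x *m mult_mx m.
Proof.
move=> [_ hm]; rewrite mulmx_sum_row; under eq_bigr do rewrite row_mult_mx.
rewrite -hrem_suml; last by move=> l; exact: hardy_L2 (hm _ (hardy_Xn _ l)).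
apply: eq_hrem => t; rewrite horner_rVpolyE mulr_sumr.
by apply: eq_bigr => l _; rewrite mulrCA.
Qed.

(** [m u] and [m r] have the same remainder when [r] is that of [u], because
    their difference is [q] times the Hardy function [m (u - r) / q]. *)
Lemma hrem_mult m u : multiplier m -> hardy u ->
  hrem (fun z => m z * u z) = hrem u *m mult_mx m.
Proof.
move=> mm hu; have [cm hm] := mm; have hw := hm _ (hardy_quotient q_monic size_q iq hu).
rewrite -hrem_mult_rVpoly // -[RHS]addr0 -(hrem_root q_monic size_q iq hw) -hremD //.
- apply: eq_hrem => t; field; exact: inner_poly_neq0.
- exact: hardy_L2 (hm _ (hardy_horner _)).
- by have [_ /(_ _ hw)[]] := @multiplier_horner R q.
Qed.

Lemma eq_mult_mx m1 m2 : (forall t, m1 (cis t) = m2 (cis t)) -> mult_mx m1 = mult_mx m2.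
Proof.
move=> e; apply/row_matrixP => l; rewrite !row_mult_mx.
by apply: eq_hrem => t; rewrite e.
Qed.

Lemma mult_mxM m1 m2 : multiplier m1 -> multiplier m2 ->
  mult_mx (fun z => m1 z * m2 z) = mult_mx m2 *m mult_mx m1.
Proof.
move=> h1 h2; have [_ h2'] := h2; apply/row_matrixP => l.
rewrite row_mul !row_mult_mx -hrem_mult //; last exact: h2' (hardy_Xn _ l).
by apply: eq_hrem => t; rewrite mulrA.
Qed.

Lemma mult_mx_horner s : mult_mx (fun z => s.[z]) = horner_mx (comp_mx n q) s.
Proof.
apply/row_matrixP => l; rewrite row_mult_mx hrem_horner //; last exact: hardy_Xn.
by rewrite hrem_Xn_small // -rowE.
Qed.

Lemma mult_mx1 : mult_mx (fun=> 1) = 1%:M.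
Proof.
rewrite (@eq_mult_mx _ (fun z => (1%:P : {poly C}).[z])) => [|t]; last by rewrite hornerC.
by rewrite mult_mx_horner rmorph1.
Qed.

Lemma det_mult_mx_inv m mi : multiplier m -> multiplier mi ->
  (forall t, m (cis t) * mi (cis t) = 1) -> \det (mult_mx mi) = (\det (mult_mx m))^-1.
Proof.
move=> hm hmi e; have : \det (mult_mx m) * \det (mult_mx mi) = 1.
  rewrite mulrC -det_mulmx -mult_mxM // (@eq_mult_mx _ (fun=> 1)) //.
  by rewrite mult_mx1 det1.
move=> dd; have d0 : \det (mult_mx m) != 0.
  by apply/eqP => d0; move: dd; rewrite d0 mul0r => /eqP; rewrite eq_sym oner_eq0.
by apply: (mulfI d0); rewrite dd mulfV.
Qed.

(** Multiplication by a polynomial is that polynomial in the companion matrix,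
    whose eigenvalues are the roots of [q]. *)
Lemma det_mult_mx_frac (rs : seq C) (s1 s2 : {poly C}) : outer_poly s2 ->
  q = \prod_(a <- rs) ('X - a%:P) ->
  \det (mult_mx (fun z => s1.[z] / s2.[z])) = \prod_(a <- rs) (s1.[a] / s2.[a]).
Proof.
move=> os eq; have cq : char_poly (comp_mx n q) = \prod_(a <- rs) ('X - a%:P).
  by rewrite char_poly_comp_mx.
have ms := multiplier_horner_inv os.
rewrite (mult_mxM (multiplier_horner s1) ms) det_mulmx.
rewrite (det_mult_mx_inv (multiplier_horner s2) ms); last first.
  by move=> t; rewrite mulfV //; exact: outer_poly_neq0.
rewrite !mult_mx_horner !(det_horner_mx _ cq) mulrC -prodfV -big_split.
by [].
Qed.

End MultiplierMatrix.

Section Commutator.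
Context (R : realType).
Local Notation C := R[i].
Implicit Types (u v w : C -> C) (t : R) (z : C).

Lemma hardy_perpZ (c : C) u : hardy_perp u -> hardy_perp (fun z => c * u z).
Proof.
move=> [Lu pu]; split; first exact: L2Z.
by move=> v hv; rewrite dotZl ?pu ?mulr0 //; exact: hardy_L2.
Qed.

Lemma eq_hardy_perp u v : (forall t, u (cis t) = v (cis t)) ->
  hardy_perp u -> hardy_perp v.
Proof.
move=> e [Lu pu]; split; first exact: eq_L2 Lu.
by move=> w hw; rewrite -(pu w hw); apply: eq_dot.
Qed.

Lemma toeplitz_multiplier (m : C -> C) : multiplier m ->
  bounded_op (toeplitz m) /\ forall u, hardy u -> eqT (toeplitz m u) (fun z => m z * u z).
Proof.
move=> [cm hm]; have perp u : hardy_perp (fun z => m z * u z - m z * u z).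
  apply: (@eq_hardy_perp (fun z => 0)) => [t|]; first by rewrite subrr.
  split=> [|v hv]; first exact: L2_cst.
  rewrite -[RHS]circle_mean0; apply: eq_circle_mean => t.
  by rewrite mul0r.
split; first by apply: toeplitz_bounded => // u hu; exists (fun z => m z * u z); [exact: hm|].
by move=> u hu; apply: toeplitz_eq => //; exact: hm.
Qed.

Section Quotient.
Context (n : nat) (p q : {poly C}) (c : C) (phi : C -> C).
Hypotheses (q_monic : q \is monic) (size_q : size q = n.+2) (iq : inner_poly q).
Hypotheses (phiE : forall t, phi (cis t) = c * (p.[cis t] / q.[cis t])).

(** [T(c p / q) u]: removing the remainder [r] of [p u] removes from [p u / q] its
    principal part [r / q], which is orthogonal to the Hardy space. *)
Definition toeplitz_quot u : C -> C := fun z =>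
  c * ((p.[z] * u z - (rVpoly (hrem n q (fun z => p.[z] * u z))).[z]) / q.[z]).

Lemma continuous_symbol : continuous_circle phi.
Proof.
apply: eq_continuous_circle (continuous_circleM (continuous_circle_cst c) (continuous_frac p iq)) => t.
by rewrite phiE.
Qed.

Lemma hardy_toeplitz_quot u : hardy u -> hardy (toeplitz_quot u).
Proof.
move=> hu; apply: hardyZ; apply: (hardy_quotient q_monic size_q iq).
by have [_] := multiplier_horner p; apply.
Qed.

Lemma perp_toeplitz_quot u : hardy_perp (fun z => phi z * u z - toeplitz_quot u z).
Proof.
set r := rVpoly (hrem n q (fun z => p.[z] * u z)).
have sr : (size r < size q)%N by rewrite size_q ltnS size_poly.
apply: eq_hardy_perp (hardy_perpZ c (hardy_perp_frac iq sr)) => t.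
by rewrite phiE /toeplitz_quot; field; exact: inner_poly_neq0.
Qed.

Lemma toeplitz_frac :
  bounded_op (toeplitz phi) /\ forall u, hardy u -> eqT (toeplitz phi u) (toeplitz_quot u).
Proof.
split.
  apply: toeplitz_bounded => [|u hu]; first exact: continuous_symbol.
  by exists (toeplitz_quot u); [exact: hardy_toeplitz_quot|exact: perp_toeplitz_quot].
move=> u hu; apply: toeplitz_eq => //; [exact: continuous_symbol
  |exact: hardy_toeplitz_quot|exact: perp_toeplitz_quot].
Qed.

End Quotient.

Context (n : nat) (p q : {poly C}) (c : C) (phi psi : C -> C).
Hypotheses (p_monic : p \is monic) (size_p : size p = n.+2) (ip : inner_poly p).
Hypotheses (q_monic : q \is monic) (size_q : size q = n.+2) (iq : inner_poly q).
Hypotheses (c_neq0 : c != 0).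
Hypotheses (phiE : forall t, phi (cis t) = c * (p.[cis t] / q.[cis t]))
  (psiE : forall t, psi (cis t) = c^-1 * (q.[cis t] / p.[cis t])).

Let Tphi := toeplitz_frac q_monic size_q iq phiE.
Let Tpsi := toeplitz_frac p_monic size_p ip psiE.

(** Applying [T(p/q)] to [u] subtracts the principal part [r / q] from [p u / q];
    multiplication by [b q / p] turns it into [b r / p], whose projection is
    [(b r - r') / p] with [r'] the remainder of [b r] modulo [p]. *)
Lemma toeplitz_sandwich b u : multiplier b -> hardy u ->
  let r := rVpoly (hrem n q (fun z => p.[z] * u z)) in
  let r' := rVpoly (hrem n p (fun z => b z * r.[z])) in
  eqT (toeplitz psi (fun z => b z * toeplitz phi u z))
      (fun z => b z * u z - (b z * r.[z] - r'.[z]) / p.[z]).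
Proof.
move=> [cb hb] hu r r'; have [bphi Ephi] := Tphi; have [bpsi Epsi] := Tpsi.
have hT := bounded_op_hardy bphi hu.
have hQ := hardy_toeplitz_quot p c q_monic size_q iq hu.
apply: (@eqT_trans _ (toeplitz psi (fun z => b z * toeplitz_quot n p q c u z))).
  apply: (bounded_op_eqT bpsi); [exact: hb|exact: hb|].
  exact: (eqT_op1 (fun z x => b z * x) (Ephi u hu)).
apply: toeplitz_eq; [exact: continuous_symbol ip psiE|exact: hb| |].
  apply: hardyB; first exact: hb.
  exact: (hardy_quotient p_monic size_p ip (hb _ (hardy_horner r))).
have sr : (size (- r')%R < size p)%N by rewrite size_polyN size_p ltnS size_poly.
apply: eq_hardy_perp (hardy_perp_frac ip sr) => t; rewrite hornerN psiE /toeplitz_quot -/r.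
by field; rewrite c_neq0 !inner_poly_neq0.
Qed.

Lemma toeplitz_frac_inverse u : hardy u -> eqT (toeplitz psi (toeplitz phi u)) u.
Proof.
move=> hu; have [bphi _] := Tphi; have [bpsi _] := Tpsi.
have hT := bounded_op_hardy bphi hu.
have m1 := multiplier_cst (1 : C).
apply: eqT_trans; last apply: eqT_trans; last first.
- apply: eqT_of_eq => t; reflexivity.
- apply: eqT_trans (toeplitz_sandwich m1 hu) _; apply: eqT_of_eq => t.
  set r := rVpoly _; have -> : hrem n p (fun z => 1 * r.[z]) = hrem n q (fun z => p.[z] * u z).
    rewrite -[RHS](hrem_rVpoly p_monic size_p ip); apply: eq_hrem => t'.
    by rewrite mul1r.
  by rewrite !mul1r subrr mul0r subr0.
by apply: (bounded_op_eqT bpsi) => //; [apply: eq_hardy hT|apply: eqT_of_eq] => t;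
  rewrite mul1r.
Qed.

(** The operator [T(a) T(q/p) T(b) T(p/q) T(ab)^-1] is the identity plus an operator
    of finite rank factoring through [C[z] / q]. By Sylvester's identity its
    determinant is that of the map [r |-> b^-1 (b r mod p) mod q] on polynomials of
    degree at most [n], the composite of multiplication by [b] modulo [p] with that by
    [b^-1] modulo [q]. *)
Lemma toeplitz_commutator_det a ai b bi (O : (C -> C) -> (C -> C)) :
  multiplier a -> multiplier ai -> multiplier b -> multiplier bi ->
  (forall t, a (cis t) * ai (cis t) = 1) -> (forall t, b (cis t) * bi (cis t) = 1) ->
  bounded_op O ->
  (forall u, hardy u -> eqT (O u) (fun z => a z *
     toeplitz psi (fun z => b z * toeplitz phi (fun z => ai z * bi z * u z) z) z)) ->
  let d := \det (mult_mx n p b) / \det (mult_mx n q b) in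
  [/\ determinant_class O, fredholm_det O = d & cvgC (fun N => \det (corner O N)) d].
Proof.
move=> ma mai mb mbi aai bbi bO eO d.
have [_ ha] := ma; have [_ hb] := mb; have mabi := multiplierM mai mbi.
have mpab := multiplierM (multiplier_horner p) mabi.
pose D := mult_mx n q (fun z => p.[z] * (ai z * bi z)).
pose rl l := rVpoly (hrem n p (fun z => b z * z ^+ l)).
pose V (l : 'I_n.+1) : C -> C := fun z => - a z * ((b z * z ^+ l - (rl l).[z]) / p.[z]).
have hV l : hardy (V l).
  apply: eq_hardy (hardyZ (-1) (ha _ (hardy_quotient p_monic size_p ip (hb _ (hardy_Xn R l))))) => t.
  by rewrite mulN1r -mulNr.
have LV l := hardy_L2 (hV l).
pose W (m : 'I_n.+1) : C -> C := fun z => \sum_l D m l * V l z.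
have hW m : hardy (W m) by apply: hardy_suml.
have eW u : hardy u -> eqT (sub_id O u) (fun z => \sum_m hrem n q u 0 m * W m z).
  move=> hu; have hu' : hardy (fun z => ai z * bi z * u z) by have [_] := mabi; apply.
  have e1 := eqT_op1 (fun z x => a z * x - u z) (toeplitz_sandwich mb hu').
  have e2 := eqT_op1 (fun z x => x - u z) (eO u hu).
  apply: eqT_trans e2 _; apply: eqT_trans e1 _; apply: eqT_of_eq => t.
  set y := hrem n q (fun z => p.[z] * _).
  have yE : y = hrem n q u *m D.
    rewrite -(hrem_mult q_monic size_q iq mpab hu); apply: eq_hrem => t'.
    by rewrite !mulrA.
  have -> : hrem n p (fun z => b z * (rVpoly y).[z]) = y *m mult_mx n p b.
    exact: hrem_mult_rVpoly.
  transitivity (\sum_l y 0 l * V l (cis t)); last first.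
    rewrite yE; under eq_bigr do rewrite mxE mulr_suml.
    rewrite exchange_big /=; apply: eq_bigr => m _; rewrite /W mulr_sumr.
    by apply: eq_bigr => l _; rewrite mulrA.
  have -> : (rVpoly (y *m mult_mx n p b)).[cis t] = \sum_l y 0 l * (rl l).[cis t].
    rewrite horner_rVpolyE; under eq_bigr do rewrite mxE mulr_suml.
    rewrite exchange_big /=; apply: eq_bigr => l _.
    rewrite /rl horner_rVpolyE mulr_sumr; apply: eq_bigr => j _.
    by rewrite [mult_mx _ _ _ _ _]mxE mulrA.
  rewrite horner_rVpolyE mulr_sumr -sumrB mulr_suml.
  have -> : \sum_l y 0 l * V l (cis t) = - a (cis t) *
      \sum_i (b (cis t) * (y 0 i * cis t ^+ i) - y 0 i * (rl i).[cis t]) / p.[cis t].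
    rewrite mulr_sumr; apply: eq_bigr => l _; rewrite /V; ring.
  have eu : a (cis t) * (b (cis t) * (ai (cis t) * bi (cis t) * u (cis t))) = u (cis t).
    transitivity ((a (cis t) * ai (cis t)) * (b (cis t) * bi (cis t)) * u (cis t)).
      ring.
    by rewrite aai bbi !mul1r.
  by rewrite mulrBr eu addrAC subrr add0r mulNr.
have [dO fO cO] := finite_rank_fredholm_det q_monic size_q iq hW bO eW.
suff -> : d = \det (1%:M + finite_rank_mx q W) by split.
pose VV : 'M[C]_n.+1 := \matrix_(j, l) hrem n q (V j) 0 l.
have -> : finite_rank_mx q W = (D *m VV)^T.
  apply/matrixP => l m; rewrite mxE hrem_suml //; rewrite summxE [RHS]mxE [RHS]mxE.
  by apply: eq_bigr => j _; rewrite [LHS]mxE [VV j l]mxE.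
rewrite -[1%:M]trmx1 -linearD det_tr det1D_mulmxC.
have -> : VV *m D = - 1%:M + mult_mx n p b *m mult_mx n q bi.
  apply/row_matrixP => j; rewrite row_mul linearD linearN /= row_mul.
  have -> : row j VV = hrem n q (V j) by apply/rowP => l; rewrite !mxE.
  rewrite -(hrem_mult q_monic size_q iq mpab (hV j)) row_mult_mx.
  have -> : hrem n p (fun z => b z * z ^+ j) *m mult_mx n q bi =
      hrem n q (fun z => bi z * (rl j).[z]) by rewrite hrem_mult_rVpoly.
  have -> : row j 1%:M = hrem n q (fun z => z ^+ j).
    by rewrite hrem_Xn_small // row1.
  rewrite addrC -hremB //; first last.
  - exact: hardy_L2 (hardy_Xn _ _).
  - by have [_ /(_ _ (hardy_horner (rl j)))/hardy_L2] := mbi.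
  apply: eq_hrem => t; rewrite /V; set P := p.[cis t].
  have P0 : P != 0 by exact: inner_poly_neq0.
  transitivity (- (a (cis t) * ai (cis t)) * ((b (cis t) * bi (cis t)) * cis t ^+ j
                 - bi (cis t) * (rl j).[cis t])); last by rewrite aai bbi !mul1r; ring.
  by field.
by rewrite addrA subrr add0r det_mulmx (det_mult_mx_inv q_monic size_q iq mb mbi bbi).
Qed.

End Commutator.

(** * The complex exponential and the logarithmic series *)

Section Exponential.
Context (R : realType).
Local Notation C := R[i].
Local Notation Re := complex.Re.
Local Notation Im := complex.Im.
Local Notation "x %:C" := (real_complex_def (Phant R) x) : ring_scope.
Local Notation "x +i* y" := (Complex x y) : ring_scope.
Implicit Types (t : R) (a b z w : C) (g : R -> C).

Lemma cexpE z : cexp z = (expR (Re z) * cos (Im z)) +i* (expR (Re z) * sin (Im z)).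
Proof. by rewrite /cexp; apply: complex_ext; rewrite ?cReM ?cImM /= !mul0r ?subr0 ?addr0. Qed.

Lemma cexpD a b : cexp (a + b) = cexp a * cexp b.
Proof.
rewrite !cexpE cReD cImD expRD cosD sinD.
by apply: complex_ext; rewrite ?cReM ?cImM /=; ring.
Qed.

Lemma cexp0 : cexp 0 = 1 :> C.
Proof. by rewrite cexpE /= expR0 cos0 sin0 mulr1 mulr0. Qed.

Lemma cexp_neq0 z : cexp z != 0.
Proof.
apply/eqP => e; have := cexpD z (- z); rewrite subrr cexp0 e mul0r => /eqP.
by rewrite oner_eq0.
Qed.

Lemma cexpN z : cexp (- z) = (cexp z)^-1.
Proof.
by apply: (mulIf (cexp_neq0 z)); rewrite mulVf ?cexp_neq0 // -cexpD addNr cexp0.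
Qed.

Lemma abs2_cexp z : abs2 (cexp z) = expR (2 * Re z).
Proof.
rewrite cexpE /abs2 /= !exprMn -mulrDr cos2Dsin2 mulr1 mulr_natl mulr2n expRD expr2.
by [].
Qed.

Lemma cvgC_Re (u : nat -> C) a : cvgC u a -> (fun n => Re (u n)) @ \oo --> Re a.
Proof.
move=> /cvgCP /cvgrPdist_lt ua; apply/cvgrPdist_lt => e e0.
have /ua : 0 < e ^+ 2 by rewrite exprn_gt0.
apply: filterS => n; rewrite sub0r normrN ger0_norm ?abs2_ge0 // => h.
rewrite -(@ltr_pXn2r _ 2) ?nnegrE ?normr_ge0 ?(ltW e0) // real_normK ?num_real //.
apply: le_lt_trans h; rewrite /abs2 cReD cReN -sqrrN opprB.
by rewrite lerDl sqr_ge0.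
Qed.

Lemma cvgC_Im (u : nat -> C) a : cvgC u a -> (fun n => Im (u n)) @ \oo --> Im a.
Proof.
move=> ua; have := cvgC_Re (cvgCM (@cvgC_cst _ (0 +i* (-1))) ua).
have e z : Re ((0 +i* (-1)) * z) = Im z by rewrite cReM /=; ring.
by rewrite e; under eq_fun do rewrite e.
Qed.

Lemma cvgC_cexp (u : nat -> C) a : cvgC u a -> cvgC (fun n => cexp (u n)) (cexp a).
Proof.
move=> ua; have ru := cvgC_Re ua; have iu := cvgC_Im ua.
have eu : (fun n => expR (Re (u n))) @ \oo --> expR (Re a).
  by apply: continuous_cvg => //; exact: continuous_expR.
have cu : (fun n => cos (Im (u n))) @ \oo --> cos (Im a).
  by apply: continuous_cvg => //; exact: continuous_cos.
have su : (fun n => sin (Im (u n))) @ \oo --> sin (Im a).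
  by apply: continuous_cvg => //; exact: continuous_sin.
have rE z : Re (cexp z) = expR (Re z) * cos (Im z) by rewrite cexpE.
have iE z : Im (cexp z) = expR (Re z) * sin (Im z) by rewrite cexpE.
apply: cvgC_of_ReIm; rewrite ?rE ?iE.
  by rewrite (funext (fun n => rE (u n))); exact (cvgM eu cu).
by rewrite (funext (fun n => iE (u n))); exact (cvgM eu su).
Qed.

(** Componentwise, so that the derivatives of real functions apply. *)
Definition cderiv g t (d : C) : Prop :=
  is_derive t 1 (fun x => Re (g x)) (Re d) /\ is_derive t 1 (fun x => Im (g x)) (Im d).

Lemma cderiv_cst a t : cderiv (fun=> a) t 0.
Proof. by split; exact: is_derive_cst. Qed.

Lemma cderiv_eq g t d d' : cderiv g t d -> d = d' -> cderiv g t d'.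
Proof. by move=> h <-. Qed.

Lemma eq_cderiv g1 g2 t d : (forall x, g1 x = g2 x) -> cderiv g1 t d -> cderiv g2 t d.
Proof. by move=> /funext ->. Qed.

Lemma cderivD g1 g2 t d1 d2 : cderiv g1 t d1 -> cderiv g2 t d2 ->
  cderiv (fun x => g1 x + g2 x) t (d1 + d2).
Proof.
move=> [r1 i1] [r2 i2]; split.
  rewrite (_ : (fun x => _) = (fun x => Re (g1 x)) \+ (fun x => Re (g2 x))).
    by rewrite cReD; exact: is_deriveD.
  by apply/funext => x; rewrite cReD.
rewrite (_ : (fun x => _) = (fun x => Im (g1 x)) \+ (fun x => Im (g2 x))).
  by rewrite cImD; exact: is_deriveD.
by apply/funext => x; rewrite cImD.
Qed.

Lemma cderivM g1 g2 t d1 d2 : cderiv g1 t d1 -> cderiv g2 t d2 ->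
  cderiv (fun x => g1 x * g2 x) t (d1 * g2 t + g1 t * d2).
Proof.
move=> [r1 i1] [r2 i2]; split.
  rewrite (_ : (fun x => _) = (fun x => Re (g1 x) * Re (g2 x) - Im (g1 x) * Im (g2 x))).
    apply: is_derive_eq (is_deriveB (is_deriveM r1 r2) (is_deriveM i1 i2)) _.
    by rewrite /GRing.scale /= cReD !cReM; ring.
  by apply/funext => x; rewrite cReM.
rewrite (_ : (fun x => _) = (fun x => Re (g1 x) * Im (g2 x) + Im (g1 x) * Re (g2 x))).
  apply: is_derive_eq (is_deriveD (is_deriveM r1 i2) (is_deriveM i1 r2)) _.
  by rewrite /GRing.scale /= cImD !cImM; ring.
by apply/funext => x; rewrite cImM.
Qed.

Lemma cderiv_real (f : R -> R) t (d : R) : is_derive t 1 f d ->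
  cderiv (fun x => (f x)%:C) t d%:C.
Proof. by move=> fd; split; [exact: fd|exact: (is_derive_cst (0 : R))]. Qed.

Lemma cderiv_id t : cderiv (fun x => x%:C) t 1.
Proof. by apply: cderiv_real; exact: is_derive_id. Qed.

Lemma cderiv_sum (I : Type) (s : seq I) (F : I -> R -> C) t (d : I -> C) :
  (forall i, cderiv (F i) t (d i)) ->
  cderiv (fun x => \sum_(i <- s) F i x) t (\sum_(i <- s) d i).
Proof.
move=> Fd; elim: s => [|i s IH].
  rewrite big_nil; apply: (@eq_cderiv (fun=> 0)) => [x|]; last exact: cderiv_cst.
  by rewrite big_nil.
rewrite big_cons; apply: (@eq_cderiv (fun x => F i x + \sum_(j <- s) F j x)) => [x|].
  by rewrite big_cons.
exact: cderivD.
Qed.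

Lemma cderivX g t d n : cderiv g t d -> cderiv (fun x => g x ^+ n.+1) t (n.+1%:R * d * g t ^+ n).
Proof.
move=> gd; elim: n => [|n IH].
  by apply: cderiv_eq gd _; rewrite expr0 mulr1 mul1r.
apply: (@eq_cderiv (fun x => g x * g x ^+ n.+1)) => [x|]; first by rewrite [RHS]exprS.
apply: cderiv_eq (cderivM gd IH) _.
by rewrite -[n.+2]addn1 natrD !exprS; ring.
Qed.

Lemma cderiv_cexp g t d : cderiv g t d -> cderiv (fun x => cexp (g x)) t (cexp (g t) * d).
Proof.
move=> [r i].
have dE := @is_derive1_comp R expR _ t _ _ (is_derive_expR _) r.
have dC := @is_derive1_comp R (@cos R) _ t _ _ (is_derive_cos _) i.
have dS := @is_derive1_comp R (@sin R) _ t _ _ (is_derive_sin _) i.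
split.
  rewrite (_ : (fun x => _) = (expR \o (fun x => Re (g x))) * (cos \o (fun x => Im (g x)))).
    apply: is_derive_eq (is_deriveM dE dC) _.
    by rewrite cexpE cReM /GRing.scale /=; ring.
  by apply/funext => x; rewrite cexpE.
rewrite (_ : (fun x => _) = (expR \o (fun x => Re (g x))) * (sin \o (fun x => Im (g x)))).
  apply: is_derive_eq (is_deriveM dE dS) _.
  by rewrite cexpE cImM /GRing.scale /=; ring.
by apply/funext => x; rewrite cexpE.
Qed.

(** The factor 2 comes from bounding the two parts separately. *)
Lemma cderiv_mvt g (d : R -> C) (K : R) : (forall t, cderiv g t (d t)) ->
  (forall t, 0 <= t <= 1 -> abs2 (d t) <= K) -> abs2 (g 1 - g 0) <= 2 * K.
Proof.
move=> gd dK.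
have bound (F D : R -> R) : (forall t, is_derive t 1 F (D t)) ->
    (forall t, 0 <= t <= 1 -> D t ^+ 2 <= K) -> (F 1 - F 0) ^+ 2 <= K.
  move=> FD DK.
  have cF : {within `[0, 1], continuous F}.
    apply: continuous_subspaceT => t; apply: differentiable_continuous.
    by apply/derivable1_diffP; case: (FD t).
  have [c c01 ->] := MVT ltr01 (fun t _ => FD t) cF.
  rewrite subr0 mulr1; apply: DK; move: c01; rewrite in_itv /= => /andP[c0 c1].
  by rewrite !ltW.
rewrite /abs2 cReD cReN cImD cImN mulr_natl mulr2n; apply: lerD.
  apply: (bound _ _ (fun t => (gd t).1)) => t /dK.
  by apply: le_trans; rewrite lerDl sqr_ge0.
apply: (bound _ _ (fun t => (gd t).2)) => t /dK.
by apply: le_trans; rewrite lerDr sqr_ge0.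
Qed.

(** ** The series of [- log (1 - w)] *)

Definition log_sum (w : C) N : C := \sum_(k < N) w ^+ k.+1 / k.+1%:R.

Lemma abs_Re_expr_le w k : `|Re (w ^+ k)| <= Num.sqrt (abs2 w) ^+ k /\
  `|Im (w ^+ k)| <= Num.sqrt (abs2 w) ^+ k.
Proof.
have s0 : 0 <= Num.sqrt (abs2 w) ^+ k by rewrite exprn_ge0 // sqrtr_ge0.
have e : (Num.sqrt (abs2 w) ^+ k) ^+ 2 = abs2 (w ^+ k).
  by rewrite -exprM mulnC exprM sqr_sqrtr ?abs2_ge0 // abs2X.
by split; rewrite -(@ler_pXn2r _ 2) ?nnegrE ?normr_ge0 // real_normK ?num_real // e /abs2 ?lerDl ?lerDr ?sqr_ge0.
Qed.

Lemma Re_divn z (k : nat) : Re (z / k.+1%:R) = Re z / k.+1%:R /\ Im (z / k.+1%:R) = Im z / k.+1%:R.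
Proof.
have e : (k.+1%:R : C)^-1 = ((k.+1%:R : R)^-1)%:C by rewrite fmorphV rmorph_nat.
by rewrite e cReM cImM /= !mulr0 subr0 add0r.
Qed.

Lemma Re_sum (I : Type) (s : seq I) (F : I -> C) :
  Re (\sum_(i <- s) F i) = \sum_(i <- s) Re (F i).
Proof. by apply: (big_morph _ (@cReD R)). Qed.

Lemma Im_sum (I : Type) (s : seq I) (F : I -> C) :
  Im (\sum_(i <- s) F i) = \sum_(i <- s) Im (F i).
Proof. by apply: (big_morph _ (@cImD R)). Qed.

Let div_le (x y : R) k : `|x| <= y -> `|x / k.+1%:R| <= y.
Proof.
move=> xy; have y0 := le_trans (normr_ge0 x) xy.
rewrite normrM normfV (@ger0_norm _ k.+1%:R) // ler_pdivrMr ?ltr0n //.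
by apply: le_trans xy _; rewrite ler_peMr ?ler1n.
Qed.

Lemma log_sum_cvg w : abs2 w < 1 -> exists l, cvgC (log_sum w) l.
Proof.
move=> w1; set r := Num.sqrt (abs2 w).
have r1 : `|r| < 1 by rewrite ger0_norm ?sqrtr_ge0 // -sqrtr1 ltr_sqrt.
have cg : cvgn (series (fun k => r ^+ k.+1)).
  by have := is_cvg_geometric_series (a := r) r1; congr (cvgn (series _)); apply/funext => k; rewrite /geometric /= exprS.
have cs (x : nat -> R) : (forall k, `|x k| <= r ^+ k.+1) -> cvgn (series x).
  move=> xr; apply: normed_cvg; apply: (series_le_cvg _ _ xr cg) => k //.
  by rewrite exprn_ge0 // sqrtr_ge0.
have cR := cs (fun k => Re (w ^+ k.+1 / k.+1%:R)).
have cI := cs (fun k => Im (w ^+ k.+1 / k.+1%:R)).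
exists (limn (series (fun k => Re (w ^+ k.+1 / k.+1%:R))) +i* limn (series (fun k => Im (w ^+ k.+1 / k.+1%:R)))).
apply: cvgC_of_ReIm => /=.
  rewrite (_ : (fun n => _) = series (fun k => Re (w ^+ k.+1 / k.+1%:R))); last first.
    by apply/funext => N; rewrite /log_sum Re_sum /series /= big_mkord.
  apply: cR => k; have [-> _] := Re_divn (w ^+ k.+1) k.
  by apply: div_le; case: (abs_Re_expr_le w k.+1).
rewrite (_ : (fun n => _) = series (fun k => Im (w ^+ k.+1 / k.+1%:R))); last first.
  by apply/funext => N; rewrite /log_sum Im_sum /series /= big_mkord.
apply: cI => k; have [_ ->] := Re_divn (w ^+ k.+1) k.
by apply: div_le; case: (abs_Re_expr_le w k.+1).
Qed.

(** The derivative of [s |-> (1 - s w) exp (log_sum (s w) N)] telescopes to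
    [- w (s w)^N exp (log_sum (s w) N)], which tends to 0 uniformly on [0, 1]. *)
Lemma cexp_log_sum_cvg w : abs2 w < 1 ->
  cvgC (fun N => (1 - w) * cexp (log_sum w N)) 1.
Proof.
move=> w1; set r := Num.sqrt (abs2 w).
have r0 : 0 <= r by rewrite sqrtr_ge0.
have r1 : r < 1 by rewrite -sqrtr1 ltr_sqrt.
have rr : r ^+ 2 = abs2 w by rewrite sqr_sqrtr ?abs2_ge0.
pose G N (s : R) := (1 - s%:C * w) * cexp (log_sum (s%:C * w) N).
pose d N (s : R) := - w * (s%:C * w) ^+ N * cexp (log_sum (s%:C * w) N).
have dsw s : cderiv (fun x => x%:C * w) s w.
  by apply: cderiv_eq (cderivM (cderiv_id s) (cderiv_cst w s)) _; rewrite mul1r mulr0 addr0.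
have dls N s : cderiv (fun x => log_sum (x%:C * w) N) s (\sum_(k < N) w * (s%:C * w) ^+ k).
  apply: cderiv_sum => k.
  apply: cderiv_eq (cderivM (cderivX k (dsw s)) (cderiv_cst (k.+1%:R)^-1 s)) _.
  have : k.+1%:R != 0 :> C by rewrite pnatr_eq0.
  by rewrite mulr0 addr0; set K := k.+1%:R => K0; field.
have geom N s : (1 - s%:C * w) * (\sum_(k < N) w * (s%:C * w) ^+ k) = w - w * (s%:C * w) ^+ N.
  elim: N => [|N IH]; first by rewrite big_ord0 expr0; ring.
  by rewrite big_ord_recr /= mulrDr IH exprS; ring.
have dG N s : cderiv (G N) s (d N s).
  have h := cderivM (cderivD (cderiv_cst 1 s) (cderivM (cderiv_cst (-1) s) (dsw s))) (cderiv_cexp (dls N s)).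
  apply: (@eq_cderiv (fun x => (1 + -1 * (x%:C * w)) * cexp (log_sum (x%:C * w) N))) => [x|].
    by rewrite mulN1r.
  apply: cderiv_eq h _; rewrite /d.
  have := geom N s; set S := \sum_(k < N) _ => gS; rewrite mulN1r.
  transitivity (cexp (log_sum (s%:C * w) N) * (- w + (1 - s%:C * w) * S)); first by ring.
  by rewrite gS; ring.
have Rels N s : 0 <= s <= 1 -> Re (log_sum (s%:C * w) N) <= (1 - r)^-1.
  move=> /andP[s0 s1]; rewrite Re_sum.
  apply: (@le_trans _ _ (\sum_(k < N) r ^+ k)).
    apply: ler_sum => k _; have [-> _] := Re_divn ((s%:C * w) ^+ k.+1) k.
    apply: le_trans (ler_norm _) _; apply: div_le.
    have [h _] := abs_Re_expr_le (s%:C * w) k.+1; apply: le_trans h _.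
    have sr : Num.sqrt (abs2 (s%:C * w)) <= r.
      rewrite ler_sqrt ?abs2_ge0 // abs2M; apply: ler_piMl; first exact: abs2_ge0.
      by rewrite /abs2 /= expr0n addr0 exprn_ile1.
    apply: (@le_trans _ _ (r ^+ k.+1)); first by rewrite lerXn2r ?nnegrE ?sqrtr_ge0.
    by rewrite exprS ler_piMl ?exprn_ge0 // ltW.
  have -> : \sum_(k < N) r ^+ k = (1 - r ^+ N) / (1 - r).
    have e : (1 - r) * \sum_(k < N) r ^+ k = 1 - r ^+ N.
      elim: N => [|N IH]; first by rewrite big_ord0 expr0 mulr0 subrr.
      by rewrite big_ord_recr /= mulrDr IH exprS; ring.
    by rewrite -e mulrC mulKf // gt_eqF // subr_gt0.
  rewrite ler_piMl ?invr_ge0 ?subr_ge0 ?(ltW r1) // gerBl exprn_ge0 //.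
pose K := expR (2 * (1 - r)^-1).
have dK N s : 0 <= s <= 1 -> abs2 (d N s) <= abs2 w ^+ N * K.
  move=> s01; have /andP[s0 s1] := s01.
  rewrite /d abs2M abs2_cexp abs2M abs2X abs2M.
  have -> : abs2 (- w) = abs2 w by rewrite /abs2 cReN cImN !sqrrN.
  apply: ler_pM; rewrite ?mulr_ge0 ?exprn_ge0 ?mulr_ge0 ?abs2_ge0 ?expR_ge0 //.
    have h : abs2 s%:C * abs2 w <= abs2 w.
      apply: ler_piMl; first exact: abs2_ge0.
      by rewrite /abs2 /= expr0n addr0 exprn_ile1.
    apply: le_trans (_ : abs2 w * abs2 w ^+ N <= _).
      rewrite ler_wpM2l ?abs2_ge0 // lerXn2r ?nnegrE ?mulr_ge0 ?abs2_ge0 //.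
    by rewrite ler_piMl ?exprn_ge0 ?abs2_ge0 // ltW.
  by rewrite ler_expR ler_wpM2l // Rels.
have GN N : abs2 (G N 1 - 1) <= 2 * (abs2 w ^+ N * K).
  have := cderiv_mvt (dG N) (dK N).
  have -> // : G N 0 = 1.
  rewrite /G mul0r subr0 mul1r /log_sum big1 ?cexp0 // => k _.
  by rewrite expr0n mul0r.
apply/cvgCP.
have cv : (fun N => 2 * (abs2 w ^+ N * K)) @ \oo --> (2 * (0 * K) : R).
  apply: cvgMr; apply: cvgMl; apply: cvg_expr.
  by rewrite ger0_norm ?abs2_ge0.
rewrite mul0r mulr0 in cv; apply: (squeeze_cvgr _ (cvg_cst 0) cv); apply: nearW => N.
by rewrite abs2_ge0 /=; have := GN N; rewrite /G mul1r.
Qed.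

Lemma log_sum_limit w : abs2 w < 1 ->
  exists2 l, cvgC (log_sum w) l & cexp l = (1 - w)^-1.
Proof.
move=> w1; have [l cl] := log_sum_cvg w1; exists l => //.
have n0 : 1 - w != 0.
  rewrite subr_eq0; apply/eqP => e; move: w1; rewrite -e abs2_1 ltxx; by [].
have h1 := cexp_log_sum_cvg w1.
have h2 := cvgCM (@cvgC_cst _ (1 - w)) (cvgC_cexp cl).
apply: (mulfI n0); rewrite mulfV //.
by have := cvgC_lim h2; rewrite (cvgC_lim h1).
Qed.

End Exponential.

(** * Fourier coefficients of a logarithm *)

Section Logarithm.
Context (R : realType).
Local Notation C := R[i].
Local Notation mu := (@lebesgue_measure R).
Local Notation arc := (`[0, 2 * pi]%classic : set R).
Local Notation Re := complex.Re.
Local Notation Im := complex.Im.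
Local Notation "x %:C" := (real_complex_def (Phant R) x) : ring_scope.
Local Notation "x +i* y" := (Complex x y) : ring_scope.
Local Notation I := (Complex 0 1 : C).
Implicit Types (t : R) (a b z w : C) (h theta : C -> C).

Lemma cderivV (g : R -> C) t d : (forall x, g x != 0) -> cderiv g t d ->
  cderiv (fun x => (g x)^-1) t (- d / g t ^+ 2).
Proof.
move=> g0 [r i]; pose A x := Re (g x) * Re (g x) + Im (g x) * Im (g x).
have A0 x : A x != 0.
  by apply/eqP => e; move: (g0 x); rewrite (@abs2_eq0 _ (g x)) ?eqxx // /abs2 !expr2.
have dA := is_deriveD (is_deriveM r r) (is_deriveM i i).
have dV := @is_deriveV R A t _ 1 (A0 t) dA.
have Vabs z : z^-1 = (Re z * (Re z * Re z + Im z * Im z)^-1) +i* (- Im z * (Re z * Re z + Im z * Im z)^-1).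
  by case: z => x y; rewrite -!expr2 mulNr.
have gE x : g x ^+ 2 = (Re (g x) ^+ 2 - Im (g x) ^+ 2) +i* (2 * Re (g x) * Im (g x)).
  by apply: complex_ext; rewrite expr2 ?cReM ?cImM /=; ring.
have At := A0 t; rewrite /A in At.
have GG : (Re (g t) ^+ 2 - Im (g t) ^+ 2) * (Re (g t) ^+ 2 - Im (g t) ^+ 2) + 2 * Re (g t) * Im (g t) * (2 * Re (g t) * Im (g t)) = A t ^+ 2.
  by rewrite /A; ring.
have keyR (x y a b : R) : x * x + y * y != 0 ->
    x * (- (x * x + y * y) ^- 2 * (x * a + x * a + (y * b + y * b))) + (x * x + y * y)^-1 * a =
    - a * ((x ^+ 2 - y ^+ 2) / (x * x + y * y) ^+ 2) -
    (- b) * (- (2 * x * y) / (x * x + y * y) ^+ 2) by move=> n0; field.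
have keyI (x y a b : R) : x * x + y * y != 0 ->
    - y * (- (x * x + y * y) ^- 2 * (x * a + x * a + (y * b + y * b))) + (x * x + y * y)^-1 * (- b) =
    - a * (- (2 * x * y) / (x * x + y * y) ^+ 2) +
    (- b) * ((x ^+ 2 - y ^+ 2) / (x * x + y * y) ^+ 2) by move=> n0; field.
split.
  rewrite (_ : (fun x => _) = (fun x => Re (g x) * (A x)^-1)); last first.
    by apply/funext => x; rewrite Vabs.
  apply: is_derive_eq (is_deriveM r dV) _.
  rewrite Vabs /= gE /= cReM cReN cImN /= GG /GRing.scale /=.
  exact: keyR.
rewrite (_ : (fun x => _) = (fun x => - Im (g x) * (A x)^-1)); last first.
  by apply/funext => x; rewrite Vabs.
apply: is_derive_eq (is_deriveM (is_deriveN i) dV) _.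
rewrite Vabs /= gE /= cImM cReN cImN /= GG /GRing.scale /=.
exact: keyI.
Qed.

(** Near [t] the difference [l x - l t] is the principal logarithm of
    [H x / H t], whose real and imaginary parts are [ln |.|] and the arctangent of
    the slope. *)
Lemma cderiv_log (l H : R -> C) t d : (forall x, cexp (l x) = H x) ->
  {for t, continuous (fun x => Im (l x))} ->
  cderiv H t (d * H t) -> cderiv l t d.
Proof.
move=> lH cl dH; have H0 x : H x != 0 by rewrite -lH cexp_neq0.
pose m x := l x - l t; pose rho x := H x * (H t)^-1.
have rhoE x : rho x = cexp (m x) by rewrite /rho /m -!lH cexpD cexpN.
have rhot : rho t = 1 by rewrite /rho mulfV.
have drho : cderiv rho t d.
  by apply: cderiv_eq (cderivM dH (cderiv_cst (H t)^-1 t)) _; rewrite mulr0 addr0 mulfK.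
have [dr di] := drho.
have Rt : Re (rho t) = 1 by rewrite rhot.
have It : Im (rho t) = 0 by rewrite rhot.
suff [mr mi] : cderiv m t d.
  split.
    rewrite (_ : (fun x => _) = (fun x => Re (m x) + Re (l t))).
      apply: is_derive_eq (is_deriveD mr (is_derive_cst (Re (l t)) t 1)) _.
      by rewrite addr0.
    by apply/funext => x; rewrite /m cReD cReN subrK.
  rewrite (_ : (fun x => _) = (fun x => Im (m x) + Im (l t))).
    apply: is_derive_eq (is_deriveD mi (is_derive_cst (Im (l t)) t 1)) _.
    by rewrite addr0.
  by apply/funext => x; rewrite /m cImD cImN subrK.
split.
  pose A x := Re (rho x) * Re (rho x) + Im (rho x) * Im (rho x).
  have dA := is_deriveD (is_deriveM dr dr) (is_deriveM di di).
  have At : A t = 1 by rewrite /A Rt It; ring.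
  have dln : is_derive (A t) 1 (@ln R) (A t)^-1 by apply: is_derive1_ln; rewrite At.
  have dlnA := @is_derive1_comp R (@ln R) A t _ _ dln dA.
  rewrite (_ : (fun x => _) = (fun x => 2^-1 * (@ln R \o A) x)).
    apply: is_derive_eq (@is_deriveZ R R R _ 2^-1 _ _ _ dlnA) _.
    have key (x y : R) : 2^-1 * (1^-1 * (1 * x + 1 * x + (0 * y + 0 * y))) = x by field.
    by rewrite At Rt It /GRing.scale /=; exact: key.
  apply/funext => x; have -> : Re (m x) = 2^-1 * ln (expR (2 * Re (m x))).
    by rewrite expRK; field.
  by rewrite -abs2_cexp -rhoE /abs2 !expr2.
have dV := @is_deriveV R (fun x => Re (rho x)) t _ 1 _ dr.
have {}dV := dV (_ : Re (rho t) != 0); rewrite Rt oner_eq0 in dV; have {}dV := dV isT.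
have dq := is_deriveM di dV.
have dat := @is_derive1_comp R atan _ t _ _ (is_derive1_atan _) dq.
have pi2 : 0 < pi / 2 :> R by rewrite divr_gt0 // pi_gt0.
apply: (@near_eq_is_derive R R R (atan \o (fun x => Im (rho x) * (Re (rho x))^-1))); last first.
  apply: is_derive_eq dat _.
  rewrite /GRing.scale /= Rt It.
  have -> : ((fun x => Im (rho x)) * (fun y => (Re (rho y))^-1)) t = 0.
    by rewrite -[LHS]/(Im (rho t) * (Re (rho t))^-1) It mul0r.
  have key (x y : R) : (1 + 0 ^+ 2)^-1 * (0 * (- 1 ^- 2 * x) + 1^-1 * y) = y by field.
  exact: key.
have cm : {for t, continuous (fun x => Im (m x))}.
  rewrite (_ : (fun x => _) = (fun x => Im (l x) + (- Im (l t)))).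
    exact (cvgD cl (cvg_cst _)).
  by apply/funext => x; rewrite /m cImD cImN.
have /cvgrPdist_lt /(_ _ pi2) := cm.
have -> : Im (m t) = 0 by rewrite /m subrr.
apply: filterS => x; rewrite sub0r normrN ltr_norml => mx; rewrite /=.
have -> : Im (rho x) * (Re (rho x))^-1 = tan (Im (m x)).
  rewrite rhoE cexpE /= /tan invfM mulrACA mulfV ?mul1r //.
  by rewrite gt_eqF // expR_gt0.
by rewrite tanK // in_itv /=.
Qed.

(** [theta] is the logarithmic derivative [z h'(z) / h(z)] along the circle. *)
Definition log_derivative h theta : Prop :=
  continuous_circle theta /\ forall t, h (cis t) != 0 /\
    cderiv (fun x => h (cis x)) t (I * theta (cis t) * h (cis t)).

Lemma cderiv_cis t : cderiv (fun x => cis x) t (I * cis t).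
Proof.
split; first by rewrite cReM /= mul0r sub0r mul1r; exact: is_derive_cos.
by rewrite cImM /= mul0r add0r mul1r; exact: is_derive_sin.
Qed.

Lemma eq_log_derivative h h' theta theta' : (forall t, h (cis t) = h' (cis t)) ->
  (forall t, theta (cis t) = theta' (cis t)) ->
  log_derivative h theta -> log_derivative h' theta'.
Proof.
move=> eh et [ct dt]; split; first exact: eq_continuous_circle ct.
move=> t; have [n0 d0] := dt t; split; first by rewrite -eh.
by rewrite -et -eh; apply: eq_cderiv d0 => x.
Qed.

Lemma log_derivative_cst (c : C) : c != 0 -> log_derivative (fun=> c) (fun=> 0).
Proof.
move=> c0; split; first exact: continuous_circle_cst.
by move=> t; split=> //; apply: cderiv_eq (cderiv_cst c t) _; rewrite mulr0 mul0r.
Qed.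

Lemma log_derivativeM h1 h2 th1 th2 : log_derivative h1 th1 -> log_derivative h2 th2 ->
  log_derivative (fun z => h1 z * h2 z) (fun z => th1 z + th2 z).
Proof.
move=> [c1 d1] [c2 d2]; split; first exact: continuous_circleD.
move=> t; have [n1 e1] := d1 t; have [n2 e2] := d2 t; split; first by rewrite mulf_neq0.
by apply: cderiv_eq (cderivM e1 e2) _; ring.
Qed.

Lemma log_derivativeV h th : log_derivative h th ->
  log_derivative (fun z => (h z)^-1) (fun z => - th z).
Proof.
move=> [c d]; split.
  by apply: eq_continuous_circle (continuous_circleM (continuous_circle_cst (-1)) c) => t;
    rewrite mulN1r.
move=> t; have [n e] := d t; split; first by rewrite invr_neq0.
have nz x : h (cis x) != 0 by case: (d x).
by apply: cderiv_eq (cderivV nz e) _; field.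
Qed.

Lemma log_derivative_factor a : (forall t, cis t - a != 0) ->
  log_derivative (fun z => z - a) (fun z => z / (z - a)).
Proof.
move=> n0; split.
  apply: continuous_circleM; first exact: continuous_circle_id.
  apply: continuous_circleV => //; apply: continuous_circleD; first exact: continuous_circle_id.
  exact: continuous_circle_cst.
move=> t; split=> //.
apply: cderiv_eq (cderivD (cderiv_cis t) (cderiv_cst (- a) t)) _.
by rewrite addr0 -mulrA divfK.
Qed.

Lemma log_derivative_prod (zs : seq C) : (forall a t, a \in zs -> cis t - a != 0) ->
  log_derivative (fun z => \prod_(a <- zs) (z - a)) (fun z => \sum_(a <- zs) z / (z - a)).
Proof.
elim: zs => [|a zs IH] n0.
  apply: (@eq_log_derivative (fun=> 1) _ (fun=> 0)) => [t|t|]; rewrite ?big_nil //.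
  exact: log_derivative_cst (oner_neq0 _).
apply: (@eq_log_derivative (fun z => (z - a) * \prod_(b <- zs) (z - b)) _
   (fun z => z / (z - a) + \sum_(b <- zs) z / (z - b))) => [t|t|]; rewrite ?big_cons //.
apply: log_derivativeM; first by apply: log_derivative_factor => t; apply: n0; rewrite mem_head.
by apply: IH => b t bz; apply: n0; rewrite inE bz orbT.
Qed.

(** Integration by parts of [z^(-k) L], [L] being single-valued on the circle. *)
Lemma fourier_log h theta L (k : int) : log_derivative h theta ->
  continuous_circle L -> (forall t, cexp (L (cis t)) = h (cis t)) ->
  k%:~R * fourier L k = fourier theta k.
Proof.
move=> [ct dh] cL hL; pose c : R := (- k)%:~R.
have dL t : cderiv (fun x => L (cis x)) t (I * theta (cis t)).
  by apply: (cderiv_log hL); [exact: cL.2|case: (dh t)].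
have dk t : cderiv (fun x => cis x ^ (- k)) t (I * (c%:C * cis t ^ (- k))).
  split.
    rewrite (_ : (fun x => _) = (fun x => cos (c * x))).
      apply: is_derive_eq (is_derive_cos_scale c t) _.
      by rewrite cisX !cReM cImM /=; ring.
    by apply/funext => x; rewrite cisX.
  rewrite (_ : (fun x => _) = (fun x => sin (c * x))).
    apply: is_derive_eq (is_derive_sin_scale c t) _.
    by rewrite cisX cImM cReM cImM /=; ring.
  by apply/funext => x; rewrite cisX.
pose D z := c%:C * (z ^ (- k) * L z) + z ^ (- k) * theta z.
have cz := continuous_circleXz R (- k).
have ckL := continuous_circleM cz cL; have ckt := continuous_circleM cz ct.
have cD : continuous_circle (fun z => I * D z).
  apply: continuous_circleM; first exact: continuous_circle_cst.
  apply: continuous_circleD => //; apply: continuous_circleM => //.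
  exact: continuous_circle_cst.
have dD t : cderiv (fun x => cis x ^ (- k) * L (cis x)) t (I * D (cis t)).
  by apply: cderiv_eq (cderivM (dk t) (dL t)) _; rewrite /D; ring.
have per : cis (2 * pi) = cis 0 :> C by rewrite cis_2pi /cis cos0 sin0.
have mD : circle_mean (fun z => I * D z) = 0.
  apply: complex_ext; rewrite /circle_mean /=.
    by rewrite (Rintegral_arc_FTC (fun t => (dD t).1) cD.1) per subrr mulr0.
  by rewrite (Rintegral_arc_FTC (fun t => (dD t).2) cD.2) per subrr mulr0.
have iL := integrable_L2 (L2_continuous ckL); have it := integrable_L2 (L2_continuous ckt).
have iD : integrable_circle D.
  by apply: integrable_circleD => //; exact: integrable_circleZ.
move: mD; rewrite circle_meanZ // => /eqP; rewrite mulf_eq0 => /orP[/eqP/(congr1 (@complex.Im R))/eqP|].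
  by rewrite /= oner_eq0.
rewrite /D circle_meanD //; last exact: integrable_circleZ.
rewrite circle_meanZ // => /eqP e.
have ck : c%:C = - k%:~R by rewrite /c rmorph_int mulrNz.
by move: e; rewrite ck mulNr addrC => /eqP; rewrite subr_eq0 => /eqP.
Qed.

(** ** The logarithmic derivative of a rational function *)

(** The coefficients [w_j] satisfy [w_j = [j = 0] + b w_(j-1)]. *)
Lemma fourier_geometric b (k : int) : abs2 b < 1 ->
  fourier (fun z => (1 - b * z)^-1) k = if 0 <= k then b ^ k else 0.
Proof.
move=> b1; pose u z := (1 - b * z)^-1.
have hu : hardy u.
  by apply: eq_hardy (hardy_geometric b1 (hardy_cst 1)) => t; rewrite mulr1.
have Lu := hardy_L2 hu; have [_ u0] := hu.
have nz t : 1 - b * cis t != 0.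
  rewrite subr_eq0; apply/eqP => /(congr1 (@abs2 R)).
  by rewrite abs2M cis_abs2 abs2_1 mulr1 => e; rewrite -e ltxx in b1.
have step (j : int) : fourier u j = (j == 0)%:R + b * fourier u (j - 1).
  have Lz : L2 (fun z => b * (z ^ 1 * u z)) by apply: L2Z; exact: L2_Xz_mul.
  rewrite -[fourier u (j - 1)]fourierXz -fourierZ; last exact: L2_Xz_mul.
  rewrite -[(j == 0)%:R]mul1r -fourier_cst -fourierD //; last exact: L2_cst.
  by apply: eq_fourier => t; rewrite /u expr1z; field.
rewrite -/u; case: k => k; last by rewrite /= u0.
rewrite /=; elim: k => [|k IH].
  by rewrite step u0 // mulr0 addr0 expr0z.
have e : k.+1%:Z - 1 = k%:Z by rewrite -addn1 PoszD addrK.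
by rewrite step e IH add0r -!exprnP exprS.
Qed.

(** The conjugate of [z / (z - a)] on the circle is [1 / (1 - a^* z)]. *)
Lemma fourier_inner_factor a (k : nat) : abs2 a < 1 ->
  fourier (fun z => z / (z - a)) k.+1%:Z = 0 /\
  fourier (fun z => z / (z - a)) (- k.+1%:Z) = a ^+ k.+1.
Proof.
move=> a1; have a1' : abs2 a^* < 1 by rewrite abs2J.
have nz t : cis t - a != 0.
  rewrite subr_eq0; apply/eqP => /(congr1 (@abs2 R)) e.
  by move: a1; rewrite -e cis_abs2 ltxx.
have conjF (j : int) : fourier (fun z => z / (z - a)) j =
    (fourier (fun z => (1 - a^* * z)^-1) (- j))^*.
  rewrite /fourier -circle_meanJ; last first.
    apply: integrable_L2; apply: L2_Xz_mul.
    apply: eq_L2 (hardy_L2 (hardy_geometric a1' (hardy_cst 1))) => t.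
    by rewrite mulr1.
  apply: eq_circle_mean => t; rewrite [RHS]rmorphM /= rmorphXz ?unitfE ?cis_neq0 //=.
  rewrite cis_conj exprz_inv opprK; congr (_ * _).
  rewrite fmorphV rmorphB rmorph1 rmorphM /= conjCK cis_conj.
  have c0 := cis_neq0 t; have n0 := nz t.
  have e : 1 - a / cis t = (cis t - a) / cis t by field.
  by rewrite e; field; rewrite n0 c0.
rewrite !conjF !fourier_geometric // opprK; split; first by rewrite conjC0.
by rewrite /= -exprnP rmorphXn /= conjCK.
Qed.

(** Here [z / (z - b) = - (z / b) / (1 - z / b)]. *)
Lemma fourier_outer_factor b (k : nat) : 1 < abs2 b ->
  fourier (fun z => z / (z - b)) k.+1%:Z = - b^-1 ^+ k.+1 /\
  fourier (fun z => z / (z - b)) (- k.+1%:Z) = 0.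
Proof.
move=> b1; have b0 : b != 0.
  by apply: contraTneq b1 => ->; rewrite /abs2 /= !expr0n addr0 ltr10.
have b1' : abs2 b^-1 < 1 by rewrite abs2V invf_lt1 // (lt_trans _ b1).
have nz t : cis t - b != 0.
  rewrite subr_eq0; apply/eqP => /(congr1 (@abs2 R)) e.
  by move: b1; rewrite -e cis_abs2 ltxx.
have Lg : L2 (fun z => (1 - b^-1 * z)^-1).
  apply: eq_L2 (hardy_L2 (hardy_geometric b1' (hardy_cst 1))) => t.
  by rewrite mulr1.
have E (j : int) : fourier (fun z => z / (z - b)) j =
    - b^-1 * fourier (fun z => (1 - b^-1 * z)^-1) (j - 1).
  rewrite -[fourier _ (j - 1)]fourierXz -fourierZ; last exact: L2_Xz_mul.
  apply: eq_fourier => t; rewrite expr1z; have n0 := nz t.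
  have -> : 1 - b^-1 * cis t = - (cis t - b) / b by field.
  by field; rewrite n0 b0.
rewrite !E !fourier_geometric //; split; last first.
  by rewrite -opprD /= mulr0.
have -> : k.+1%:Z - 1 = k%:Z by rewrite -addn1 PoszD addrK.
by rewrite /= -exprnP exprS mulNr.
Qed.

End Logarithm.

(** * Branches of the logarithm near the circle *)

Section LogBranch.
Context (R : realType).
Local Notation C := R[i].
Local Notation Re := complex.Re.
Local Notation Im := complex.Im.
Local Notation "x %:C" := (real_complex_def (Phant R) x) : ring_scope.
Local Notation "x +i* y" := (Complex x y) : ring_scope.
Implicit Types (t : R) (a b z w : C) (h L : C -> C).

Lemma abs_ReIm_lt z (e : R) : 0 < e -> `|z| < e%:C -> `|Re z| < e /\ `|Im z| < e.
Proof.
move=> e0; rewrite normC_ltE // /abs2 => h; split;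
  rewrite -(@ltr_pXn2r _ 2) ?nnegrE ?normr_ge0 ?(ltW e0) // real_normK ?num_real //;
  apply: le_lt_trans h; by rewrite ?lerDl ?lerDr sqr_ge0.
Qed.

Lemma Re_continuous (a : R[i]^o) : (fun z : R[i]^o => Re z) @ a --> Re a.
Proof.
have FF := nbhs_filter a; apply/(@cvgrPdist_lt _ _ _ (nbhs a) FF) => e e0.
have eC0 : 0 < e%:C by rewrite ltcR.
have h : (fun z : R[i]^o => z) @ a --> a by exact: cvg_id.
have /(@cvgrPdist_lt _ _ _ (nbhs a) FF) /(_ _ eC0) H := h.
by apply: (@filterS _ _ (nbhs_filter a) _ _ _ H) => z /(abs_ReIm_lt e0) []; rewrite cReD cReN.
Qed.

Lemma Im_continuous (a : R[i]^o) : (fun z : R[i]^o => Im z) @ a --> Im a.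
Proof.
have FF := nbhs_filter a; apply/(@cvgrPdist_lt _ _ _ (nbhs a) FF) => e e0.
have eC0 : 0 < e%:C by rewrite ltcR.
have h : (fun z : R[i]^o => z) @ a --> a by exact: cvg_id.
have /(@cvgrPdist_lt _ _ _ (nbhs a) FF) /(_ _ eC0) H := h.
by apply: (@filterS _ _ (nbhs_filter a) _ _ _ H) => z /(abs_ReIm_lt e0) [] _; rewrite cImD cImN.
Qed.

Lemma cvg_complex (T : Type) (F : set_system T) {FF : Filter F} (f : T -> C) (a : C) :
  (fun x => Re (f x)) @ F --> Re a -> (fun x => Im (f x)) @ F --> Im a ->
  (f : T -> R[i]^o) @ F --> (a : R[i]^o).
Proof.
move=> rf imf; apply/(@cvgrPdist_lt _ R[i]^o) => e e0.
have [e' e'0 ->] : exists2 e' : R, 0 < e' & e = e'%:C.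
  exists (Re e); first by move: e0; rewrite ltcE => /andP[].
  by apply: complex_ext => //=; apply/eqP; move: e0; rewrite ltcE eq_sym => /andP[].
have e2 : 0 < e' / 2 by rewrite divr_gt0.
have /cvgrPdist_lt /(_ _ e2) hr := rf; have /cvgrPdist_lt /(_ _ e2) hi := imf.
apply: filterS2 hr hi => x hr hi; rewrite normC_ltE // /abs2 cReD cReN cImD cImN.
have sq (y : R) : `|y| < e' / 2 -> y ^+ 2 < e' ^+ 2 / 4.
  move=> ye; rewrite -real_normK ?num_real //.
  have -> : e' ^+ 2 / 4 = (e' / 2) ^+ 2 by field.
  by rewrite ltr_pXn2r ?nnegrE ?normr_ge0 // ltW.
have := sq _ hr; have := sq _ hi; have : 0 < e' ^+ 2 by rewrite exprn_gt0.
lra.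
Qed.

(** The principal logarithm of the right half plane. *)
Definition Log z : C := (2^-1 * ln (abs2 z)) +i* atan (Im z / Re z).

Lemma cexp_Log z : 0 < Re z -> cexp (Log z) = z.
Proof.
move=> x0; have xn0 : Re z != 0 by rewrite gt_eqF.
set s := Im z / Re z; have z2 : abs2 z = Re z ^+ 2 * (1 + s ^+ 2).
  by rewrite /abs2 /s; field.
have s0 : 0 < 1 + s ^+ 2 by rewrite ltr_pwDl // sqr_ge0.
have a0 : 0 < abs2 z by rewrite z2 mulr_gt0 // exprn_gt0.
have sq0 : Num.sqrt (1 + s ^+ 2) != 0 by rewrite gt_eqF // sqrtr_gt0.
have E : expR (2^-1 * ln (abs2 z)) = Re z * Num.sqrt (1 + s ^+ 2).
  apply: (@pexpIrn _ 2) => //; rewrite ?nnegrE ?expR_ge0 //.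
    by rewrite mulr_ge0 ?sqrtr_ge0 // ltW.
  rewrite exprMn sqr_sqrtr ?(ltW s0) // -z2 -expRM_natl -[RHS]lnK ?posrE //.
  by congr expR; field.
have cs : cos (atan s) = (Num.sqrt (1 + s ^+ 2))^-1 by rewrite cos_atan.
have tn : sin (atan s) = s * cos (atan s).
  have c0 : cos (atan s) != 0 by rewrite cs invr_neq0.
  have e : tan (atan s) * cos (atan s) = s * cos (atan s) by rewrite atanK.
  by rewrite -e /tan -mulrA mulVf // mulr1.
rewrite cexpE /= E tn cs; apply: complex_ext => /=; first by rewrite mulfK.
by move: sq0; set Q := Num.sqrt _ => Q0; rewrite /s; field; rewrite Q0.
Qed.

Lemma Log_continuous (T : Type) (F : set_system T) {FF : Filter F} (f : T -> C) (a : C) :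
  0 < Re a -> (f : T -> R[i]^o) @ F --> (a : R[i]^o) ->
  ((fun x => Log (f x)) : T -> R[i]^o) @ F --> (Log a : R[i]^o).
Proof.
move=> a0 fa; have rf : (fun x => Re (f x)) @ F --> Re a by exact: cvg_comp fa (@Re_continuous a).
have imf : (fun x => Im (f x)) @ F --> Im a by exact: cvg_comp fa (@Im_continuous a).
have an0 : Re a != 0 by rewrite gt_eqF.
have ab0 : 0 < abs2 a by rewrite ltr_pwDl ?sqr_ge0 // exprn_gt0.
apply: cvg_complex => /=.
  have ab : (fun x => abs2 (f x)) @ F --> abs2 a.
    exact (cvgD (cvgM rf rf) (cvgM imf imf)).
  have ln' : (fun x => ln (abs2 (f x))) @ F --> ln (abs2 a).
    by apply: continuous_cvg ab; exact: continuous_ln.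
  exact (cvgM (cvg_cst _) ln').
apply: continuous_cvg; first exact: continuous_atan.
exact (cvgM imf (cvgV an0 rf)).
Qed.

Lemma norm1_abs2 z : `|z| = 1 <-> abs2 z = 1.
Proof.
split=> [z1|z1].
  by apply: complexI; rewrite -normC_abs2 z1 expr1n rmorph1.
apply/eqP; rewrite -(@eqrXn2 _ 2) // ?normr_ge0 // normC_abs2 z1 expr1n.
by rewrite rmorph1.
Qed.

Lemma log_branchM h1 h2 L1 L2 : log_branch h1 L1 -> log_branch h2 L2 ->
  log_branch (fun z => h1 z * h2 z) (fun z => L1 z + L2 z).
Proof.
move=> [U1 [ o1 c1 l1 e1]] [U2 [ o2 c2 l2 e2]]; exists (U1 `&` U2); split.
- exact: openI.
- by move=> z z1; split; [exact: c1|exact: c2].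
- move=> z; rewrite inE => -[u1 u2].
  have k1 := l1 z (mem_set u1); have k2 := l2 z (mem_set u2).
  exact (@cvgD R[i] R[i]^o _ _ _ _ _ _ _ k1 k2).
by move=> z [u1 u2]; rewrite cexpD e1 // e2.
Qed.

Lemma log_branchV h L : log_branch h L -> log_branch (fun z => (h z)^-1) (fun z => - L z).
Proof.
move=> [U [ o c l e]]; exists U; split; [exact: o|exact: c| |by move=> z Uz; rewrite cexpN e].
move=> z Uz; have k := l z Uz.
exact (@cvgN R[i] R[i]^o _ _ _ _ _ k).
Qed.

Lemma eq_log_branch h h' L (U : set R[i]^o) : open U -> (forall z : C, `|z| = 1 -> U z) ->
  (forall z, U z -> h z = h' z) -> log_branch h L -> log_branch h' L.
Proof.
move=> oU cU e [V [ oV cV l eV]]; exists (U `&` V); split.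
- exact: openI.
- by move=> z z1; split; [exact: cU|exact: cV].
- by move=> z; rewrite inE => -[_ Vz]; apply: l; rewrite inE.
by move=> z [Uz Vz]; rewrite eV // e.
Qed.

Lemma cexp_surj (c : C) : c != 0 -> exists l, cexp l = c.
Proof.
move=> c0; have rot : cexp ((0 : R) +i* (pi / 2)) = (0 : R) +i* 1.
  by rewrite cexpE /= expR0 cos_pihalf sin_pihalf !mul1r.
have pos (d : C) : 0 < Re d -> exists l, cexp l = d by move=> d0; exists (Log d); exact: cexp_Log.
(* Rotating by quarter turns brings [c] into the right half plane. *)
have turn (d : C) : (exists l, cexp l = ((0 : R) +i* 1) * d) -> exists l, cexp l = d.
  move=> [l el]; exists (l - ((0 : R) +i* (pi / 2))); rewrite cexpD cexpN rot el mulrAC mulfV ?mul1r //.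
  by apply/eqP => /(congr1 (@complex.Im R))/eqP; rewrite /= oner_eq0.
have ReI (d : C) : Re (((0 : R) +i* 1) * d) = - Im d by rewrite cReM /=; ring.
have ImI (d : C) : Im (((0 : R) +i* 1) * d) = Re d by rewrite cImM /=; ring.
case: (ltrgtP 0 (Re c)) => rc; first exact: pos.
- apply: (@turn _); apply: (@turn _); apply: pos; rewrite ReI ImI oppr_gt0.
  exact: rc.
case: (ltrgtP 0 (Im c)) => ic.
- by apply: (@turn _); apply: (@turn _); apply: (@turn _); apply: pos; rewrite ReI ImI ReI opprK.
- by apply: (@turn _); apply: pos; rewrite ReI oppr_gt0.
by case/eqP: c0; apply: complex_ext; rewrite -?rc -?ic.
Qed.

Lemma log_branch_cst (c : C) : c != 0 -> exists L, log_branch (fun=> c) L.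
Proof.
move=> /cexp_surj [l el]; exists (fun=> l), setT; split=> //; first exact: openT.
move=> z _; exact (@cvg_cst R[i]^o l R[i]^o _ (nbhs_filter z)).
Qed.

Lemma open_abs2_lt (c : R) : open [set z : R[i]^o | abs2 z < c] /\
  open [set z : R[i]^o | c < abs2 z].
Proof.
have ca : continuous (fun z : R[i]^o => abs2 z).
  move=> z; exact (cvgD (cvgM (@Re_continuous z) (@Re_continuous z))
                        (cvgM (@Im_continuous z) (@Im_continuous z))).
by split; [apply: (open_comp (D := [set x | x < c]))|apply: (open_comp (D := [set x | c < x]))] => //.
Qed.

Lemma Re_1B_gt0 w : abs2 w < 1 -> 0 < Re (1 - w).
Proof.
rewrite cReD cReN subr_gt0 /= => w1; rewrite ltNge; apply/negP => h.
move: w1; rewrite ltNge => /negP; apply; rewrite /abs2.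
have h2 := sqr_ge0 (Im w); nra.
Qed.

(** Where [|z| > |a|] the factor stays in the right half plane. *)
Lemma log_branch_inner a : abs2 a < 1 -> exists L, log_branch (fun z => 1 - a / z) L.
Proof.
move=> a1; exists (fun z => Log (1 - a / z)), [set z | abs2 a < abs2 z].
have Uz z : abs2 a < abs2 z -> z != 0 /\ 0 < Re (1 - a / z).
  move=> az; have z0 : 0 < abs2 z by apply: le_lt_trans az; exact: abs2_ge0.
  split; first by apply: contraTneq z0 => ->; rewrite /abs2 /= !expr0n addr0 ltxx.
  by apply: Re_1B_gt0; rewrite abs2M abs2V ltr_pdivrMr // mul1r.
split.
- by case: (open_abs2_lt (abs2 a)).
- by move=> z /norm1_abs2 /= ->.
- move=> z; rewrite inE => /Uz [z0 r0]; apply: (@Log_continuous _ _ (nbhs_filter (z : R[i]^o))) => //.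
  have ci : (fun x : R[i]^o => x^-1 : R[i]^o) @ z --> (z^-1 : R[i]^o).
    exact (@cvgV R[i] _ _ _ _ _ z0 (@cvg_id _ (nbhs (z : R[i]^o)))).
  exact (@cvgB R[i] R[i]^o _ _ _ _ _ _ _ (@cvg_cst _ (1 : R[i]^o) _ _ _)
     (@cvgM R[i] _ _ _ _ _ _ _ (@cvg_cst _ (a : R[i]^o) _ _ _) ci)).
by move=> z /Uz [_ r0]; exact: cexp_Log.
Qed.

Lemma log_branch_outer b : 1 < abs2 b -> exists L, log_branch (fun z => 1 - z / b) L.
Proof.
move=> b1; exists (fun z => Log (1 - z / b)), [set z | abs2 z < abs2 b].
have Uz z : abs2 z < abs2 b -> 0 < Re (1 - z / b).
  move=> zb; apply: Re_1B_gt0; rewrite abs2M abs2V ltr_pdivrMr ?mul1r //.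
  exact: lt_trans b1.
split.
- by case: (open_abs2_lt (abs2 b)).
- by move=> z /norm1_abs2 /= ->.
- move=> z; rewrite inE => /Uz r0; apply: (@Log_continuous _ _ (nbhs_filter (z : R[i]^o))) => //.
  exact (@cvgB R[i] R[i]^o _ _ _ _ _ _ _ (@cvg_cst _ (1 : R[i]^o) _ _ _)
     (@cvgM R[i] _ _ _ _ _ _ _ (@cvg_id _ (nbhs (z : R[i]^o))) (@cvg_cst _ (b^-1 : R[i]^o) _ _ _))).
by move=> z /Uz r0; exact: cexp_Log.
Qed.

Lemma log_branch_prod (zs : seq C) (F : C -> C -> C) :
  (forall a, a \in zs -> exists L, log_branch (F a) L) ->
  exists L, log_branch (fun z => \prod_(a <- zs) F a z) L.
Proof.
elim: zs => [|a zs IH] ex.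
  have [L bL] := log_branch_cst (oner_neq0 C); exists L.
  by apply: (eq_log_branch openT _ _ bL) => // z _; rewrite big_nil.
have [L1 b1] := ex a (mem_head _ _).
have [L2 b2] : exists L, log_branch (fun z => \prod_(a <- zs) F a z) L.
  by apply: IH => b bz; apply: ex; rewrite inE bz orbT.
exists (fun z => L1 z + L2 z); apply: (eq_log_branch openT _ _ (log_branchM b1 b2)) => // z _.
by rewrite big_cons.
Qed.

Lemma log_branch_circle h L : log_branch h L ->
  continuous_circle L /\ forall t, cexp (L (cis t)) = h (cis t).
Proof.
move=> [U [ oU cU cL e]]; have Ut t : U (cis t) by apply: cU; apply/norm1_abs2; exact: cis_abs2.
split; last by move=> t; exact: e.
have cl t : ((fun x => L (cis x)) : R -> R[i]^o) @ t --> (L (cis t) : R[i]^o).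
  have cc : (fun x : R => cis x : R[i]^o) @ t --> (cis t : R[i]^o).
    by apply: cvg_complex; [exact: continuous_cos|exact: continuous_sin].
  have cz := cL _ (mem_set (Ut t)); exact (cvg_comp _ _ cc cz).
split=> t; first exact (cvg_comp _ _ (cl t) (@Re_continuous _)).
exact (cvg_comp _ _ (cl t) (@Im_continuous _)).
Qed.

(** ** The exponential of the sum over the Fourier coefficients *)

Definition pair_sum (F : C -> C) (X Y : seq C) : C := \sum_(x <- X) \sum_(y <- Y) F (x / y).

Lemma pair_log_sum_limit (X Y : seq C) : {in X, forall x, abs2 x < 1} ->
  {in Y, forall y, 1 < abs2 y} ->
  exists2 l, cvgC (fun N => pair_sum (fun w => log_sum w N) X Y) l &
    cexp l = (\prod_(x <- X) \prod_(y <- Y) (1 - x / y))^-1.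
Proof.
move=> hX hY; elim: X hX => [|x X IH] hX.
  exists 0; last by rewrite cexp0 big_nil invr1.
  by apply: (@eq_cvgC _ (fun=> 0)) => [N|]; [rewrite /pair_sum big_nil|exact: cvgC_cst].
have [l cl el] : exists2 l, cvgC (fun N => \sum_(y <- Y) log_sum (x / y) N) l &
    cexp l = (\prod_(y <- Y) (1 - x / y))^-1.
  have x1 : abs2 x < 1 by apply: hX; rewrite mem_head.
  elim: Y hY {IH} => [|y Y IH] hY.
    exists 0; last by rewrite cexp0 big_nil invr1.
    by apply: (@eq_cvgC _ (fun=> 0)) => [N|]; [rewrite big_nil|exact: cvgC_cst].
  have [l2 c2 e2] := IH (fun z zY => hY z (mem_behead (s := y :: Y) zY)).
  have y1 : 1 < abs2 y by apply: hY; rewrite mem_head.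
  have xy : abs2 (x / y) < 1.
    rewrite abs2M abs2V ltr_pdivrMr ?mul1r; first exact: lt_trans y1.
    exact: lt_trans y1.
  have [l1 c1 e1] := log_sum_limit xy; exists (l1 + l2).
    apply: (@eq_cvgC _ (fun N => log_sum (x / y) N + \sum_(y <- Y) log_sum (x / y) N)) => [N|].
      by rewrite big_cons.
    exact: cvgCD.
  by rewrite cexpD e1 e2 big_cons invfM.
have [l2 c2 e2] := IH (fun z zX => hX z (mem_behead (s := x :: X) zX)).
exists (l + l2).
  apply: (@eq_cvgC _ (fun N => \sum_(y <- Y) log_sum (x / y) N + pair_sum (fun w => log_sum w N) X Y)) => [N|].
    by rewrite /pair_sum big_cons.
  exact: cvgCD.
by rewrite cexpD el e2 big_cons invfM.
Qed.

(** The zeros and poles of the symbol: [A] and [B] inside the disk, [Z] and [W]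
    outside the closed disk. *)
Context (h : C -> C) (c : C) (A B Z W : seq C).
Hypotheses (c0 : c != 0)
  (hA : {in A, forall a, abs2 a < 1}) (hB : {in B, forall a, abs2 a < 1})
  (hZ : {in Z, forall a, 1 < abs2 a}) (hW : {in W, forall a, 1 < abs2 a})
  (hE : forall t, h (cis t) =
     c * (\prod_(a <- A) (cis t - a) / \prod_(b <- B) (cis t - b) *
          (\prod_(a <- Z) (cis t - a) / \prod_(b <- W) (cis t - b)))).

Let T (s : seq C) z : C := \sum_(a <- s) z / (z - a).

Let inner_neq0 a t : abs2 a < 1 -> cis t - a != 0.
Proof.
move=> a1; rewrite subr_eq0; apply/eqP => /(congr1 (@abs2 R)) e.
by rewrite -e cis_abs2 ltxx in a1.
Qed.

Let outer_neq0 a t : 1 < abs2 a -> cis t - a != 0.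
Proof.
move=> a1; rewrite subr_eq0; apply/eqP => /(congr1 (@abs2 R)) e.
by rewrite -e cis_abs2 ltxx in a1.
Qed.

Lemma symbol_log_derivative :
  log_derivative h (fun z => 0 + (T A z - T B z + (T Z z - T W z))).
Proof.
have lA := log_derivative_prod (fun a t aA => inner_neq0 t (hA aA)).
have lB := log_derivative_prod (fun a t aA => inner_neq0 t (hB aA)).
have lZ := log_derivative_prod (fun a t aA => outer_neq0 t (hZ aA)).
have lW := log_derivative_prod (fun a t aA => outer_neq0 t (hW aA)).
apply: (eq_log_derivative _ _ (log_derivativeM (log_derivative_cst c0)
  (log_derivativeM (log_derivativeM lA (log_derivativeV lB))
                   (log_derivativeM lZ (log_derivativeV lW))))) => t //.
Qed.

Let fourier_T (s : seq C) (k : int) : (forall a t, a \in s -> cis t - a != 0) ->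
  L2 (T s) /\ fourier (T s) k = \sum_(a <- s) fourier (fun z => z / (z - a)) k.
Proof.
elim: s => [|a s IH] n0.
  split; first by apply: eq_L2 (@L2_cst R 0) => t; rewrite /T big_nil.
  rewrite big_nil -[RHS](mul0r ((k == 0)%:R)) -fourier_cst.
  by apply: eq_fourier => t; rewrite /T big_nil.
have [L1 e1] := IH (fun b t bs => n0 b t (mem_behead (s := a :: s) bs)).
have La : L2 (fun z => z / (z - a)).
  apply: L2_continuous; have [] // := @log_derivative_factor R a _.
  by move=> t; apply: n0; rewrite mem_head.
split; first by apply: eq_L2 (L2D La L1) => t; rewrite /T big_cons.
by rewrite big_cons -e1 -fourierD //; apply: eq_fourier => t; rewrite /T big_cons.
Qed.

Lemma fourier_symbol_log_derivative (k : nat) :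
  fourier (fun z => 0 + (T A z - T B z + (T Z z - T W z))) k.+1%:Z =
    \sum_(b <- W) b^-1 ^+ k.+1 - \sum_(b <- Z) b^-1 ^+ k.+1 /\
  fourier (fun z => 0 + (T A z - T B z + (T Z z - T W z))) (- k.+1%:Z) =
    \sum_(a <- A) a ^+ k.+1 - \sum_(a <- B) a ^+ k.+1.
Proof.
have nA a t aA := inner_neq0 t (hA (x := a) aA).
have nB a t aA := inner_neq0 t (hB (x := a) aA).
have nZ a t aA := outer_neq0 t (hZ (x := a) aA).
have nW a t aA := outer_neq0 t (hW (x := a) aA).
have split j : fourier (fun z => 0 + (T A z - T B z + (T Z z - T W z))) j =
    fourier (T A) j - fourier (T B) j + (fourier (T Z) j - fourier (T W) j).
  have [LA _] := fourier_T j nA; have [LB _] := fourier_T j nB.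
  have [LZ _] := fourier_T j nZ; have [LW _] := fourier_T j nW.
  rewrite -fourierB // -fourierB // -fourierD; [|exact: L2B..].
  by apply: eq_fourier => t; rewrite add0r.
have big_eq (s : seq C) (F G : C -> C) : {in s, F =1 G} ->
    \sum_(a <- s) F a = \sum_(a <- s) G a.
  by move=> FG; apply: eq_big_seq.
have bigN (s : seq C) (F : C -> C) : \sum_(a <- s) - F a = - \sum_(a <- s) F a.
  by rewrite sumrN.
have big0 (s : seq C) : \sum_(a <- s) (0 : C) = 0 by rewrite big1.
rewrite !split; split.
  rewrite (fourier_T _ nA).2 (fourier_T _ nB).2 (fourier_T _ nZ).2 (fourier_T _ nW).2.
  rewrite (big_eq A _ (fun=> 0)) => [|a /hA /(fourier_inner_factor k) [] //].
  rewrite (big_eq B _ (fun=> 0)) => [|a /hB /(fourier_inner_factor k) [] //].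
  rewrite (big_eq Z _ (fun b => - b^-1 ^+ k.+1)) => [|a /hZ /(fourier_outer_factor k) [] //].
  rewrite (big_eq W _ (fun b => - b^-1 ^+ k.+1)) => [|a /hW /(fourier_outer_factor k) [] //].
  by rewrite !bigN !big0; ring.
rewrite (fourier_T _ nA).2 (fourier_T _ nB).2 (fourier_T _ nZ).2 (fourier_T _ nW).2.
rewrite (big_eq A _ (fun a => a ^+ k.+1)) => [|a /hA /(fourier_inner_factor k) [] //].
rewrite (big_eq B _ (fun a => a ^+ k.+1)) => [|a /hB /(fourier_inner_factor k) [] //].
rewrite (big_eq Z _ (fun=> 0)) => [|a /hZ /(fourier_outer_factor k) [] //].
rewrite (big_eq W _ (fun=> 0)) => [|a /hW /(fourier_outer_factor k) [] //].
by rewrite !big0; ring.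
Qed.

(** Every product of a power sum over [A] or [B] by one over [Z] or [W] expands
    into the logarithmic series of the quotients. *)
Lemma szego_sum_limit L : log_branch h L ->
  exists2 l, cvgC (series (fun n : nat =>
      n.+1%:R * fourier L n.+1%:Z * fourier L (- n.+1%:Z))) l &
    cexp l = \prod_(a <- A) (\prod_(b <- W) (1 - a / b) / \prod_(b <- Z) (1 - a / b)) /
             \prod_(a <- B) (\prod_(b <- W) (1 - a / b) / \prod_(b <- Z) (1 - a / b)).
Proof.
move=> /log_branch_circle [cL eL].
have fl k := fourier_log k symbol_log_derivative cL eL.
have [lAW cAW eAW] := pair_log_sum_limit hA hW.
have [lAZ cAZ eAZ] := pair_log_sum_limit hA hZ.
have [lBW cBW eBW] := pair_log_sum_limit hB hW.
have [lBZ cBZ eBZ] := pair_log_sum_limit hB hZ.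
exists ((-1) * lAW + lAZ + (lBW + (-1) * lBZ)); last first.
  rewrite !cexpD !mulN1r !cexpN eAW eAZ eBW eBZ !invrK.
  rewrite !big_split /= !prodfV.
  by rewrite [in RHS]invfM invrK mulrACA; ring.
have PS X Y N : pair_sum (fun w => log_sum w N) X Y =
    \sum_(k < N) (\sum_(x <- X) x ^+ k.+1) * (\sum_(y <- Y) y^-1 ^+ k.+1) / k.+1%:R.
  rewrite /pair_sum /log_sum exchange_big /=.
  rewrite (eq_bigr (fun y => \sum_(k < N) \sum_(x <- X) (x / y) ^+ k.+1 / k.+1%:R)); last first.
    by move=> y _; rewrite exchange_big.
  rewrite exchange_big /=; apply: eq_bigr => k _.
  rewrite mulr_sumr mulr_suml; apply: eq_bigr => y _.
  rewrite -mulr_suml; congr (_ / _); rewrite mulr_suml.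
  by apply: eq_bigr => x _; rewrite exprMn.
apply: (@eq_cvgC _ (fun N => (-1) * pair_sum (fun w => log_sum w N) A W +
     pair_sum (fun w => log_sum w N) A Z + (pair_sum (fun w => log_sum w N) B W +
     (-1) * pair_sum (fun w => log_sum w N) B Z))) => [N|]; last first.
  have cN := @cvgC_cst R (-1).
  exact (cvgCD (cvgCD (cvgCM cN cAW) cAZ) (cvgCD cBW (cvgCM cN cBZ))).
rewrite !PS !mulr_sumr -!big_split /series /= big_mkord; apply: eq_bigr => k _.
have k0 : k.+1%:R != 0 :> C by rewrite pnatr_eq0.
have [f1 f2] := fourier_symbol_log_derivative k.
have := fl k.+1%:Z; rewrite f1; have := fl (- k.+1%:Z); rewrite f2.
set x := fourier L _; set y := fourier L _.
have -> : (- k.+1%:Z)%:~R = - (k.+1%:R) :> C by rewrite mulrNz.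
have -> : k.+1%:Z%:~R = k.+1%:R :> C by [].
move: k0; set K := k.+1%:R => K0.
set sA := \sum_(a <- A) _; set sB := \sum_(a <- B) _.
set sZ := \sum_(a <- Z) _; set sW := \sum_(a <- W) _ => ex ey.
transitivity (- (- K * x) * (K * y) / K); last by field.
by rewrite ex ey; field.
Qed.

End LogBranch.

(** * Rational functions in lowest terms and the resultant *)

Section RationalFunctions.
Context (R : realType).
Local Notation C := R[i].
Local Notation "p %:F" := (FracField.tofrac p) : ring_scope.
Implicit Types (f g : {fraction {poly C}}) (p q : {poly C}) (z : C) (A B : seq C).

Lemma fraction_repr f : f = (frac (repr f)).1%:F / (frac (repr f)).2%:F.
Proof.
have d0 := denom_ratioP (repr f).
apply: (canRL (mulfK _)); first by rewrite tofrac_eq0.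
unlock FracField.tofrac; rewrite -[X in X * _]reprK -[LHS]FracField.pi_mul.
apply/eqmodP; rewrite /= FracField.equivfE /FracField.mulf !numden_Ratio ?mulf_neq0 ?oner_neq0 //.
by rewrite !mulr1 mulrC.
Qed.

Lemma rden_neq0 f : rden f != 0.
Proof.
rewrite /rden; have := denom_ratioP (repr f); case: (frac (repr f)) => p q /= q0.
have gn : gcdp p q != 0 by rewrite gcdp_eq0 (negbTE q0) andbF.
by rewrite dvdp_div_eq0 // dvdp_gcdr.
Qed.

Lemma coprimep_rnum_rden f : coprimep (rnum f) (rden f).
Proof.
rewrite /rnum /rden; have := denom_ratioP (repr f); case: (frac (repr f)) => p q /= q0.
by rewrite coprimep_div_gcd // q0 orbT.
Qed.

Lemma rnum_rdenE f : f = (rnum f)%:F / (rden f)%:F.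
Proof.
rewrite [LHS]fraction_repr /rnum /rden; have := denom_ratioP (repr f).
case: (frac (repr f)) => p q /= q0; set d := gcdp p q.
have dn : d != 0 by rewrite gcdp_eq0 (negbTE q0) andbF.
have ep : p = p %/ d * d by rewrite divpK // dvdp_gcdl.
have eq : q = q %/ d * d by rewrite divpK // dvdp_gcdr.
rewrite {1}ep {1}eq !tofracM invfM mulrACA mulfV ?mulr1 //.
by rewrite tofrac_eq0.
Qed.

Lemma rnum_neq0 f : f != 0 -> rnum f != 0.
Proof. by apply: contra_neq => e; rewrite [f]rnum_rdenE e rmorph0 mul0r. Qed.

(** Lowest terms guarantee that no value is lost to a common root. *)
Lemma symbol_frac f p q z : f = p%:F / q%:F -> q.[z] != 0 ->
  symbol f z = p.[z] / q.[z].
Proof.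
move=> ef qz; have q0 : q != 0 by apply: contraNneq qz => ->; rewrite horner0.
have e : rnum f * q = p * rden f.
  apply/eqP; rewrite -tofrac_eq !tofracM -eqr_div ?tofrac_eq0 ?rden_neq0 //.
  by rewrite -rnum_rdenE -ef.
have ez : (rnum f).[z] * q.[z] = p.[z] * (rden f).[z] by rewrite -!hornerM e.
have dz : (rden f).[z] != 0.
  apply/negP => /eqP dz; move/eqP: ez; rewrite dz mulr0 mulf_eq0 (negbTE qz) orbF => nz.
  by have := coprimep_root (coprimep_rnum_rden f) nz; rewrite dz eqxx.
by apply/eqP; rewrite /symbol /rval eqr_div // ez.
Qed.

Lemma symbol_div f g z : (rden f).[z] != 0 -> (rnum g).[z] != 0 ->
  symbol (f / g) z = symbol f z / symbol g z.
Proof.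
move=> fz gz.
have e : f / g = (rnum f * rden g)%:F / (rden f * rnum g)%:F.
  by rewrite {1}[f]rnum_rdenE {1}[g]rnum_rdenE !tofracM invf_div mulf_div.
rewrite (symbol_frac e) ?hornerM ?mulf_neq0 // /symbol /rval.
by rewrite -mulf_div invf_div.
Qed.

Lemma mup_prod_XsubC (c : C) A z : c != 0 ->
  mup z (c *: \prod_(a <- A) ('X - a%:P)) = count_mem z A.
Proof.
move=> c0; rewrite -mul_polyC mupMr ?rootC //.
elim: A => [|a A IH]; first by rewrite big_nil mupNroot // rootC oner_neq0.
rewrite big_cons mupM ?polyXsubC_eq0 ?monic_neq0 ?monic_prod_XsubC // IH /=.
by rewrite -['X - _]expr1 mup_XsubCX; case: eqP.
Qed.

Lemma prod_count (U A : seq C) (F : C -> C) : uniq U -> {subset A <= U} ->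
  \prod_(z <- U) F z ^+ count_mem z A = \prod_(z <- A) F z.
Proof.
move=> uU; elim: A => [|a A IH] AU.
  by rewrite big_nil big1_seq.
rewrite big_cons -IH; last by move=> z zA; apply: AU; rewrite inE zA orbT.
under eq_bigr do rewrite /= exprD.
rewrite big_split (bigD1_seq a) //=; last by apply: AU; rewrite mem_head.
rewrite eqxx expr1 big1 ?mulr1 // => z za.
by rewrite eq_sym (negbTE za) expr0.
Qed.

(** The finite support of the product lies among the roots listed, and the
    multiplicity of a root is its number of occurrences. *)
Lemma meromorphic_resultantE f g (a b : C) A B : a != 0 -> b != 0 ->
  rnum f = a *: \prod_(x <- A) ('X - x%:P) -> rden f = b *: \prod_(x <- B) ('X - x%:P) ->
  size (rnum f) = size (rden f) -> (forall x, x \in A ++ B -> symbol g x != 0) ->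
  meromorphic_resultant f g = \prod_(x <- A) symbol g x / \prod_(x <- B) symbol g x.
Proof.
move=> a0 b0 eA eB sz g0; set U := undup (A ++ B).
have uU : uniq U by exact: undup_uniq.
have oE z : ord (Some z) f = (count_mem z A)%:Z - (count_mem z B)%:Z.
  by rewrite /ord eA eB !mup_prod_XsubC.
rewrite /meromorphic_resultant (@fsbigE _ _ _ _ _ (map Some U)) //=; first last.
- case=> [z|] _ zU; last by rewrite /ord sz subrr expr0z.
  have : z \notin A ++ B by rewrite -mem_undup; apply: contra zU => zU; exact: map_f.
  rewrite mem_cat negb_or => /andP[zA zB].
  by rewrite oE (count_memPn zA) (count_memPn zB) subrr expr0z.
- by rewrite map_inj_uniq // => x y [].
rewrite big_map (eq_bigl xpredT) => [|z]; last by rewrite in_setT.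
rewrite -(@prod_count U A) // => [|z zA]; last by rewrite mem_undup mem_cat zA.
rewrite -(@prod_count U B) // => [|z zB]; last by rewrite mem_undup mem_cat zB orbT.
rewrite -prodfV -big_split big_seq [RHS]big_seq; apply: eq_bigr => z; rewrite mem_undup => /g0 gz.
by rewrite oE expfzDr // -exprz_inv -exprVn.
Qed.

Lemma supp_root f z : f != 0 -> root (rnum f) z \/ root (rden f) z -> supp f (Some z).
Proof.
move=> f0.
have mup_gt0 p : p != 0 -> root p z -> (0 < mup z p)%N.
  by move=> p0 pz; rewrite -XsubC_dvd // dvdp_XsubCl.
have cfz := coprimep_rnum_rden f; have dn := rden_neq0 f; have nn := rnum_neq0 f0.
rewrite /supp /ord /= => -[rz|rz]; have r' := rz.
  rewrite [mup z (rden f)]mupNroot ?subr0; last by rewrite /root (coprimep_root cfz rz).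
  by rewrite eqz_nat -lt0n mup_gt0.
rewrite coprimep_sym in cfz; rewrite [mup z (rnum f)]mupNroot ?sub0r ?oppr_eq0.
  by rewrite eqz_nat -lt0n mup_gt0.
by rewrite /root (coprimep_root cfz rz).
Qed.

Lemma inner_supp f : f != 0 -> supp f `<=` @unit_disk R ->
  [/\ size (rnum f) = size (rden f), inner_poly (rnum f) & inner_poly (rden f)].
Proof.
move=> f0 sf; have sN : ord None f = 0.
  by apply: contrapT => /eqP /(sf None) [].
have inner z : root (rnum f) z \/ root (rden f) z -> abs2 z < 1.
  by move=> /(supp_root f0) /sf [w [<-]]; rewrite (normC_ltE z (@ltr01 R)) expr1n.
split.
- by apply/eqP; rewrite -eqz_nat -subr_eq0 -opprB oppr_eq0; apply/eqP.
- by split; [exact: rnum_neq0|move=> z rz; apply: inner; left].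
by split; [exact: rden_neq0|move=> z rz; apply: inner; right].
Qed.

Lemma outer_supp g : g != 0 -> supp g `<=` ~` @closed_unit_disk R ->
  outer_poly (rnum g) /\ outer_poly (rden g).
Proof.
move=> g0 sg; have outer z : root (rnum g) z \/ root (rden g) z -> 1 < abs2 z.
  move=> /(supp_root g0) /sg nz; rewrite ltNge; apply/negP => z1; apply: nz; exists z => //.
  by rewrite -(@expr_le1 _ 2) // normC_abs2 -(rmorph1 (real_complex R)) lecR.
split.
  by split; [exact: rnum_neq0|move=> z rz; apply: outer; left].
by split; [exact: rden_neq0|move=> z rz; apply: outer; right].
Qed.

End RationalFunctions.

(** * Commutators and truncated Toeplitz determinants *)

Section OperatorAgreement.
Context (R : realType).
Local Notation C := R[i].
Implicit Types (u v w m : C -> C) (t : R) (z : C) (A B : (C -> C) -> (C -> C)).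

(** Operators are only determined up to null sets: [A'] is a formula for [A]. *)
Definition op_agree A A' : Prop :=
  bounded_op A /\ forall u, hardy u -> hardy (A' u) /\ eqT (A u) (A' u).

Lemma op_agree_refl A : bounded_op A -> op_agree A A.
Proof. by move=> bA; split=> // u hu; split; [exact: bounded_op_hardy|exact: eqT_refl]. Qed.

Lemma op_agree_comp A A' B B' : op_agree A A' -> op_agree B B' -> op_agree (A \o B) (A' \o B').
Proof.
move=> [bA eA] [bB eB]; split=> [|u hu]; first exact: bounded_op_comp.
have [hB' e] := eB u hu; have [hA' e'] := eA _ hB'; split=> //.
exact: eqT_trans (bounded_op_eqT bA (bounded_op_hardy bB hu) hB' e) e'.
Qed.

Lemma op_agree_inv A B : inverse_ops A B -> op_agree (op_inv A) B.
Proof.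
move=> AB; have [_ bB _] := AB; have [bI eI] := op_inv_spec AB.
by split=> // u hu; split; [exact: bounded_op_hardy|exact: eI].
Qed.

Lemma op_agree_trans A A' A'' : op_agree A A' ->
  (forall u, hardy u -> hardy (A'' u) /\ eqT (A' u) (A'' u)) -> op_agree A A''.
Proof.
move=> [bA e] e'; split=> // u hu; have [_ h] := e u hu; have [h1 h2] := e' u hu.
by split=> //; exact: eqT_trans h h2.
Qed.

Lemma op_agree_multiplier m : multiplier m -> op_agree (toeplitz m) (fun u z => m z * u z).
Proof.
move=> mm; have [b e] := toeplitz_multiplier mm; split=> // u hu.
by have [_ hm] := mm; split; [exact: hm|exact: e].
Qed.

Lemma multiplier_inverse_ops m mi : multiplier m -> multiplier mi ->
  (forall t, m (cis t) * mi (cis t) = 1) -> inverse_ops (toeplitz m) (toeplitz mi).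
Proof.
move=> mm mmi mmi1.
have inv a b : multiplier a -> multiplier b -> (forall t, a (cis t) * b (cis t) = 1) ->
    forall u, hardy u -> eqT (toeplitz a (toeplitz b u)) u.
  move=> ma mb ab u hu.
  have [_ /(_ u hu) [_ e]] := op_agree_comp (op_agree_multiplier ma) (op_agree_multiplier mb).
  by apply: eqT_trans e _; apply: eqT_of_eq => t; rewrite /= mulrA ab mul1r.
split; [by case: (toeplitz_multiplier mm)|by case: (toeplitz_multiplier mmi)|].
by move=> u hu; split; apply: inv => // t; rewrite mulrC.
Qed.

Section Quotient.
Context (n : nat) (p q : {poly C}) (c : C) (phi psi : C -> C).
Hypotheses (p_monic : p \is monic) (size_p : size p = n.+2) (ip : inner_poly p).
Hypotheses (q_monic : q \is monic) (size_q : size q = n.+2) (iq : inner_poly q).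
Hypotheses (c_neq0 : c != 0).
Hypotheses (phiE : forall t, phi (cis t) = c * (p.[cis t] / q.[cis t]))
  (psiE : forall t, psi (cis t) = c^-1 * (q.[cis t] / p.[cis t])).

Lemma op_agree_quotient : op_agree (toeplitz phi) (toeplitz phi).
Proof. by apply: op_agree_refl; case: (toeplitz_frac q_monic size_q iq phiE). Qed.

Lemma quotient_inverse_ops : inverse_ops (toeplitz phi) (toeplitz psi).
Proof.
have [bp _] := toeplitz_frac q_monic size_q iq phiE.
have [bq _] := toeplitz_frac p_monic size_p ip psiE.
have phiE' t : phi (cis t) = c^-1^-1 * (p.[cis t] / q.[cis t]) by rewrite invrK.
split=> // u hu; split.
  exact: (toeplitz_frac_inverse q_monic size_q iq p_monic size_p ip (invr_neq0 c_neq0) psiE phiE').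
exact: (toeplitz_frac_inverse p_monic size_p ip q_monic size_q iq c_neq0 phiE psiE).
Qed.

Lemma op_agree_quotient_mult m chi : multiplier m ->
  (forall t, chi (cis t) = phi (cis t) * m (cis t)) ->
  op_agree (toeplitz chi) (fun u => toeplitz phi (fun z => m z * u z)).
Proof.
move=> [cm hm] chiE; have [bp ep] := toeplitz_frac q_monic size_q iq phiE.
have cchi : continuous_circle chi.
  apply: eq_continuous_circle (continuous_circleM (continuous_symbol iq phiE) cm) => t.
  by rewrite chiE.
have hq u : hardy u -> hardy (toeplitz_quot n p q c (fun z => m z * u z)).
  by move=> hu; exact: (hardy_toeplitz_quot p c q_monic size_q iq (hm _ hu)).
have pq u : hardy u ->
    hardy_perp (fun z => chi z * u z - toeplitz_quot n p q c (fun z => m z * u z) z).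
  move=> hu; apply: eq_hardy_perp (perp_toeplitz_quot size_q iq phiE (fun z => m z * u z)) => t.
  by rewrite chiE mulrA.
split=> [|u hu].
  by apply: toeplitz_bounded => // u hu; exists (toeplitz_quot n p q c (fun z => m z * u z)); auto.
split; first exact: bounded_op_hardy bp (hm _ hu).
apply: eqT_trans (eqT_sym (ep _ (hm _ hu))); apply: toeplitz_eq; auto.
Qed.

End Quotient.

(** The tail of [w] is [z^N] times a Hardy function, and so is its product with
    [m]. *)
Lemma fourier_multiplier m w N (i : 'I_N) : multiplier m -> hardy w ->
  fourier (fun z => m z * w z) i%:Z = \sum_(k < N) fourier m (i%:Z - k%:Z) * fourier w k%:Z.
Proof.
move=> [cm hm] hw; set v := fun z => z ^ (- N%:Z) * (w z - partial_sum w N z).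
have hv : hardy v by exact: hardy_tail.
have LX (k : nat) : L2 (fun z => m z * z ^+ k) by exact: hardy_L2 (hm _ (hardy_Xn _ k)).
have L1 : L2 (fun z => \sum_(k < N) fourier w k%:Z * (m z * z ^+ k)).
  by apply: L2_sum => k; apply: L2Z.
have L2' : L2 (fun z => z ^ N%:Z * (m z * v z)) by apply: L2_Xz_mul; exact: hardy_L2 (hm _ hv).
transitivity (fourier (fun z => \sum_(k < N) fourier w k%:Z * (m z * z ^+ k) +
                          z ^ N%:Z * (m z * v z)) i%:Z).
  apply: eq_fourier => t; rewrite /v.
  have -> : cis t ^ N%:Z * (m (cis t) * (cis t ^ (- N%:Z) * (w (cis t) - partial_sum w N (cis t)))) =
      m (cis t) * (w (cis t) - partial_sum w N (cis t)).
    rewrite mulrCA; congr (_ * _).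
    by rewrite mulrA -expfzDr ?cis_neq0 // subrr expr0z mul1r.
  have -> : \sum_(k < N) fourier w k%:Z * (m (cis t) * cis t ^+ k) =
      m (cis t) * partial_sum w N (cis t).
    by rewrite mulr_sumr; apply: eq_bigr => k _; rewrite mulrCA.
  by rewrite -mulrDr addrC subrK.
rewrite fourierD // fourierXz fourier_suml //.
have [_ ->] := hm _ hv; last by rewrite subr_lt0 ltz_nat.
rewrite addr0; apply: eq_bigr => k _; rewrite mulrC; congr (_ * _).
by rewrite -fourierXz; apply: eq_fourier => t; rewrite mulrC.
Qed.

End OperatorAgreement.

Section Sandwich.
Context (R : realType).
Local Notation C := R[i].
Context (n : nat) (p q : {poly C}) (c : C) (phi psi : C -> C).
Hypotheses (p_monic : p \is monic) (size_p : size p = n.+2) (ip : inner_poly p).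
Hypotheses (q_monic : q \is monic) (size_q : size q = n.+2) (iq : inner_poly q).
Hypotheses (c_neq0 : c != 0).
Hypotheses (phiE : forall t, phi (cis t) = c * (p.[cis t] / q.[cis t]))
  (psiE : forall t, psi (cis t) = c^-1 * (q.[cis t] / p.[cis t])).

Lemma op_agree_ext A (A' A'' : (C -> C) -> C -> C) : op_agree A A' ->
  (forall u, A' u = A'' u) -> op_agree A A''.
Proof. by move=> h /funext <-. Qed.

(** With [e] in place of the product [ai bi] this applies when the latter is 1 or a
    simpler function on the circle. *)
Lemma sandwich_det a ai b bi e (O : (C -> C) -> (C -> C)) :
  multiplier a -> multiplier ai -> multiplier b -> multiplier bi -> multiplier e ->
  (forall t, a (cis t) * ai (cis t) = 1) -> (forall t, b (cis t) * bi (cis t) = 1) ->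
  (forall t, e (cis t) = ai (cis t) * bi (cis t)) ->
  op_agree O (fun u z => a z *
     toeplitz psi (fun z => b z * toeplitz phi (fun z => e z * u z) z) z) ->
  let d := \det (mult_mx n p b) / \det (mult_mx n q b) in
  [/\ determinant_class O, fredholm_det O = d & cvgC (fun N => \det (corner O N)) d].
Proof.
move=> ma mai mb mbi me aai bbi eE [bO eO].
apply: (toeplitz_commutator_det p_monic size_p ip q_monic size_q iq c_neq0 phiE psiE
  ma mai mb mbi aai bbi bO) => u hu.
have [bphi _] := toeplitz_frac q_monic size_q iq phiE.
have [bpsi _] := toeplitz_frac p_monic size_p ip psiE.
have [_ /(_ _ hu) h1] := me; have [_ /(_ _ hu) h2] := multiplierM mai mbi.
have [_ hb] := mb; have [_ h] := eO u hu; apply: eqT_trans h _.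
have e1 : eqT (toeplitz phi (fun z => e z * u z)) (toeplitz phi (fun z => ai z * bi z * u z)).
  by apply: (bounded_op_eqT bphi h1 h2); apply: eqT_of_eq => t; rewrite eE.
apply: (eqT_op1 (fun z x => a z * x)).
apply: (bounded_op_eqT bpsi (hb _ (bounded_op_hardy bphi h1)) (hb _ (bounded_op_hardy bphi h2))).
exact: (eqT_op1 (fun z x => b z * x) e1).
Qed.

(** The difference is orthogonal to [z^k]. *)
Lemma fourier_toeplitz u (k : nat) : hardy u ->
  fourier (toeplitz phi u) k%:Z = fourier (fun z => phi z * u z) k%:Z.
Proof.
move=> hu; have [bphi ephi] := toeplitz_frac q_monic size_q iq phiE.
have hq := hardy_toeplitz_quot p c q_monic size_q iq hu.
have Lpu : L2 (fun z => phi z * u z).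
  by apply: L2_mulr; [exact: continuous_symbol iq phiE|exact: hardy_L2].
rewrite (fourier_eqT _ _ _ (ephi u hu)); [|exact: hardy_L2 (bounded_op_hardy _ _)|exact: hardy_L2].
have [_ /(_ _ (hardy_Xn R k))] := perp_toeplitz_quot size_q iq phiE u.
rewrite -[X in dot _ X]/(fun z : C => z ^ k%:Z) -fourier_dot fourierB //; last exact: hardy_L2.
by move/eqP; rewrite subr_eq0 => /eqP.
Qed.

(** The projection of [c z^j p / q] keeps its polynomial part: the rest, a proper
    fraction with poles in the disk, is orthogonal to the Hardy space. *)
Lemma toeplitz_Xn (j : nat) : eqT (toeplitz phi (@monom R j))
  (fun z => c * (p * 'X^j %/ q).[z]).
Proof.
have hX : hardy (@monom R j) by exact: hardy_Xn.
have [_ /(_ _ hX) e] := toeplitz_frac q_monic size_q iq phiE; apply: eqT_trans e _.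
set s := p * 'X^j; apply: eqT_of_eq => t; rewrite /toeplitz_quot.
have es : s = s %/ q * q + s %% q by exact: divp_eq.
have q0 : q != 0 by exact: monic_neq0.
have sr : (size (s %% q)%R <= n.+1)%N by rewrite -ltnS -size_q ltn_modp.
have -> : hrem n q (fun z => p.[z] * @monom R j z) = poly_rV (s %% q).
  rewrite -(hrem_poly q_monic size_q iq sr) -[RHS]add0r.
  rewrite -(hrem_root q_monic size_q iq (hardy_horner (s %/ q))) -hremD //; first last.
  - exact: hardy_L2 (hardy_horner _).
  - by have [_ /(_ _ (hardy_horner (s %/ q)))/hardy_L2] := multiplier_horner q.
  apply: eq_hrem => t'; rewrite mulrC /monom -hornerXn [_ * p.[_]]mulrC -hornerM -/s.
  by rewrite {1}es hornerD hornerM mulrC.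
rewrite poly_rV_K // /monom -hornerXn -hornerM -/s {1}es hornerD addrK hornerM mulfK //.
exact: inner_poly_neq0.
Qed.

End Sandwich.

Lemma divp_monic (F : fieldType) (s r : {poly F}) : s \is monic -> r \is monic ->
  (size r <= size s)%N -> s %/ r \is monic.
Proof.
move=> ms mr rs; have r0 := monic_neq0 mr.
have dn : s %/ r != 0 by rewrite divp_eq0 (negbTE r0) (negbTE (monic_neq0 ms)) /= -leqNgt.
move: ms; rewrite !monicE {1}(divp_eq s r) lead_coefDl ?lead_coef_Mmonic //.
have sd : (0 < size (s %/ r)%R)%N by rewrite size_poly_gt0.
rewrite size_Mmonic // -(prednK sd) addSn /=; apply: leq_trans (leq_addl _ _).
by rewrite ltn_modp.
Qed.

Section CommutatorDeterminants.
Context (R : realType).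
Local Notation C := R[i].
Context (n : nat) (p q : {poly C}) (c : C) (phi psi m mi h h' : C -> C).
Hypotheses (p_monic : p \is monic) (size_p : size p = n.+2) (ip : inner_poly p).
Hypotheses (q_monic : q \is monic) (size_q : size q = n.+2) (iq : inner_poly q).
Hypotheses (c_neq0 : c != 0).
Hypotheses (phiE : forall t, phi (cis t) = c * (p.[cis t] / q.[cis t]))
  (psiE : forall t, psi (cis t) = c^-1 * (q.[cis t] / p.[cis t])).
Hypotheses (mm : multiplier m) (mmi : multiplier mi)
  (mmi1 : forall t, m (cis t) * mi (cis t) = 1).
Hypotheses (hE : forall t, h (cis t) = phi (cis t) * mi (cis t))
  (h'E : forall t, h' (cis t) = psi (cis t) * m (cis t)).

Let m1 := multiplier_cst (1 : C).
Let phiE' t : phi (cis t) = c^-1^-1 * (p.[cis t] / q.[cis t]).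
Proof. by rewrite invrK. Qed.
Let mim1 t : mi (cis t) * m (cis t) = 1. Proof. by rewrite mulrC. Qed.
Let one1 (t : R) : (1 : C) * 1 = 1. Proof. by rewrite mulr1. Qed.
Let mul1_fun (u : C -> C) : (fun z => 1 * u z) = u.
Proof. by apply/funext => z; rewrite mul1r. Qed.

Let a_phi := op_agree_quotient q_monic size_q iq phiE.
Let a_psi := op_agree_quotient p_monic size_p ip psiE.
Let a_m := op_agree_multiplier mm.
Let a_mi := op_agree_multiplier mmi.
Let inv_phi := quotient_inverse_ops p_monic size_p ip q_monic size_q iq c_neq0 phiE psiE.
Let inv_m := multiplier_inverse_ops mm mmi mmi1.
Let a_Iphi := op_agree_inv inv_phi.
Let a_Im : op_agree (op_inv (toeplitz m)) (fun u z => mi z * u z).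
Proof. by apply: op_agree_trans (op_agree_inv inv_m) _; case: a_mi. Qed.

Lemma commutator_determinant_class :
  determinant_class (toeplitz m \o op_inv (toeplitz phi) \o op_inv (toeplitz m) \o toeplitz phi).
Proof.
have ag := op_agree_comp (op_agree_comp (op_agree_comp a_m a_Iphi) a_Im) a_phi.
have [] := sandwich_det p_monic size_p ip q_monic size_q iq c_neq0 phiE psiE
  mm mmi mmi mm m1 mmi1 mim1 (fun t => esym (mim1 t)) (op_agree_ext ag _).
  by move=> u /=; rewrite mul1_fun.
by [].
Qed.

Let d : C := \det (mult_mx n p m) / \det (mult_mx n q m).

Let dV : \det (mult_mx n q mi) / \det (mult_mx n p mi) = d.
Proof.
rewrite (det_mult_mx_inv q_monic size_q iq mm mmi mmi1).
by rewrite (det_mult_mx_inv p_monic size_p ip mm mmi mmi1) invrK mulrC.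
Qed.

Lemma toeplitz_pair_det : determinant_class (toeplitz h \o toeplitz h') /\
  fredholm_det (toeplitz h \o toeplitz h') = d.
Proof.
have ag := op_agree_comp (op_agree_quotient_mult q_monic size_q iq phiE mmi hE)
  (op_agree_quotient_mult p_monic size_p ip psiE mm h'E).
have [] := sandwich_det q_monic size_q iq p_monic size_p ip (invr_neq0 c_neq0) psiE phiE'
  m1 m1 mmi mm mm one1 mim1 (fun t : R => esym (mul1r _)) (op_agree_ext ag _).
  by move=> u /=; rewrite mul1_fun.
by rewrite dV => dc fd _; split; [exact: dc|exact: fd].
Qed.

Lemma commutator_det :
  determinant_class (op_inv (toeplitz phi) \o toeplitz m \o toeplitz phi \o op_inv (toeplitz m)) /\
  fredholm_det (op_inv (toeplitz phi) \o toeplitz m \o toeplitz phi \o op_inv (toeplitz m)) = d.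
Proof.
have ag := op_agree_comp (op_agree_comp (op_agree_comp a_Iphi a_m) a_phi) a_Im.
have [] := sandwich_det p_monic size_p ip q_monic size_q iq c_neq0 phiE psiE
  m1 m1 mm mmi mmi one1 mmi1 (fun t : R => esym (mul1r _)) (op_agree_ext ag _).
  by move=> u /=; rewrite mul1_fun.
by move=> dc fd _; split; [exact: dc|exact: fd].
Qed.

(** Up to the constants coming from the diagonal of two triangular matrices, the
    truncated Toeplitz determinant is that of a corner of
    [T(m) T(phi) T(m)^-1 T(phi)^-1]: multiplication by [m] is lower triangular and
    [T(psi)] maps [z^j] to a polynomial of degree [j]. *)
Lemma toeplitz_corner N :
  (fourier m 0 / c) ^+ N * \det (toeplitz_mx h N) =
  \det (corner (toeplitz m \o toeplitz phi \o toeplitz mi \o toeplitz psi) N).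
Proof.
pose s (j : nat) : {poly C} := q * 'X^j %/ p.
have [p0 q0] := (monic_neq0 p_monic, monic_neq0 q_monic).
have s_size j : size (s j) = j.+1.
  rewrite (size_divp _ p0) (size_mulXn _ q0) size_p size_q /=.
  by rewrite -addSnnS addnK.
have s_monic j : s j \is monic.
  apply: divp_monic => //; first by rewrite monicMr ?monicXn.
  by rewrite size_mulXn ?monic_neq0 // size_p size_q leq_addl.
pose G : 'M[C]_N := \matrix_(i, k) fourier m (i%:Z - k%:Z).
pose F : 'M[C]_N := \matrix_(l, j) (c^-1 * (s j)`_l).
have detG : \det G = fourier m 0 ^+ N.
  rewrite det_trig; last first.
    apply/is_trig_mxP => i k ik; rewrite mxE; have [_ hm] := mm.
    have [_ m0] := hm _ (hardy_cst 1).
    by rewrite -(m0 (i%:Z - k%:Z)) ?subr_lt0 ?ltz_nat //; apply: eq_fourier => t; rewrite mulr1.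
  under eq_bigr do rewrite mxE subrr.
  by rewrite prodr_const card_ord.
have detF : \det F = c^-1 ^+ N.
  rewrite -det_tr det_trig; last first.
    by apply/is_trig_mxP => j l jl; rewrite !mxE nth_default ?mulr0 // s_size.
  rewrite (eq_bigr (fun=> c^-1)); first by rewrite prodr_const card_ord.
  move=> j _; rewrite !mxE.
  by have /monicP := s_monic j; rewrite /lead_coef s_size => ->; rewrite mulr1.
suff -> : corner (toeplitz m \o toeplitz phi \o toeplitz mi \o toeplitz psi) N =
    G *m (toeplitz_mx h N *m F).
  by rewrite !det_mulmx detG detF exprMn exprVn; ring.
have [bK eK] := op_agree_comp (op_agree_comp (op_agree_comp a_m a_phi) a_mi) a_psi.
have [bphi _] := toeplitz_frac q_monic size_q iq phiE.
have [bpsi _] := toeplitz_frac p_monic size_p ip psiE.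
have [cm hm] := mm; have [cmi hmi] := mmi.
have ch : continuous_circle h.
  apply: eq_continuous_circle (continuous_circleM (continuous_symbol iq phiE) cmi) => t.
  by rewrite hE.
apply/matrixP => i j; rewrite [LHS]mxE.
have hX : hardy (@monom R j) by exact: hardy_Xn.
pose w z := \sum_(l < N) F l j * z ^+ l.
have hw : hardy w by apply: hardy_suml => l; exact: hardy_Xn.
have hpX := bounded_op_hardy bpsi hX.
have hpw := bounded_op_hardy bphi (hmi _ hw).
have ew : eqT (toeplitz psi (@monom R j)) w.
  apply: eqT_trans (toeplitz_Xn p_monic size_p ip psiE j) _; apply: eqT_of_eq => t.
  rewrite -/(s j) (@horner_coef_wide _ N) ?s_size // mulr_sumr.
  by apply: eq_bigr => l _; rewrite mxE mulrA.
have e2 := bounded_op_eqT bphi (hmi _ hpX) (hmi _ hw) (eqT_op1 (fun z x => mi z * x) ew).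
have [_ e1] := eK _ hX; have e3 := eqT_trans e1 (eqT_op1 (fun z x => m z * x) e2).
rewrite -[X in dot _ X]/(fun z : C => z ^ i%:Z) -fourier_dot.
rewrite (fourier_eqT _ _ _ e3); [|exact: hardy_L2 (bounded_op_hardy bK hX)|exact: hardy_L2 (hm _ hpw)].
rewrite fourier_multiplier // mxE; apply: eq_bigr => k _; rewrite [G _ _]mxE; congr (_ * _).
rewrite (fourier_toeplitz q_monic size_q iq phiE _ (hmi _ hw)).
transitivity (fourier (fun z => \sum_(l < N) F l j * (z ^ l%:Z * h z)) k%:Z).
  apply: eq_fourier => t; rewrite mulrA -hE /w mulr_sumr.
  by apply: eq_bigr => l _; rewrite mulrCA [h _ * _]mulrC.
rewrite fourier_suml; last by move=> l; apply: L2_Xz_mul; exact: L2_continuous.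
rewrite [RHS]mxE; apply: eq_bigr => l _; rewrite fourierXz [toeplitz_mx _ _ _ _]mxE.
exact: mulrC.
Qed.

Lemma toeplitz_det_cvg :
  cvgC (fun N => (fourier m 0 / c) ^+ N * \det (toeplitz_mx h N)) d.
Proof.
apply: (@eq_cvgC _ (fun N =>
  \det (corner (toeplitz m \o toeplitz phi \o toeplitz mi \o toeplitz psi) N))) => [N|].
  by rewrite toeplitz_corner.
have ag := op_agree_comp (op_agree_comp (op_agree_comp a_m a_phi) a_mi) a_psi.
have [] := sandwich_det q_monic size_q iq p_monic size_p ip (invr_neq0 c_neq0) psiE phiE'
  mm mmi mmi mm m1 mmi1 mim1 (fun t => esym (mim1 t)) (op_agree_ext ag _).
  by move=> u /=; rewrite mul1_fun.
by rewrite dV.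
Qed.

End CommutatorDeterminants.

(** * A branch of the logarithm of the symbol *)

Section Assembly.
Context (R : realType).
Local Notation C := R[i].
Implicit Types (A B Z W : seq C) (a b c z : C).

Lemma prod_inner_factor A z : z != 0 ->
  \prod_(a <- A) (z - a) = z ^+ size A * \prod_(a <- A) (1 - a / z).
Proof.
move=> z0; elim: A => [|a A IH]; first by rewrite !big_nil mulr1.
by rewrite !big_cons IH exprS; field.
Qed.

Lemma prod_outer_factor W z : {in W, forall b, b != 0} ->
  \prod_(b <- W) (z - b) = \prod_(b <- W) (- b) * \prod_(b <- W) (1 - z / b).
Proof.
elim: W => [|b W IH] W0; first by rewrite !big_nil mulr1.
have b0 : b != 0 by apply: W0; rewrite mem_head.
rewrite !big_cons IH => [|x xW]; last by apply: W0; rewrite inE xW orbT.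
by field.
Qed.

Lemma abs2_gt0_neq0 z : 0 < abs2 z -> z != 0.
Proof. by apply: contraTneq => ->; rewrite /abs2 /= !expr0n addr0 ltxx. Qed.

Lemma abs2_gt1_neq0 z : 1 < abs2 z -> z != 0.
Proof. by move=> z1; apply: abs2_gt0_neq0; exact: lt_trans z1. Qed.

(** The points farther from 0 than every element of [B]. *)
Lemma inner_nbhd B : {in B, forall b, abs2 b < 1} ->
  exists U : set R[i]^o, [/\ open U, (forall z : C, `|z| = 1 -> U z) &
    forall z, U z -> z != 0 /\ {in B, forall b, z != b}].
Proof.
elim: B => [|b B IH] hB.
  exists [set z | 0 < abs2 z]; split.
  - by case: (open_abs2_lt (0 : R)).
  - by move=> z /norm1_abs2 /= ->; exact: ltr01.
  by move=> z /abs2_gt0_neq0.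
have [|U [oU cU UB]] := IH; first by move=> x xB; apply: hB; rewrite inE xB orbT.
exists (U `&` [set z | abs2 b < abs2 z]); split.
- by apply: openI => //; case: (open_abs2_lt (abs2 b)).
- move=> z z1; split; first exact: cU.
  by have /norm1_abs2 /= -> := z1; apply: hB; rewrite mem_head.
move=> z [/UB [z0 zB] /= bz]; split=> // x; rewrite inE => /orP[/eqP ->|/zB //].
by apply: contraTneq bz => ->; rewrite ltxx.
Qed.

Lemma outer_nbhd W : {in W, forall b, 1 < abs2 b} ->
  exists U : set R[i]^o, [/\ open U, (forall z : C, `|z| = 1 -> U z) &
    forall z, U z -> {in W, forall b, z != b}].
Proof.
elim: W => [|b W IH] hW.
  by exists setT; split=> //; exact: openT.
have [|U [oU cU UW]] := IH; first by move=> x xW; apply: hW; rewrite inE xW orbT.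
exists (U `&` [set z | abs2 z < abs2 b]); split.
- by apply: openI => //; case: (open_abs2_lt (abs2 b)).
- move=> z z1; split; first exact: cU.
  by have /norm1_abs2 /= -> := z1; apply: hW; rewrite mem_head.
move=> z [/UW zW /= bz] x; rewrite inE => /orP[/eqP ->|/zW //].
by apply: contraTneq bz => ->; rewrite ltxx.
Qed.

(** As [A] and [B] have the same length, the powers of [z] in
    [z - a = z (1 - a / z)] cancel: the winding number is 0. *)
Lemma log_branch_exists (h : C -> C) c A B Z W : c != 0 -> size A = size B ->
  {in A, forall a, abs2 a < 1} -> {in B, forall a, abs2 a < 1} ->
  {in Z, forall a, 1 < abs2 a} -> {in W, forall a, 1 < abs2 a} ->
  (forall z, {in B, forall b, z != b} -> {in W, forall b, z != b} ->
     h z = c * (\prod_(a <- A) (z - a) / \prod_(b <- B) (z - b) *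
                (\prod_(a <- Z) (z - a) / \prod_(b <- W) (z - b)))) ->
  exists L, log_branch h L.
Proof.
move=> c0 sAB hA hB hZ hW hE.
have [U1 [oU1 cU1 U1B]] := inner_nbhd hB; have [U2 [oU2 cU2 U2W]] := outer_nbhd hW.
have nz (s : seq C) : {in s, forall b, 1 < abs2 b} -> {in s, forall b, b != 0}.
  by move=> hs b /hs /abs2_gt1_neq0.
have pn0 (s : seq C) : {in s, forall b, 1 < abs2 b} -> \prod_(b <- s) (- b) != 0.
  move=> hs; rewrite prodf_seq_neq0; apply/allP => b /(nz _ hs) /=.
  by rewrite oppr_eq0.
pose k := c * (\prod_(b <- Z) (- b) / \prod_(b <- W) (- b)).
have k0 : k != 0 by rewrite !mulf_neq0 // ?invr_neq0 // pn0.
have [L0 b0] := log_branch_cst k0.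
have [LA bA] := log_branch_prod (F := fun a z => 1 - a / z) (fun a aA => log_branch_inner (hA a aA)).
have [LB bB] := log_branch_prod (F := fun a z => 1 - a / z) (fun a aA => log_branch_inner (hB a aA)).
have [LZ bZ] := log_branch_prod (F := fun a z => 1 - z / a) (fun a aA => log_branch_outer (hZ a aA)).
have [LW bW] := log_branch_prod (F := fun a z => 1 - z / a) (fun a aA => log_branch_outer (hW a aA)).
have bL := log_branchM b0 (log_branchM (log_branchM bA (log_branchV bB))
  (log_branchM bZ (log_branchV bW))).
eexists; apply: (eq_log_branch (openI oU1 oU2) _ _ bL) => [z z1|z].
  by split; [exact: cU1|exact: cU2].
move=> [/U1B [z0 zB] /U2W zW]; rewrite hE //.
rewrite (prod_inner_factor A z0) (prod_inner_factor B z0).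
rewrite (prod_outer_factor _ (nz _ hZ)) (prod_outer_factor _ (nz _ hW)) sAB /k.
by rewrite -!mulf_div mulfV ?expf_neq0 // mul1r; ring.
Qed.

Lemma fourier_horner (s : {poly C}) (k : nat) : fourier (fun z => s.[z]) k%:Z = s`_k.
Proof.
rewrite (@eq_fourier _ _ (fun z => \sum_(i < size s) s`_i * z ^ i%:Z)) => [|t]; last first.
  by rewrite horner_coef.
rewrite fourier_suml; last by move=> i; exact: L2_Xz.
have [sk|ks] := leqP (size s) k.
  rewrite nth_default // big1 // => i _; rewrite fourier_Xz eqz_nat ltn_eqF ?mulr0 //.
  exact: leq_trans (ltn_ord i) sk.
rewrite (bigD1 (Ordinal ks)) //= fourier_Xz eqxx mulr1 big1 ?addr0 // => i ik.
by move: ik; rewrite fourier_Xz eqz_nat -val_eqE /= => /negbTE ->; rewrite mulr0.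
Qed.

Lemma fourier0_outer_frac (s1 s2 : {poly C}) : outer_poly s2 ->
  fourier (fun z => s1.[z] / s2.[z]) 0 = s1.[0] / s2.[0].
Proof.
move=> os; have mf := multiplierM (multiplier_horner s1) (multiplier_horner_inv os).
have s20 : s2.[0] != 0.
  by apply/negP => /os.2; rewrite /abs2 /= !expr0n addr0 ltr10.
have := fourier_multiplier (ord0 : 'I_1) mf (hardy_horner s2).
rewrite big_ord1 subrr fourier_horner -horner_coef0 => e.
apply: (mulIf s20); rewrite divfK //; apply: etrans (esym e) _.
rewrite horner_coef0 -fourier_horner; apply: eq_fourier => t.
by rewrite divfK //; exact: outer_poly_neq0.
Qed.

End Assembly.

Theorem proposition3 (R : realType) (f g : {fraction {poly R[i]}})
    (hf0 : f != 0) (hg0 : g != 0)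
    (hf : supp f `<=` @unit_disk R)
    (hg : supp g `<=` ~` @closed_unit_disk R) :
  let T (x : {fraction {poly R[i]}}) := toeplitz (symbol x) in
  let h := symbol (f / g) in
  (invertible_op (T f) /\ invertible_op (T g)) /\
  determinant_class (T g \o op_inv (T f) \o op_inv (T g) \o T f) /\
  (determinant_class (T (f / g) \o T (g / f)) /\
   meromorphic_resultant f g = fredholm_det (T (f / g) \o T (g / f))) /\
  (determinant_class (op_inv (T f) \o T g \o T f \o op_inv (T g)) /\
   meromorphic_resultant f g =
     fredholm_det (op_inv (T f) \o T g \o T f \o op_inv (T g))) /\
  ((fun N : nat => (rval g (Some 0) / rval f None) ^+ N
                   * \det (toeplitz_mx h N) : R[i]^o) @ \oo
     --> (meromorphic_resultant f g : R[i]^o)) /\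
  (exists Log, log_branch h Log) /\
  (forall Log, log_branch h Log ->
   let S := series (fun n : nat =>
     n.+1%:R * fourier Log n.+1%:Z * fourier Log (- n.+1%:Z) : R[i]^o) in
   cvgn S /\ meromorphic_resultant f g = cexp (limn S)).
Proof.
move=> T h.
have [sf iN iD] := inner_supp hf0 hf; have [oN oD] := outer_supp hg0 hg.
have [A eA] := closed_field_poly_normal (rnum f).
have [B eB] := closed_field_poly_normal (rden f).
have [W eW] := closed_field_poly_normal (rnum g).
have [Z eZ] := closed_field_poly_normal (rden g).
have lnf : lead_coef (rnum f) != 0 by rewrite lead_coef_eq0; case: iN.
have ldf : lead_coef (rden f) != 0 by rewrite lead_coef_eq0; case: iD.
have lng : lead_coef (rnum g) != 0 by rewrite lead_coef_eq0; case: oN.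
have ldg : lead_coef (rden g) != 0 by rewrite lead_coef_eq0; case: oD.
have rootsE (r : {poly R[i]}) s : lead_coef r != 0 ->
    r = lead_coef r *: \prod_(a <- s) ('X - a%:P) -> forall a, (a \in s) = root r a.
  by move=> r0 er a; rewrite er rootZ ?root_prod_XsubC.
have hA : {in A, forall a, abs2 a < 1} by move=> a; rewrite (rootsE _ _ lnf eA); apply: iN.2.
have hB : {in B, forall a, abs2 a < 1} by move=> a; rewrite (rootsE _ _ ldf eB); apply: iD.2.
have hW : {in W, forall a, 1 < abs2 a} by move=> a; rewrite (rootsE _ _ lng eW); apply: oN.2.
have hZ : {in Z, forall a, 1 < abs2 a} by move=> a; rewrite (rootsE _ _ ldg eZ); apply: oD.2.
have sAB : size A = size B.
  apply/eqP; rewrite -eqSS -!(size_prod_XsubC _ id) -(size_scale _ lnf) -eA sf.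
  by rewrite -(size_scale (\prod_(x <- B) _) ldf) -eB.
have valE (r : {poly R[i]}) s z : r = lead_coef r *: \prod_(a <- s) ('X - a%:P) ->
    r.[z] = lead_coef r * \prod_(a <- s) (z - a).
  move=> er; rewrite {1}er hornerZ horner_prod; congr (_ * _).
  by apply: eq_bigr => a _; rewrite hornerXsubC.
have g_neq0 a : abs2 a <= 1 -> symbol g a != 0.
  move=> a1; rewrite mulf_neq0 ?invr_neq0 //.
    by apply/negP => /oN.2; rewrite ltNge a1.
  by apply/negP => /oD.2; rewrite ltNge a1.
have g0 : symbol g 0 != 0 by apply: g_neq0; rewrite /abs2 /= !expr0n addr0 ler01.
have resE : meromorphic_resultant f g = \prod_(a <- A) symbol g a / \prod_(b <- B) symbol g b.
  apply: (meromorphic_resultantE lnf ldf eA eB sf) => a; rewrite mem_cat => /orP[/hA|/hB] a1.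
    by apply: g_neq0; exact: ltW.
  by apply: g_neq0; exact: ltW.
pose c := lead_coef (rnum f) / lead_coef (rden f).
have c0 : c != 0 by rewrite mulf_neq0 ?invr_neq0.
have cE : rval f None = c by rewrite /rval -sf.
(* A common root at 0 makes the degrees at least 1 and cancels in the ratios. *)
pose p := \prod_(a <- 0 :: A) ('X - a%:P); pose q := \prod_(a <- 0 :: B) ('X - a%:P).
have p_monic : p \is monic by exact: monic_prod_XsubC.
have q_monic : q \is monic by exact: monic_prod_XsubC.
have size_p : size p = (size A).+2 by rewrite size_prod_XsubC.
have size_q : size q = (size A).+2 by rewrite size_prod_XsubC sAB.
have inner0 s : {in s, forall a : R[i], abs2 a < 1} -> inner_poly (\prod_(a <- 0 :: s) ('X - a%:P)).
  move=> hs; split; first exact: monic_neq0 (monic_prod_XsubC _ _ _).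
  move=> a; rewrite root_prod_XsubC inE => /orP[/eqP ->|/hs //].
  by rewrite /abs2 /= !expr0n addr0 ltr01.
have [ip iq] := (inner0 _ hA, inner0 _ hB).
have fE t : symbol f (cis t) = c * (p.[cis t] / q.[cis t]).
  rewrite /symbol /rval (valE _ _ _ eA) (valE _ _ _ eB) /p /q !horner_prod !big_cons.
  rewrite !hornerXsubC !(eq_bigr _ (fun a _ => hornerXsubC a (cis t))) subr0.
  by rewrite -!mulf_div mulfV ?cis_neq0 // mul1r.
pose psi z := (symbol f z)^-1; pose mi z := (symbol g z)^-1.
have psiE t : psi (cis t) = c^-1 * (q.[cis t] / p.[cis t]).
  by rewrite /psi fE invfM [(_ / q.[_])^-1]invf_div.
have mg : multiplier (symbol g).
  exact: multiplierM (multiplier_horner _) (multiplier_horner_inv oD).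
have mmi : multiplier mi.
  apply: eq_multiplier (multiplierM (multiplier_horner (rden g)) (multiplier_horner_inv oN)) => t.
  by rewrite /mi /symbol /rval invf_div.
have gmi t : symbol g (cis t) * mi (cis t) = 1.
  by rewrite mulfV // g_neq0 // cis_abs2.
have hE t : h (cis t) = symbol f (cis t) * mi (cis t).
  by rewrite /h (symbol_div (inner_poly_neq0 t iD) (outer_poly_neq0 t oN)).
have h'E t : symbol (g / f) (cis t) = psi (cis t) * symbol g (cis t).
  by rewrite (symbol_div (outer_poly_neq0 t oD) (inner_poly_neq0 t iN)) [RHS]mulrC.
have detE : \det (mult_mx (size A) p (symbol g)) / \det (mult_mx (size A) q (symbol g)) =
    meromorphic_resultant f g.
  have dp := det_mult_mx_frac p_monic size_p ip (rnum g) oD (erefl p).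
  have dq := det_mult_mx_frac q_monic size_q iq (rnum g) oD (erefl q).
  rewrite resE; apply: etrans (congr2 (fun x y => x / y) dp dq) _; rewrite !big_cons.
  by rewrite -mulf_div mulfV ?mul1r //; exact: g0.
have inv_f := quotient_inverse_ops p_monic size_p ip q_monic size_q iq c0 fE psiE.
have inv_g := multiplier_inverse_ops mg mmi gmi.
split; first exact: conj (ex_intro _ _ inv_f) (ex_intro _ _ inv_g).
split; first exact: commutator_determinant_class p_monic size_p ip q_monic size_q iq c0 fE psiE mg mmi gmi.
split.
  have [dc fd] := toeplitz_pair_det p_monic size_p ip q_monic size_q iq c0 fE psiE mg mmi gmi hE h'E.
  exact: conj dc (etrans (esym detE) (esym fd)).
split.
  have [dc fd] := commutator_det p_monic size_p ip q_monic size_q iq c0 fE psiE mg mmi gmi.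
  exact: conj dc (etrans (esym detE) (esym fd)).
split.
  rewrite cE; have fg0 : fourier (symbol g) 0 = rval g (Some 0).
    exact (fourier0_outer_frac (rnum g) oD).
  have := toeplitz_det_cvg p_monic size_p ip q_monic size_q iq c0 fE psiE mg mmi gmi hE.
  by rewrite detE fg0; apply.
pose k := c * (lead_coef (rden g) / lead_coef (rnum g)).
have k0 : k != 0 by rewrite !mulf_neq0 ?invr_neq0.
have hprod z : (rden f).[z] != 0 -> (rnum g).[z] != 0 ->
    h z = k * (\prod_(a <- A) (z - a) / \prod_(b <- B) (z - b) *
               (\prod_(a <- Z) (z - a) / \prod_(b <- W) (z - b))).
  move=> dz nz; rewrite /h (symbol_div dz nz) /symbol /rval invf_div.
  rewrite (valE _ _ _ eA) (valE _ _ _ eB) (valE _ _ _ eZ) (valE _ _ _ eW).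
  by rewrite /k /c -!mulf_div mulrACA.
have notin (r : {poly R[i]}) s z : lead_coef r != 0 ->
    r = lead_coef r *: \prod_(a <- s) ('X - a%:P) -> {in s, forall b, z != b} -> r.[z] != 0.
  move=> r0 er zs; apply/negP; rewrite -/(root r z) -(rootsE _ _ r0 er) => /zs.
  by rewrite eqxx.
split.
  apply: (log_branch_exists k0 sAB hA hB hZ hW) => z zB zW.
  by apply: hprod; [exact: notin ldf eB zB|exact: notin lng eW zW].
move=> L bL S; have hcirc t : h (cis t) = k * (\prod_(a <- A) (cis t - a) / \prod_(b <- B) (cis t - b) *
               (\prod_(a <- Z) (cis t - a) / \prod_(b <- W) (cis t - b))).
  by apply: hprod; [exact: inner_poly_neq0|exact: outer_poly_neq0].
have [l cl el] := szego_sum_limit k0 hA hB hZ hW hcirc bL.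
split; first by apply/cvg_ex; exists l.
rewrite (cvgC_lim cl) el resE.
have nz (s : seq R[i]) : {in s, forall b, 1 < abs2 b} -> {in s, forall b, b != 0}.
  by move=> hs b /hs /abs2_gt1_neq0.
pose e := lead_coef (rnum g) / lead_coef (rden g) * (\prod_(b <- W) (- b) / \prod_(b <- Z) (- b)).
have gE a : symbol g a = e * (\prod_(b <- W) (1 - a / b) / \prod_(b <- Z) (1 - a / b)).
  rewrite /symbol /rval (valE _ _ _ eZ) (valE _ _ _ eW).
  by rewrite (prod_outer_factor _ (nz _ hZ)) (prod_outer_factor _ (nz _ hW)) /e -!mulf_div mulrA.
have e0 : e != 0 by move: g0; rewrite gE mulf_eq0 negb_or => /andP[].
clearbody e.
rewrite !(eq_bigr _ (fun a _ => gE a)) !big_split /= !prodr_const_size sAB.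
by rewrite -mulf_div mulfV ?expf_neq0 // mul1r.
Qed.
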